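(* The sequence $$\mathbb{R}\hookrightarrow S^n_h \xrightarrow{\ \nabla\ } \mathbf{S}^e_h \xrightarrow{\ \operatorname{curl}\ } \mathbf{S}^f_h \xrightarrow{\ \operatorname{div}\ } Q_h \to 0$$ (with $\nabla$, $\operatorname{curl}$, $\operatorname{div}$ taken element by element on $\mathcal{T}_h$) is a complex; that is, $\mathbb{R}\subset S^n_h$, each operator maps its space into the next one, and the composition of any two consecutive maps is zero.
   Context: Geometry and mesh. $\Omega\subset\mathbb{R}^3$ is a cubic domain separated by a smooth interface surface $\Gamma$ into subdomains $\Omega^-$ and $\Omega^+$. $\alpha,\beta$ are positive piecewise constants, $\alpha=\alpha^\pm$, $\beta=\beta^\pm$ in $\Omega^\pm$. $\mathcal{T}_h$ is a conforming shape-regular tetrahedral mesh of $\Omega$, not fitted to $\Gamma$, obtained by partitioning each cube of a Cartesian mesh into tetrahedra, each of which is either trirectangular (three mutually orthogonal faces) or regular. $\mathcal{N}_h,\mathcal{E}_h,\mathcal{F}_h$ are the sets of its nodes, edges and faces; $\mathcal{N}_K$ is the set of vertices of $K$. $\varphi^\Gamma$ is the signed-distance level-set function of $\Gamma$, $\varphi^\Gamma_h$ is its continuous piecewise linear nodal interpolant on $\mathcal{T}_h$, and $\Gamma_h=\{\varphi^\Gamma_h=0\}$, which cuts $\Omega$ into $\Omega_h^\pm$. $K\in\mathcal{T}_h$ is an interface element if $\min_{\mathcal{N}_K}\varphi^\Gamma_h\cdot\max_{\mathcal{N}_K}\varphi^\Gamma_h<0$; $\mathcal{T}_h^i$ is the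 set of interface elements and $\mathcal{T}_h^n=\mathcal{T}_h\setminus\mathcal{T}_h^i$. For $K\in\mathcal{T}_h^i$: $\Gamma_h^K=\Gamma_h\cap K$ (planar), $K_h^\pm=K\cap\Omega_h^\pm$, and $\mathbf{x}_K$ is a fixed point of $\Gamma_h^K$. $\alpha_h=\alpha^\pm$ and $\beta_h=\beta^\pm$ in $\Omega_h^\pm$. Local IFE spaces. For $K\in\mathcal{T}^i_h$ let $\mathbf{A}_h(K)$ be the space of $\mathbf{c}$ that are constant vectors on each of $K_h^+$ and $K_h^-$ with $\mathbf{c}\in\mathbf{H}(\operatorname{div};K)$ and $\alpha_h\mathbf{c}\in\mathbf{H}(\operatorname{curl};K)$; let $\mathbf{B}_h(K)$ be the space of such piecewise constant $\mathbf{c}$ with $\mathbf{c}\in\mathbf{H}(\operatorname{curl};K)$ and $\beta_h\mathbf{c}\in\mathbf{H}(\operatorname{div};K)$. Define $S^n_h(K)=\{\mathbf{b}\cdot(\mathbf{x}-\mathbf{x}_K)+c:\mathbf{b}\in\mathbf{B}_h(K),\,c\in\mathbb{R}\}$, $\mathbf{S}^e_h(K)=\{\mathbf{a}\times(\mathbf{x}-\mathbf{x}_K)+\mathbf{b}:\mathbf{a}\in\mathbf{A}_h(K),\,\mathbf{b}\in\mathbf{B}_h(K)\}$, $\mathbf{S}^f_h(K)=\{c(\mathbf{x}-\mathbf{x}_K)+\mathbf{a}:c\in\mathbb{R},\,\mathbf{a}\in\mathbf{A}_h(K)\}$. These lie in $H^1(K)$, $\mathbf{H}(\operatorname{curl};K)$,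 $\mathbf{H}(\operatorname{div};K)$ respectively. Global IFE spaces. $\mathcal{ND}_0(K)=\{\mathbf{a}\times\mathbf{x}+\mathbf{b}:\mathbf a,\mathbf b\in\mathbb{R}^3\}$, $\mathcal{RT}_0(K)=\{c\,\mathbf{x}+\mathbf{a}:c\in\mathbb{R},\mathbf{a}\in\mathbb{R}^3\}$. $S^n_h$: all $v_h\in L^2(\Omega)$ with $v_h|_K\in S^n_h(K)$ for $K\in\mathcal{T}^i_h$, $v_h|_K\in\mathbb{P}_1(K)$ for $K\in\mathcal{T}^n_h$, and $v_h$ continuous at every node in $\mathcal{N}_h$. $\mathbf{S}^e_h$: all $\mathbf{v}_h\in [L^2(\Omega)]^3$ with $\mathbf{v}_h|_K\in\mathbf{S}^e_h(K)$ for $K\in\mathcal{T}^i_h$, $\mathbf{v}_h|_K\in\mathcal{ND}_0(K)$ for $K\in\mathcal{T}^n_h$, and $\int_e(\mathbf{v}_h|_{K_1}-\mathbf{v}_h|_{K_2})\cdot\mathbf{t}\,ds=0$ for all $e\in\mathcal{E}_h$ and all $K_1,K_2$ sharing $e$ ($\mathbf{t}$ a unit tangent to $e$). $\mathbf{S}^f_h$: all $\mathbf{v}_h\in [L^2(\Omega)]^3$ with $\mathbf{v}_h|_K\in\mathbf{S}^f_h(K)$ for $K\in\mathcal{T}^i_h$, $\mathbf{v}_h|_K\in\mathcal{RT}_0(K)$ for $K\in\mathcal{T}^n_h$, and $\int_F[\mathbf{v}_h\cdot\mathbf{n}]\,ds=0$ for all interior faces $F\in\mathcal{F}_h$ ($[\cdot]$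 the jump across $F$). $Q_h$: piecewise constants on $\mathcal{T}_h$. *)

(* Defs.v *)
From HB Require Import structures.
From mathcomp Require Import all_boot all_order all_algebra.
From mathcomp Require Import all_classical all_reals all_analysis.

Set Implicit Arguments.
Unset Strict Implicit.
Unset Printing Implicit Defensive.
Import Order.TTheory GRing.Theory Num.Theory.
Import numFieldNormedType.Exports.
Local Open Scope classical_set_scope.
Local Open Scope ring_scope.

Section Euclidean.
Context {R : realType}.
Notation V3 := 'rV[R]_3.

Definition dot (u v : V3) : R := \sum_(i < 3) u 0 i * v 0 i.

(* The library norm on 'rV[R]_3 is the sup norm. *)
Definition enorm (u : V3) : R := Num.sqrt (dot u u).

(* Index arithmetic in 'I_3 is modulo 3. *)
Definition cross (u v : V3) : V3 :=
  \row_(i < 3) (u 0 (i + 1) * v 0 (i + 2) - u 0 (i + 2) * v 0 (i + 1)).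

Definition dist (x : V3) (A : set V3) : R := inf [set enorm (x - y) | y in A].

Definition partial (i : 'I_3) (f : V3 -> R) (x : V3) : R := 'D_(delta_mx 0 i) f x.

Definition grad (f : V3 -> R) (x : V3) : V3 := \row_(i < 3) partial i f x.

Definition curl (F : V3 -> V3) (x : V3) : V3 :=
  \row_(i < 3) (partial (i + 1) (fun y => F y 0 (i + 2)) x
              - partial (i + 2) (fun y => F y 0 (i + 1)) x).

Definition iter_partial (s : seq 'I_3) (f : V3 -> R) : V3 -> R := foldr partial f s.

Definition smooth (f : V3 -> R) : Prop :=
  forall s : seq 'I_3, continuous (iter_partial s f) /\
    forall i x, derivable (iter_partial s f) x (delta_mx 0 i).

Definition smooth_surface (A : set V3) : Prop :=
  forall x, A x -> exists (U : set V3) (f : V3 -> R),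
    [/\ open U, U x, smooth f, grad f x != 0 & forall y, U y -> (A y <-> f y = 0)].

(* Lebesgue measure on R^3; 'rV[R]_3 has no measurable structure of its own,
   so measurability and integration go through the coordinate triples. *)
Definition leb3 := ((@lebesgue_measure R \x @lebesgue_measure R) \x @lebesgue_measure R)%E.

Definition vec3 (p : R * R * R) : V3 := \row_(i < 3) [:: p.1.1; p.1.2; p.2]`_i.

Definition int3 (D : set V3) (f : V3 -> R) : R :=
  \int[leb3]_(p in vec3 @^-1` D) f (vec3 p).

Definition ae_on (D : set V3) (P : V3 -> Prop) : Prop :=
  {ae leb3, forall p, D (vec3 p) -> P (vec3 p)}.

Definition L2 (D : set V3) (f : V3 -> R) : Prop :=
  measurable_fun (vec3 @^-1` D)
    (fun p : measurableTypeR R * measurableTypeR R * measurableTypeR R => f (vec3 p)) /\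
  (\int[leb3]_(p in vec3 @^-1` D) ((f (vec3 p) ^+ 2)%:E) < +oo)%E.

Definition L2v (D : set V3) (F : V3 -> V3) : Prop :=
  forall i, L2 D (fun x => F x 0 i).

Definition seg_int (p q : V3) (f : V3 -> R) : R :=
  enorm (q - p) * \int[@lebesgue_measure R]_(s in `[0, 1]) f (p + s *: (q - p)).

Definition tri_int (p q r : V3) (f : V3 -> R) : R :=
  enorm (cross (q - p) (r - p)) *
  \int[(@lebesgue_measure R \x @lebesgue_measure R)%E]_(s in
      [set s : R * R | [/\ 0 <= s.1, 0 <= s.2 & s.1 + s.2 <= 1]])
    f (p + s.1 *: (q - p) + s.2 *: (r - p)).

Definition unit_tangent (p q : V3) : V3 := (enorm (q - p))^-1 *: (q - p).

Definition unit_normal (p q r : V3) : V3 :=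
  (enorm (cross (q - p) (r - p)))^-1 *: cross (q - p) (r - p).

Definition test_fun (U : set V3) (phi : V3 -> R) : Prop :=
  smooth phi /\
  exists C : set V3, [/\ compact C, C `<=` U & forall x, ~ C x -> phi x = 0].

Definition test_field (U : set V3) (Phi : V3 -> V3) : Prop :=
  forall i, test_fun U (fun x => Phi x 0 i).

Definition weak_grad (U : set V3) (u : V3 -> R) (w : V3 -> V3) : Prop :=
  forall phi, test_fun U phi -> forall i : 'I_3,
    int3 U (fun x => u x * partial i phi x) = - int3 U (fun x => w x 0 i * phi x).

Definition weak_curl (U : set V3) (u w : V3 -> V3) : Prop :=
  forall Phi, test_field U Phi ->
    int3 U (fun x => dot (u x) (curl Phi x)) = int3 U (fun x => dot (w x) (Phi x)).

Definition weak_div (U : set V3) (u : V3 -> V3) (q : V3 -> R) : Prop :=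
  forall phi, test_fun U phi ->
    int3 U (fun x => dot (u x) (grad phi x)) = - int3 U (fun x => q x * phi x).

Definition Hcurl (U : set V3) (u : V3 -> V3) : Prop :=
  L2v U u /\ exists w, L2v U w /\ weak_curl U u w.

Definition Hdiv (U : set V3) (u : V3 -> V3) : Prop :=
  L2v U u /\ exists q, L2 U q /\ weak_div U u q.

Definition hull (v : 'I_4 -> V3) (I : {set 'I_4}) : set V3 :=
  [set x | exists l : 'I_4 -> R,
     [/\ forall i, 0 <= l i, forall i, i \notin I -> l i = 0,
         \sum_(i < 4) l i = 1 & x = \sum_(i < 4) l i *: v i]].

Definition tetra (v : 'I_4 -> V3) : set V3 := hull v [set: 'I_4].

(* lift j i, i < 3, enumerates the vertices of the face opposite to v j. *)
Definition face_normal (v : 'I_4 -> V3) (j : 'I_4) : V3 :=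
  cross (v (lift j 1) - v (lift j 0)) (v (lift j 2) - v (lift j 0)).

Definition nondegenerate (v : 'I_4 -> V3) : Prop :=
  dot (v 1 - v 0) (cross (v 2 - v 0) (v 3 - v 0)) != 0.

Definition trirectangular (v : 'I_4 -> V3) : Prop :=
  exists k : 'I_4, forall i j, i != k -> j != k -> i != j ->
    dot (face_normal v i) (face_normal v j) = 0.

Definition regular (v : 'I_4 -> V3) : Prop :=
  forall i j k l, i != j -> k != l -> enorm (v i - v j) = enorm (v k - v l).

Definition shape_regular_tetra (sigma : R) (v : 'I_4 -> V3) : Prop :=
  exists (x : V3) (r : R), [/\ 0 < r,
    forall y, enorm (y - x) <= r -> tetra v y &
    forall y z, tetra v y -> tetra v z -> enorm (y - z) <= sigma * r].

Definition open_cube (o : V3) (len : R) : set V3 :=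
  [set x | forall i, o 0 i < x 0 i < o 0 i + len].

Definition closed_cube (o : V3) (len : R) : set V3 :=
  [set x | forall i, o 0 i <= x 0 i <= o 0 i + len].

Definition affine_on (D : set V3) (f : V3 -> R) : Prop :=
  exists (g : V3) (c : R), forall x, D x -> f x = dot g x + c.

End Euclidean.

Record ife_setting (R : realType) := IfeSetting {
  corner : 'rV[R]_3;
  side : R;
  side_gt0 : 0 < side;
  Omega := open_cube corner side;
  Gamma : set 'rV[R]_3;
  Omega_m : set 'rV[R]_3;
  Omega_p : set 'rV[R]_3;
  Gamma_smooth : smooth_surface Gamma;
  Omega_m_open : open Omega_m;
  Omega_p_open : open Omega_p;
  Omega_m_neq0 : Omega_m !=set0;
  Omega_p_neq0 : Omega_p !=set0;
  Omega_decomp : Omega = Omega_m `|` Gamma `|` Omega_p;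
  Omega_mp_disj : Omega_m `&` Omega_p = set0;
  Omega_mG_disj : Omega_m `&` Gamma = set0;
  Omega_pG_disj : Omega_p `&` Gamma = set0;
  Gamma_interface : Gamma `<=` closure Omega_m `&` closure Omega_p;
  alpha_m : R;
  alpha_p : R;
  beta_m : R;
  beta_p : R;
  alpha_m_gt0 : 0 < alpha_m;
  alpha_p_gt0 : 0 < alpha_p;
  beta_m_gt0 : 0 < beta_m;
  beta_p_gt0 : 0 < beta_p;
  ncell : nat;
  ncell_gt0 : (0 < ncell)%N;
  elt : finType;
  vtx : elt -> 'I_4 -> 'rV[R]_3;
  cell (k : 'I_3 -> 'I_ncell) : set 'rV[R]_3 :=
    closed_cube (corner + \row_i ((k i)%:R * (side / ncell%:R))) (side / ncell%:R);
  elt_nondegenerate : forall K, nondegenerate (vtx K);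
  elt_shape : forall K, trirectangular (vtx K) \/ regular (vtx K);
  elt_in_cell : forall K, exists k, tetra (vtx K) `<=` cell k;
  cell_covered : forall k,
    cell k `<=` \bigcup_(K in [set K | tetra (vtx K) `<=` cell k]) tetra (vtx K);
  elt_disjoint : forall K1 K2, K1 != K2 ->
    (tetra (vtx K1))° `&` (tetra (vtx K2))° = set0;
  elt_conforming : forall K1 K2,
    tetra (vtx K1) `&` tetra (vtx K2) =
    hull (vtx K1) [set i | [exists j, vtx K1 i == vtx K2 j]];
  sigma : R;
  elt_shape_regular : forall K, shape_regular_tetra sigma (vtx K);
  phi : 'rV[R]_3 -> R;
  phi_m : forall x, Omega_m x -> phi x = - dist x Gamma;
  phi_G : forall x, Gamma x -> phi x = 0;
  phi_p : forall x, Omega_p x -> phi x = dist x Gamma;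
  phi_continuous : {within closure Omega, continuous phi};
  phi_h : 'rV[R]_3 -> R;
  phi_h_continuous : {within closure Omega, continuous phi_h};
  phi_h_affine : forall K, affine_on (tetra (vtx K)) phi_h;
  phi_h_nodal : forall K i, phi_h (vtx K i) = phi (vtx K i);
  is_interface (K : elt) : bool :=
    \big[Order.min/phi_h (vtx K 0)]_(i < 4) phi_h (vtx K i) *
    \big[Order.max/phi_h (vtx K 0)]_(i < 4) phi_h (vtx K i) < 0;
  x_K : elt -> 'rV[R]_3;
  x_K_in : forall K, is_interface K -> tetra (vtx K) (x_K K) /\ phi_h (x_K K) = 0
}.

Section Spaces.
Context {R : realType} (G : ife_setting R).
Notation V3 := 'rV[R]_3.
Notation elt := (elt G).

(* Elements carry their closure for traces on nodes, edges and faces, and their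
   interior as the open set on which they are domains of functions. *)
Definition elt_cl (K : elt) : set V3 := tetra (vtx K).
Definition elt_op (K : elt) : set V3 := (elt_cl K)°.

Definition is_node (K : elt) (p : V3) : Prop := exists i, p = vtx K i.

(* The null set Gamma_h is attached to the minus side, so that the functions
   below are defined at every point of the closed element. *)
Definition elt_p (K : elt) : set V3 := [set x | elt_cl K x /\ 0 < phi_h G x].
Definition elt_m (K : elt) : set V3 := [set x | elt_cl K x /\ phi_h G x <= 0].
Definition alpha_h (x : V3) : R := if 0 < phi_h G x then alpha_p G else alpha_m G.
Definition beta_h (x : V3) : R := if 0 < phi_h G x then beta_p G else beta_m G.

Definition piecewise_const (K : elt) (c : V3 -> V3) : Prop :=
  (exists cp, forall x, elt_p K x -> c x = cp) /\
  (exists cm, forall x, elt_m K x -> c x = cm).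

Definition A_loc (K : elt) (c : V3 -> V3) : Prop :=
  [/\ piecewise_const K c, Hdiv (elt_op K) c &
      Hcurl (elt_op K) (fun x => alpha_h x *: c x)].

Definition B_loc (K : elt) (c : V3 -> V3) : Prop :=
  [/\ piecewise_const K c, Hcurl (elt_op K) c &
      Hdiv (elt_op K) (fun x => beta_h x *: c x)].

Definition Sn_loc (K : elt) (u : V3 -> R) : Prop :=
  exists (b : V3 -> V3) (c : R), B_loc K b /\
    forall x, elt_cl K x -> u x = dot (b x) (x - x_K K) + c.

Definition Se_loc (K : elt) (u : V3 -> V3) : Prop :=
  exists a b : V3 -> V3, [/\ A_loc K a, B_loc K b &
    forall x, elt_cl K x -> u x = cross (a x) (x - x_K K) + b x].

Definition Sf_loc (K : elt) (u : V3 -> V3) : Prop :=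
  exists (c : R) (a : V3 -> V3), A_loc K a /\
    forall x, elt_cl K x -> u x = c *: (x - x_K K) + a x.

Definition P1_loc (K : elt) (u : V3 -> R) : Prop := affine_on (elt_cl K) u.

Definition ND0_loc (K : elt) (u : V3 -> V3) : Prop :=
  exists a b : V3, forall x, elt_cl K x -> u x = cross a x + b.

Definition RT0_loc (K : elt) (u : V3 -> V3) : Prop :=
  exists (c : R) (a : V3), forall x, elt_cl K x -> u x = c *: x + a.

(* In the global spaces, v is a representative of a class in L^2(Omega) and
   tr K is the member of the local space that v agrees with a.e. on K; it
   supplies the traces of v|_K on the nodes, edges and faces of K. *)
Definition Sn (v : V3 -> R) : Prop :=
  L2 (Omega G) v /\
  exists tr : elt -> V3 -> R,
    [/\ forall K, ae_on (elt_op K) (fun x => v x = tr K x),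
        forall K, if is_interface K then Sn_loc K (tr K) else P1_loc K (tr K) &
        forall K1 K2 p, is_node K1 p -> is_node K2 p -> tr K1 p = tr K2 p].

Definition Se (v : V3 -> V3) : Prop :=
  L2v (Omega G) v /\
  exists tr : elt -> V3 -> V3,
    [/\ forall K, ae_on (elt_op K) (fun x => v x = tr K x),
        forall K, if is_interface K then Se_loc K (tr K) else ND0_loc K (tr K) &
        forall K1 K2 p q, p <> q ->
          is_node K1 p -> is_node K1 q -> is_node K2 p -> is_node K2 q ->
          seg_int p q (fun x => dot (tr K1 x - tr K2 x) (unit_tangent p q)) = 0].

Definition Sf (v : V3 -> V3) : Prop :=
  L2v (Omega G) v /\
  exists tr : elt -> V3 -> V3,
    [/\ forall K, ae_on (elt_op K) (fun x => v x = tr K x),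
        forall K, if is_interface K then Sf_loc K (tr K) else RT0_loc K (tr K) &
        forall K1 K2 p q r, K1 != K2 -> p <> q -> q <> r -> p <> r ->
          is_node K1 p -> is_node K1 q -> is_node K1 r ->
          is_node K2 p -> is_node K2 q -> is_node K2 r ->
          tri_int p q r (fun x => dot (tr K1 x) (unit_normal p q r)
                                - dot (tr K2 x) (unit_normal p q r)) = 0].

Definition Qh (q : V3 -> R) : Prop :=
  L2 (Omega G) q /\ forall K, exists c : R, ae_on (elt_op K) (fun x => q x = c).

(* Weak derivatives are determined only up to a null set, hence relations
   between representatives; maps_into quantifies over all representatives. *)
Definition grad_h (v : V3 -> R) (w : V3 -> V3) : Prop :=
  L2v (Omega G) w /\ forall K, weak_grad (elt_op K) v w.

Definition curl_h (v w : V3 -> V3) : Prop :=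
  L2v (Omega G) w /\ forall K, weak_curl (elt_op K) v w.

Definition div_h (v : V3 -> V3) (q : V3 -> R) : Prop :=
  L2 (Omega G) q /\ forall K, weak_div (elt_op K) v q.

Definition maps_into (A B : Type) (S : A -> Prop) (D : A -> B -> Prop)
    (T : B -> Prop) : Prop :=
  forall v, S v -> (exists w, D v w) /\ (forall w, D v w -> T w).

Definition ae0 (V : zmodType) (f : V3 -> V) : Prop :=
  ae_on (Omega G) (fun x => f x = 0).

End Spaces.

(* Main.v *)
From HB Require Import structures.
Require Import Defs.
From mathcomp Require Import all_boot all_order all_algebra.
From mathcomp Require Import all_classical all_reals all_analysis.
From mathcomp Require Import measurable_realfun ring lra.

(** On an element cut by the discrete interface, a member of a local space is
    built from vector fields that take one value on each side of a plane
    [dot g (x - z) = 0] ([pw g z b l]: the value [b], with the jump [l]). The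
    interface conditions act on the jump alone: membership in H(curl) forces
    [cross g l = 0] and membership in H(div) forces [dot g l = 0] ([Hcurl_pw],
    [Hdiv_pw]), because a directional derivative of the indicator of a
    half-space is carried by the bounding plane, so that it vanishes as soon as
    it is square integrable ([jump_test0]), which happens in tangential
    directions only ([jump_normal0]). Conversely these conditions make the
    elementwise derivatives the weak ones:
    the gradient of [b . (x - z) + c] is [b], the curl of [a x (x - z) + b] is
    [2 a], and the divergence of [c (x - z) + a] is [3 c] ([weak_grad_pw],
    [weak_curl_pw], [weak_div_pw]). These derivatives belong to the next local
    space, and the next operator annihilates them.

    The degrees of freedom are transported by the classical integral theorems,
    which hold across the interface under the same two conditions: the
    circulation of [b] along an edge is the difference of the nodal values of
    [b . (x - z) + c] ([edge_circ_pw]), and the flux of [2 a] through a face is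
    the circulation of [a x (x - z) + b] along the boundary of the face
    ([triangle_circ_pw]). So continuity at the nodes gives equal circulations
    on shared edges, and these give equal fluxes through shared faces.

    Every identity for a field with a jump is the limit of the same identity for
    smooth fields in which the indicator of the half-space is replaced by
    [flat 1 (n t)], with [flat 1 s = exp (- 1 / s)] for [s > 0] and [0]
    otherwise, and [t] the level function of the plane. Differentiating the
    cutoff produces the normal component, or the tangential trace, of the jump;
    the interface condition puts a factor [t] into it, and [n t flat 1' (n t)]
    is bounded and tends to [0] pointwise, so that dominated convergence
    applies.

    The weak operators determine their values almost everywhere
    ([weak_grad_unique] and its analogues), so what holds for the piecewise
    derivatives holds for every representative. Functions given element by
    element define functions on the whole domain because the interiors of the
    elements are disjoint and exhaust it up to the planes of the faces, which
    are null sets ([ae_Omega_elt_op]). *)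

Set Implicit Arguments.
Unset Strict Implicit.
Unset Printing Implicit Defensive.
Import Order.TTheory GRing.Theory Num.Theory.
Import numFieldNormedType.Exports.
Local Open Scope classical_set_scope.
Local Open Scope ring_scope.

(** * Smooth cutoff functions on the line *)

Section Flat.
Context {R : realType}.
Implicit Types (P : {poly R}) (s u : R).

(** The functions [P(1/s) exp (- 1/s)], extended by [0] to [s <= 0]. They are
    bounded, and the family is closed under differentiation. *)
Definition flat P s : R := if 0 < s then P.[s^-1] * expR (- s^-1) else 0.

Lemma flat_le0 P s : s <= 0 -> flat P s = 0.
Proof. by move=> s0; rewrite /flat ltNge s0. Qed.

Lemma exprn_le_expR n u : 0 <= u -> u ^+ n <= n`!%:R * expR u.
Proof.
case: n => [|n] u0; first by rewrite expr0 fact0 mul1r -expR0 ler_expR.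
rewrite mulrC -ler_pdivrMr ?ltr0n ?fact_gt0//.
by apply: le_trans (expR_ge1Dxn n u0); rewrite lerDr.
Qed.

Lemma horner_expR_bounded P :
  exists2 C, 0 <= C & forall u, 0 <= u -> `|P.[u] * expR (- u)| <= C.
Proof.
suff H n : exists2 C, 0 <= C & forall u, 0 <= u -> `|P.[u]| * u ^+ n <= C * expR u.
  have [C C0 HC] := H 0; exists C => // u u0; have := HC u u0.
  by rewrite expr0 mulr1 normrM (ger0_norm (expR_ge0 _)) expRN ler_pdivrMr// expR_gt0.
elim/poly_ind: P n => [|P c IH] n.
  by exists 0 => // u _; rewrite horner0 normr0 !mul0r.
have [C C0 HC] := IH n.+1.
exists (C + `|c| * n`!%:R); first by rewrite addr_ge0// mulr_ge0.
move=> u u0; rewrite hornerMXaddC mulrDl.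
apply: (@le_trans _ _ ((`|P.[u]| * u + `|c|) * u ^+ n)).
  rewrite ler_wpM2r ?exprn_ge0// (le_trans (ler_normD _ _))// normrM (ger0_norm u0) lexx//.
rewrite mulrDl lerD//; first by rewrite -mulrA -exprS HC.
by rewrite -mulrA ler_wpM2l// exprn_le_expR.
Qed.

Lemma flat_bounded P : exists2 C, 0 <= C & forall s, `|flat P s| <= C.
Proof.
have [C C0 HC] := horner_expR_bounded P; exists C => // s.
by rewrite /flat; case: ltP => s0; rewrite ?normr0// HC// invr_ge0 ltW.
Qed.

Lemma flatX P s : flat (P * 'X) s * s = flat P s.
Proof.
rewrite /flat; case: ltP => s0; last by rewrite mul0r.
by rewrite hornerM hornerX; field; rewrite gt_eqF.
Qed.

Lemma flat_lipschitz0 P : exists2 C, 0 <= C & forall s, `|flat P s| <= C * `|s|.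
Proof.
have [C C0 HC] := flat_bounded (P * 'X); exists C => // s.
by rewrite -flatX normrM ler_wpM2r.
Qed.

(** The polynomial of the derivative of [flat P]. *)
Definition dflat P : {poly R} := 'X^2 * (P - P^`()).

Lemma is_derive_flat P s : is_derive s 1 (flat P) (flat (dflat P) s).
Proof.
have [s0|s0|->] := ltrgtP s 0.
- rewrite (flat_le0 _ (ltW s0)).
  apply: (@near_eq_is_derive _ _ _ (cst 0)).
  by near=> x; rewrite flat_le0// ltW//; near: x; exact: lt_nbhsl.
- pose F := (horner P \o GRing.inv) * (expR \o (fun x => - x^-1)).
  have s1 : s != 0 by rewrite gt_eqF.
  apply: (@near_eq_is_derive _ _ _ F).
    near=> x; rewrite /flat ifT//.
    by near: x; exact: lt_nbhsr.
  have dV : is_derive s 1 (GRing.inv : R -> R) (- s ^- 2).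
    by have := @is_deriveV _ id s 1 1 s1 (is_derive_id _ _); rewrite /GRing.scale/= mulr1.
  have dN : is_derive s 1 (fun x : R => - x^-1) (- - s ^- 2) := is_deriveN dV.
  apply: is_derive_eq; rewrite /flat s0 /dflat !hornerE /=.
  by rewrite /GRing.scale/=; field.
- have H : (h^-1 *: ((flat P \o shift 0) (h *: 1) - flat P 0)) @[h --> 0^'] --> flat (dflat P) 0.
    rewrite (flat_le0 (dflat P))//; have [C C0 HC] := flat_lipschitz0 (P * 'X).
    have C1 : 0 < C + 1 by rewrite ltr_wpDl.
    apply/cvgr0Pnorm_le => e e0; near=> h; have h0 : h != 0 by near: h; exact: nbhs_dnbhs_neq.
    rewrite /= addr0 (flat_le0 P (lexx 0)) subr0 /GRing.scale/= mulr1.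
    rewrite -flatX mulrCA mulVf// mulr1.
    apply: (le_trans (HC h)).
    apply: (@le_trans _ _ ((C + 1) * `|h|)); first by rewrite ler_wpM2r// lerDl.
    rewrite -ler_pdivlMl//; near: h.
    by apply: (@dnbhs0_le R R^o); rewrite mulr_gt0// invr_gt0.
  by split; [exact: (cvgP _ H)|exact: (cvg_lim _ H)].
Unshelve. all: by end_near. Qed.

Lemma continuous_flat P : continuous (flat P).
Proof.
move=> x; apply: differentiable_continuous; apply/derivable1_diffP.
by case: (is_derive_flat P x).
Qed.

Lemma flat1_ge0 s : 0 <= flat 1 s.
Proof. by rewrite /flat; case: ifP => // _; rewrite hornerC mul1r expR_ge0. Qed.

Lemma flat1_gt0 s : (0 < flat 1 s) = (0 < s).
Proof. by rewrite /flat; case: ifP; rewrite ?ltxx// hornerC mul1r expR_gt0. Qed.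

Lemma flat1_le1 s : flat 1 s <= 1.
Proof.
rewrite /flat; case: ifP => // s0.
by rewrite hornerC mul1r -expR0 ler_expR oppr_le0 invr_ge0 ltW.
Qed.

(** The cutoffs converge to the indicator of the positive reals. *)
Lemma cvg_flat1 s : flat 1 (n.+1%:R * s) @[n --> \oo] --> ((0 < s)%R%:R : R).
Proof.
case: ltP => s0; last first.
  apply: (@cvg_trans _ (cst (0 : R) @ \oo)); last exact: cvg_cst.
  by apply: near_eq_cvg; near=> n; rewrite flat_le0// mulr_ge0_le0.
have -> : (fun n => flat 1 (n.+1%:R * s)) = fun n => expR (- (s^-1 * n.+1%:R^-1)).
  by apply/funext => n; rewrite /flat mulr_gt0// hornerC mul1r invfM mulrC.
rewrite -[true%:R]expR0; apply: continuous_cvg; first exact: continuous_expR.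
rewrite -oppr0; apply: cvgN; rewrite -(mulr0 s^-1); apply: cvgM; first exact: cvg_cst.
exact: cvg_harmonic.
Unshelve. all: by end_near. Qed.

(** Together with [cvg_flatX] and [flat_bounded], this controls the error
    [n t flat 1' (n t)] made by the cutoff. *)
Lemma flat_mulX s : s * flat (dflat 1) s = flat 'X s.
Proof.
by rewrite -(flatX 'X) mulrC /dflat derivC subr0 mulr1 expr2.
Qed.

Lemma cvg_flatX s : flat 'X (n.+1%:R * s) @[n --> \oo] --> (0 : R).
Proof.
have [s0|s0] := leP s 0.
  apply: (@cvg_trans _ (cst (0 : R) @ \oo)); last exact: cvg_cst.
  by apply: near_eq_cvg; near=> n; rewrite flat_le0// mulr_ge0_le0.
have -> : (fun n => flat 'X (n.+1%:R * s)) =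
    fun n => s^-1 * n.+1%:R^-1 * flat 1 (n.+1%:R * s).
  apply/funext => n; rewrite -(flatX 1) mul1r mulrCA -invfM mulrC.
  by rewrite mulVf ?mulr1// mulf_neq0// gt_eqF.
rewrite -(mul0r ((0 < s)%R%:R)); apply: cvgM; last exact: cvg_flat1.
rewrite -(mulr0 s^-1); apply: cvgM; [exact: cvg_cst|].
exact: cvg_harmonic.
Unshelve. all: by end_near. Qed.

End Flat.

(** * Derivatives along lines and smooth functions *)

Section DirectionalDerivative.
Context {R : realType} {V : normedModType R}.
Implicit Types (f : V -> R) (x v : V).

Lemma derive_line f x v : 'D_v f x = 'D_1 (fun h : R => f (h *: v + x)) 0.
Proof.
rewrite /derive; congr (lim (_ @ 0^')); apply/funext => h /=.
by rewrite addr0 scale0r add0r /GRing.scale/= mulr1.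
Qed.

Lemma is_derive_line f x v df :
  is_derive x v f df <-> is_derive (0 : R) 1 (fun h : R => f (h *: v + x)) df.
Proof.
have [H1 H2] := derivable1P f x v.
split=> -[d e]; split.
- exact: H1.
- by rewrite -derive_line.
- exact: H2.
- by rewrite derive_line.
Qed.

Lemma is_derive_comp1 (g : R -> R) f x v dg df :
  is_derive (f x) 1 g dg -> is_derive x v f df ->
  is_derive x v (g \o f) (dg * df).
Proof.
move=> Hg /is_derive_line Hf; apply/is_derive_line.
apply: (@is_derive1_comp _ g (fun h => f (h *: v + x))) => //.
by rewrite scale0r add0r.
Qed.

End DirectionalDerivative.

Lemma is_derive_along {R : realType} {V : normedModType R} (f : V -> R) (x v : V) (t df : R) :
  is_derive (t *: v + x) v f df -> is_derive t 1 (fun s : R => f (s *: v + x)) df.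
Proof.
move=> /is_derive_line H; apply/is_derive_line.
congr (is_derive _ _ _ _): H; apply/funext => h.
by rewrite [h *: 1]mulr1 scalerDl addrA.
Qed.

Section Smooth.
Context {R : realType}.
Local Notation V3 := 'rV[R]_3.
Implicit Types (f g : V3 -> R) (x v : V3).

Lemma derivable_flat P f x v : derivable f x v -> derivable (flat P \o f) x v.
Proof.
move=> /derivableP H.
by have [] := is_derive_comp1 (is_derive_flat P (f x)) H.
Qed.

Lemma partialD i f g x : derivable f x (delta_mx 0 i) -> derivable g x (delta_mx 0 i) ->
  partial i (f \+ g) x = partial i f x + partial i g x.
Proof. by move=> df dg; rewrite /partial deriveD. Qed.

Lemma partialM i f g x : derivable f x (delta_mx 0 i) -> derivable g x (delta_mx 0 i) ->
  partial i (f \* g) x = f x * partial i g x + partial i f x * g x.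
Proof. by move=> df dg; rewrite /partial (deriveM df dg) [g x *: _]mulrC. Qed.

Lemma partial_flat i P f x : derivable f x (delta_mx 0 i) ->
  partial i (flat P \o f) x = flat (dflat P) (f x) * partial i f x.
Proof.
move=> /derivableP H.
by have [_] := is_derive_comp1 (is_derive_flat P (f x)) H.
Qed.

Lemma partial_cst i (c : R) x : partial i (cst c) x = 0.
Proof. exact: derive_cst. Qed.

Lemma is_derive_coord i v x : is_derive x v (fun y : V3 => y 0 i) (v 0 i).
Proof.
apply/is_derive_line.
have -> : (fun h : R => (h *: v + x) 0 i) = (fun h : R => h * v 0 i + x 0 i).
  by apply/funext => h; rewrite !mxE.
have -> : v 0 i = (v 0 i *: 1 + 0) :> R by rewrite addr0 /GRing.scale/= mulr1.
have := is_deriveD (is_deriveZ (v 0 i) (is_derive_id (0:R) 1)) (is_derive_cst (x 0 i) (0 : R) 1).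
congr (is_derive _ _ _ _); apply/funext => h /=.
by rewrite /GRing.scale/= addr0 mulr1 [h * _]mulrC.
Qed.

Lemma partial_coord i j x : partial i (fun y : V3 => y 0 j) x = (i == j)%:R.
Proof.
rewrite /partial; have [_ ->] := is_derive_coord j (delta_mx 0 i) x.
by rewrite !mxE eqxx eq_sym.
Qed.

(** The smallest class of functions that contains the smooth ones, the
    constants and the coordinates and is closed under sums, products and
    composition with the flat functions; it is stable under partial derivatives. *)
Inductive smoothgen : (V3 -> R) -> Prop :=
| sg_smooth f of smooth f : smoothgen f
| sg_cst c : smoothgen (cst c)
| sg_coord i : smoothgen (fun y => y 0 i)
| sg_add f g of smoothgen f & smoothgen g : smoothgen (f \+ g)
| sg_mul f g of smoothgen f & smoothgen g : smoothgen (f \* g)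
| sg_flat P f of smoothgen f : smoothgen (flat P \o f).

Lemma smooth_partial i f : smooth f -> smooth (partial i f).
Proof. by move=> sf s; have := sf (rcons s i); rewrite /iter_partial foldr_rcons. Qed.

Lemma smoothgen_derivable f : smoothgen f -> forall i x, derivable f x (delta_mx 0 i).
Proof.
elim=> {f} [f sf|c|j|f g _ df _ dg|f g _ df _ dg|P f _ df] i x.
- exact: (sf [::]).2.
- exact: derivable_cst.
- by have [] := is_derive_coord j (delta_mx 0 i) x.
- exact: derivableD.
- exact: derivableM.
- exact: derivable_flat.
Qed.

Lemma smoothgen_continuous f : smoothgen f -> continuous f.
Proof.
elim=> {f} [f sf|c|j|f g _ cf _ cg|f g _ cf _ cg|P f _ cf].
- exact: (sf [::]).1.
- exact: cst_continuous.
- exact: coord_continuous.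
- by move=> x; exact: continuousD (cf x) (cg x).
- by move=> x; exact: continuousM (cf x) (cg x).
- move=> x; apply: continuous_comp; [exact: cf|exact: continuous_flat].
Qed.

Lemma smoothgen_partial i f : smoothgen f -> smoothgen (partial i f).
Proof.
elim=> {f} [f sf|c|j|f g sf df sg dg|f g sf df sg dg|P f sf df].
- exact/sg_smooth/smooth_partial.
- have -> : partial i (cst c) = cst 0 by apply/funext => x; exact: partial_cst.
  exact: sg_cst.
- have -> : partial i (fun y : V3 => y 0 j) = cst (i == j)%:R.
    by apply/funext => x; exact: partial_coord.
  exact: sg_cst.
- have -> : partial i (f \+ g) = partial i f \+ partial i g.
    by apply/funext => x; apply: partialD; exact: smoothgen_derivable.
  exact: sg_add.
- have -> : partial i (f \* g) = (f \* partial i g) \+ (partial i f \* g).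
    by apply/funext => x; apply: partialM; exact: smoothgen_derivable.
  by apply: sg_add; apply: sg_mul.
- have -> : partial i (flat P \o f) = (flat (dflat P) \o f) \* partial i f.
    by apply/funext => x; apply: partial_flat; exact: smoothgen_derivable.
  by apply: sg_mul => //; exact: sg_flat.
Qed.

Lemma smoothgenP f : smoothgen f <-> smooth f.
Proof.
split; last exact: sg_smooth.
move=> sf s; have : smoothgen (iter_partial s f).
  by elim: s => [//|i s IH]; exact: smoothgen_partial.
move=> sg; split; [exact: smoothgen_continuous|exact: smoothgen_derivable].
Qed.

Lemma smooth_cst c : smooth (cst c : V3 -> R).
Proof. exact/smoothgenP/sg_cst. Qed.

Lemma smooth_coord i : smooth (fun y : V3 => y 0 i).
Proof. exact/smoothgenP/sg_coord. Qed.

Lemma smoothD f g : smooth f -> smooth g -> smooth (fun x => f x + g x).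
Proof. by move=> /smoothgenP sf /smoothgenP sg; apply/smoothgenP/sg_add. Qed.

Lemma smoothM f g : smooth f -> smooth g -> smooth (fun x => f x * g x).
Proof. by move=> /smoothgenP sf /smoothgenP sg; apply/smoothgenP/sg_mul. Qed.

Lemma smoothZ c f : smooth f -> smooth (fun x => c * f x).
Proof. by move=> sf; apply: smoothM sf; exact: smooth_cst. Qed.

Lemma smooth_flat P f : smooth f -> smooth (fun x => flat P (f x)).
Proof. by move=> /smoothgenP sf; apply/smoothgenP/sg_flat. Qed.

Lemma smooth_derivable f i x : smooth f -> derivable f x (delta_mx 0 i).
Proof. by move=> sf; exact: (sf [::]).2. Qed.

Lemma smooth_continuous f : smooth f -> continuous f.
Proof. by move=> sf; exact: (sf [::]).1. Qed.

Lemma partial_smoothM i f g x : smooth f -> smooth g ->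
  partial i (fun y => f y * g y) x = f x * partial i g x + partial i f x * g x.
Proof.
by move=> sf sg; apply: (@partialM i f g x); exact: smooth_derivable.
Qed.

Lemma partialZ i (c : R) f x : smooth f -> partial i (fun y => c * f y) x = c * partial i f x.
Proof. by move=> sf; rewrite (@partial_smoothM i (cst c) f x (smooth_cst c) sf) partial_cst mul0r addr0. Qed.

Lemma partial_smooth_flat i P f x : smooth f ->
  partial i (fun y => flat P (f y)) x = flat (dflat P) (f x) * partial i f x.
Proof. by move=> sf; apply: (@partial_flat i P f x); exact: smooth_derivable. Qed.

Lemma smooth_sum I (r : seq I) (F : I -> V3 -> R) : (forall i, smooth (F i)) ->
  smooth (fun x => \sum_(i <- r) F i x).
Proof.
move=> sF; elim: r => [|i r IH].
  by rewrite (_ : (fun x => _) = cst 0); [exact: smooth_cst|apply/funext => x; rewrite big_nil].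
have -> : (fun x => \sum_(j <- i :: r) F j x) = (fun x => F i x + \sum_(j <- r) F j x).
  by apply/funext => x; rewrite big_cons.
exact: smoothD (sF i) IH.
Qed.

Lemma smooth_dot (g : V3) : smooth (fun x => dot g x).
Proof. by apply: smooth_sum => i; apply: smoothZ; exact: smooth_coord. Qed.

Lemma smooth_affine (g x0 : V3) : smooth (fun x => dot g (x - x0)).
Proof.
have -> : (fun x => dot g (x - x0)) = (fun x => dot g x + - dot g x0).
  apply/funext => x; rewrite /dot -sumrN -big_split/=; apply: eq_bigr => i _.
  by rewrite !mxE mulrDr mulrN.
by apply: smoothD; [exact: smooth_dot|exact: smooth_cst].
Qed.

End Smooth.

(** * Vector algebra in coordinates *)

Section Vectors.
Context {R : realType}.
Local Notation V3 := 'rV[R]_3.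
Implicit Types (u v w x y g : V3).

Lemma I3_ind (P : 'I_3 -> Prop) : P 0 -> P 1 -> P 2 -> forall i, P i.
Proof.
move=> P0 P1 P2 [[|[|[|//]]] Hi].
- by have -> : Ordinal Hi = 0 by apply: val_inj.
- by have -> : Ordinal Hi = 1 by apply: val_inj.
- by have -> : Ordinal Hi = 2 by apply: val_inj.
Qed.

Lemma sum3E (V : nmodType) (F : 'I_3 -> V) : \sum_(i < 3) F i = F 0 + F 1 + F 2.
Proof.
rewrite !big_ord_recl big_ord0 addr0 addrA; congr (F _ + F _ + F _); exact: val_inj.
Qed.

Lemma dotE u v : dot u v = u 0 0 * v 0 0 + u 0 1 * v 0 1 + u 0 2 * v 0 2.
Proof. exact: sum3E. Qed.

Lemma crossE u v :
  ((cross u v 0 0 = u 0 1 * v 0 2 - u 0 2 * v 0 1) *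
   (cross u v 0 1 = u 0 2 * v 0 0 - u 0 0 * v 0 2) *
   (cross u v 0 2 = u 0 0 * v 0 1 - u 0 1 * v 0 0))%type.
Proof.
have E1 : (1 + 1 : 'I_3) = 2 by apply: val_inj.
have E2 : (1 + 2 : 'I_3) = 0 by apply: val_inj.
have E3 : (2 + 1 : 'I_3) = 0 by apply: val_inj.
have E4 : (2 + 2 : 'I_3) = 1 by apply: val_inj.
by split; [split|]; rewrite !mxE ?add0r ?E1 ?E2 ?E3 ?E4.
Qed.

Lemma row3P u v : u 0 0 = v 0 0 -> u 0 1 = v 0 1 -> u 0 2 = v 0 2 -> u = v.
Proof. by move=> *; apply/rowP; elim/I3_ind. Qed.

(* Coordinates of vector expressions. *)
Lemma addV u v (i : 'I_3) : (u + v) 0 i = u 0 i + v 0 i. Proof. by rewrite mxE. Qed.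
Lemma oppV u (i : 'I_3) : (- u) 0 i = - u 0 i. Proof. by rewrite mxE. Qed.
Lemma scaleV (c : R) u (i : 'I_3) : (c *: u) 0 i = c * u 0 i. Proof. by rewrite mxE. Qed.
Lemma zeroV (i : 'I_3) : (0 : V3) 0 i = 0. Proof. by rewrite mxE. Qed.
Definition coordE := (dotE, crossE, addV, oppV, scaleV, zeroV).

Lemma dotDr u v w : dot u (v + w) = dot u v + dot u w.
Proof. rewrite !coordE; ring. Qed.
Lemma dotDl u v w : dot (v + w) u = dot v u + dot w u.
Proof. rewrite !coordE; ring. Qed.
Lemma dotZl c u v : dot (c *: u) v = c * dot u v.
Proof. rewrite !coordE; ring. Qed.
Lemma dotZr c u v : dot u (c *: v) = c * dot u v.
Proof. rewrite !coordE; ring. Qed.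
Lemma dotNr u v : dot u (- v) = - dot u v.
Proof. rewrite !coordE; ring. Qed.
Lemma dotNl u v : dot (- u) v = - dot u v.
Proof. rewrite !coordE; ring. Qed.
Lemma dotC u v : dot u v = dot v u.
Proof. rewrite !coordE; ring. Qed.
Lemma dot0l u : dot 0 u = 0.
Proof. rewrite !coordE; ring. Qed.
Lemma dot0r u : dot u 0 = 0.
Proof. rewrite !coordE; ring. Qed.

Lemma dotvv_ge0 u : 0 <= dot u u.
Proof. by rewrite sumr_ge0// => i _; rewrite -expr2 sqr_ge0. Qed.

Lemma dotvv_eq0 u : (dot u u == 0) = (u == 0).
Proof.
apply/idP/eqP => [|->]; last by rewrite dot0l.
rewrite psumr_eq0 => [|i _]; last by rewrite -expr2 sqr_ge0.
move=> /allP H; apply/rowP => i; have := H i; rewrite mem_index_enum => /(_ isT).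
by rewrite -expr2 sqrf_eq0 mxE => /eqP.
Qed.

Lemma enorm_eq0 u : (enorm u == 0) = (u == 0).
Proof. by rewrite /enorm sqrtr_eq0 le_eqVlt ltNge dotvv_ge0 orbF dotvv_eq0. Qed.

(* The norm of the space of row vectors is the sup norm. *)
Lemma norm_leP x (r : R) : 0 <= r -> `|x| <= r <-> forall i, `|x 0 i| <= r.
Proof.
move=> r0; rewrite [`|x|]mx_normrE; split=> [/bigmax_leP[_ H] i|H].
  by have := H (0, i) isT.
by apply/bigmax_leP; split => // -[a b] _ /=; rewrite (ord1 a).
Qed.

Lemma ball_row3P x (r : R) y : ball x r y <-> 0 < r /\ forall i, `|x 0 i - y 0 i| < r.
Proof.
split=> [[r0 H]|[r0 H]]; split=> //.
  by move=> i; have := H 0 i.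
by move=> a b; rewrite (ord1 a); exact: H.
Qed.

Lemma coord_norm_le x i : `|x 0 i| <= `|x|.
Proof. by move: i; apply/(norm_leP x (normr_ge0 x)). Qed.

Lemma dotBr u v w : dot u (v - w) = dot u v - dot u w.
Proof. by rewrite dotDr dotNr. Qed.

Lemma cross0l u : cross 0 u = 0.
Proof. by apply: row3P; rewrite crossE !mxE; ring. Qed.

End Vectors.

(** * Integrals of real functions *)

Section RealIntegrals.
Context d (T : measurableType d) {R : realType} (mu : {measure set T -> \bar R}).
Implicit Types (D : set T) (f g : T -> R).

Lemma bounded_integrable D f (M : R) : measurable D -> (mu D < +oo)%E ->
  measurable_fun D f -> (forall x, D x -> `|f x| <= M) ->
  mu.-integrable D (EFin \o f).
Proof.
move=> mD muD mf fM; apply: measurable_bounded_integrable => //.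
exists M; split; first exact: num_real.
by move=> N MN x Dx; exact: le_trans (fM _ Dx) (ltW MN).
Qed.

Lemma dominated_Rintegral D (f_ : nat -> T -> R) f g : measurable D ->
  (forall n, measurable_fun D (f_ n)) ->
  (forall x, D x -> f_ n x @[n --> \oo] --> f x) ->
  mu.-integrable D (EFin \o g) ->
  (forall n x, D x -> `|f_ n x| <= g x) ->
  mu.-integrable D (EFin \o f) /\
  Rintegral mu D (f_ n) @[n --> \oo] --> Rintegral mu D f.
Proof.
move=> mD mf_ cf ig fg.
have mf : measurable_fun D f := measurable_fun_cvg mf_ cf.
have [] := @dominated_convergence _ _ _ mu D mD (fun n => EFin \o f_ n) (EFin \o f) (EFin \o g).
- by move=> n; apply/measurable_EFinP.
- exact/measurable_EFinP.
- by apply: aeW => x Dx; apply/fine_cvgP; split; [exact: nearW|exact: cf].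
- exact: ig.
- by apply: aeW => x n Dx; rewrite lee_fin fg.
move=> fi _ H; split => //.
by apply: fine_cvg; rewrite fineK//; exact: integrable_fin_num.
Qed.

Lemma dominated_Rintegral_cst D (f_ : nat -> T -> R) f g (c : R) : measurable D ->
  (forall n, measurable_fun D (f_ n)) ->
  (forall x, D x -> f_ n x @[n --> \oo] --> f x) ->
  mu.-integrable D (EFin \o g) ->
  (forall n x, D x -> `|f_ n x| <= g x) ->
  (forall n, Rintegral mu D (f_ n) = c) -> Rintegral mu D f = c.
Proof.
move=> mD mf_ cf ig fg H.
have [_] := dominated_Rintegral mD mf_ cf ig fg.
under eq_fun do rewrite H.
by move=> /(cvg_unique _); apply; [exact: Rhausdorff|exact: cvg_cst].
Qed.

Lemma ae_eq_Rintegral D f g : measurable D ->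
  measurable_fun D f -> measurable_fun D g ->
  {ae mu, forall x, D x -> f x = g x} -> Rintegral mu D f = Rintegral mu D g.
Proof.
move=> mD mf mg fg; congr fine; apply: ae_eq_integral => //.
- exact/measurable_EFinP.
- exact/measurable_EFinP.
- by apply: filterS fg => x + Dx => /(_ Dx) ->.
Qed.

Lemma Rintegral0 D : Rintegral mu D (fun=> 0) = 0.
Proof. by rewrite /Rintegral integral0. Qed.

Lemma integrableM_bounded D f g (M : R) : measurable D ->
  mu.-integrable D (EFin \o f) -> measurable_fun D g -> (forall x, D x -> `|g x| <= M) ->
  mu.-integrable D (EFin \o (fun x => f x * g x)).
Proof.
move=> mD fi mg gM.
have mf : measurable_fun D f by apply/measurable_EFinP; exact: measurable_int fi.
apply: (le_integrable mD _ _ (integrableZl mD M fi)).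
  exact/measurable_EFinP/measurable_funM.
move=> x Dx; rewrite lee_fin !normrM mulrC ler_wpM2r//.
exact: le_trans (gM _ Dx) (ler_norm _).
Qed.

Lemma integrableM_L2 D f g : measurable D ->
  measurable_fun D f -> measurable_fun D g ->
  (\int[mu]_(x in D) ((f x ^+ 2)%:E) < +oo)%E ->
  (\int[mu]_(x in D) ((g x ^+ 2)%:E) < +oo)%E ->
  mu.-integrable D (EFin \o (fun x => f x * g x)).
Proof.
move=> mD mf mg f2 g2.
have I (h : T -> R) : measurable_fun D h -> (\int[mu]_(x in D) ((h x ^+ 2)%:E) < +oo)%E ->
    mu.-integrable D (EFin \o (fun x => h x ^+ 2)).
  move=> mh h2; apply/integrableP; split; first exact/measurable_EFinP/measurable_funX.
  apply: le_lt_trans h2; rewrite le_eqVlt; apply/orP; left; apply/eqP.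
  by apply: eq_integral => x _ /=; rewrite ger0_norm// sqr_ge0.
apply: (le_integrable mD _ _ (integrableD mD (I f mf f2) (I g mg g2))).
  exact/measurable_EFinP/measurable_funM.
move=> x Dx; rewrite /= lee_fin [leRHS]ger0_norm ?addr_ge0 ?sqr_ge0// ler_norml.
have := sqr_ge0 (f x - g x); have := sqr_ge0 (f x + g x).
have := sqr_ge0 (f x); have := sqr_ge0 (g x).
rewrite !expr2 => *; apply/andP; split; nra.
Qed.

End RealIntegrals.

(** * Measurability in the space of row vectors *)

Section Space.
Context {R : realType}.
Local Notation V3 := 'rV[R]_3.
Local Notation T1 := (measurableTypeR R).
Local Notation T3 := (T1 * T1 * T1)%type.
Implicit Types (f g : V3 -> R) (U D : set V3) (x y : V3).

Lemma vec3E (p : R * R * R) :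
  ((vec3 p 0 0 = p.1.1) * (vec3 p 0 1 = p.1.2) * (vec3 p 0 2 = p.2))%type.
Proof. by split; [split|]; rewrite mxE. Qed.

(** The inverse of the identification of triples with row vectors. *)
Definition unvec3 x : R * R * R := (x 0 0, x 0 1, x 0 2).

Lemma unvec3K : cancel unvec3 vec3.
Proof. by move=> x; apply: row3P; rewrite vec3E. Qed.

Definition box3 (a b : V3) : set V3 := [set x | forall i, a 0 i < x 0 i < b 0 i].

Lemma box3E (a b : V3) : (vec3 @^-1` box3 a b : set T3) =
  (`]a 0 0, b 0 0[%classic `*` `]a 0 1, b 0 1[%classic) `*` `]a 0 2, b 0 2[%classic.
Proof.
apply/seteqP; split=> [p H|p [[/= H0 H1] H2]].
  have := H 0; have := H 1; have := H 2; rewrite !vec3E => h2 h1 h0.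
  by split; [split|]; rewrite /= in_itv/=.
rewrite /preimage /box3 /=.
by elim/I3_ind; rewrite vec3E; [move: H0|move: H1|move: H2]; rewrite in_itv.
Qed.

Lemma measurable_box3 a b : measurable (vec3 @^-1` box3 a b : set T3).
Proof. by rewrite box3E; do !apply: measurableX => //; exact: measurable_itv. Qed.

Lemma leb3_box3 (a b : V3) : (forall i, a 0 i < b 0 i) ->
  leb3 (vec3 @^-1` box3 a b) =
  ((b 0 0 - a 0 0) * (b 0 1 - a 0 1) * (b 0 2 - a 0 2))%:E.
Proof.
move=> ab; rewrite box3E /leb3 product_measure1E.
- rewrite /= product_measure1E.
  + by rewrite /= !lebesgue_measure_itv/= !lte_fin !ab.
  + exact: measurable_itv.
  + exact: measurable_itv.
- by apply: measurableX; exact: measurable_itv.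
- exact: measurable_itv.
Qed.

(** Every open set is a countable union of open boxes with closure inside it. *)
Lemma open_ball_cover U : open U -> exists (q : nat -> V3) (r : nat -> R),
  U = \bigcup_n ball (q n) (r n) /\
  forall n y, (forall i, `|q n 0 i - y 0 i| <= r n) -> 0 < r n -> U y.
Proof.
move=> oU.
pose c (t : rat * rat * rat * nat) : V3 :=
  vec3 (ratr t.1.1.1, ratr t.1.1.2, ratr t.1.2).
pose good t := forall y, (forall i, `|c t 0 i - y 0 i| <= t.2.+1%:R^-1) -> U y.
pose q n := if unpickle n is Some t then c t else 0.
pose r n := if unpickle n is Some t then
  (if asbool (good t) then t.2.+1%:R^-1 else 0) else 0 : R.
have in_U n y : (forall i, `|q n 0 i - y 0 i| <= r n) -> 0 < r n -> U y.
  rewrite /q /r; case: (unpickle n) => [t|]; last by rewrite ltxx.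
  by case: ifPn => [/asboolP gt H _|_]; [exact: gt|rewrite ltxx].
exists q, r; split; last exact: in_U.
apply/seteqP; split=> [x Ux|x [n _] /ball_row3P[r0 H]]; last first.
  by apply: (in_U n) => // i; exact/ltW/H.
have /nbhs_ballP[e /= e0 eU] : nbhs x U by exact: open_nbhs_nbhs.
have e3 : 0 < e / 3 by rewrite divr_gt0.
have [m me] : exists m : nat, m.+1%:R^-1 < e / 3.
  have := near_infty_natSinv_lt (PosNum e3) => /= -[m _ /(_ m (leqnn m)) H].
  by exists m.
have /choice[a Ha] : forall i : 'I_3, exists a : rat, `|ratr a - x 0 i| < m.+1%:R^-1.
  move=> i; have [|a] := @rat_in_itvoo R (x 0 i - m.+1%:R^-1) (x 0 i + m.+1%:R^-1).
    have : (0 : R) < m.+1%:R^-1 by rewrite invr_gt0.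
    move: (m.+1%:R^-1) => d d0; lra.
  rewrite in_itv/= => /andP[h1 h2]; by exists a; rewrite ltr_distl h1 h2.
pose t := (a 0, a 1, a 2, m).
have ct i : c t 0 i = ratr (a i) by elim/I3_ind: i; rewrite vec3E.
have gt : good t.
  move=> y Hy; apply: eU; apply/ball_row3P; split=> // i.
  have := Hy i; have := Ha i; rewrite ct /= => h1 h2.
  rewrite distrC in h1.
  have := ler_distD (ratr (a i)) (x 0 i) (y 0 i).
  move: me h1 h2; move: (m.+1%:R^-1) => d; lra.
exists (pickle t) => //; apply/ball_row3P; rewrite /q /r pickleK.
rewrite asboolT// invr_gt0 ltr0n; split => // i; rewrite ct; exact: Ha.
Qed.

Lemma measurable_open3 U : open U -> measurable (vec3 @^-1` U : set T3).
Proof.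
move=> /open_ball_cover[q [r [-> _]]]; rewrite preimage_bigcup.
apply: bigcupT_measurable => n.
have [r0|r0] := leP (r n) 0.
  rewrite [X in measurable X](_ : _ = set0)//.
  by apply/seteqP; split=> // p /ball_row3P[]; rewrite ltNge r0.
rewrite [X in measurable X](_ : _ = vec3 @^-1` box3 (q n - const_mx (r n)) (q n + const_mx (r n))).
  exact: measurable_box3.
have cst i : (const_mx (r n) : V3) 0 i = r n by rewrite mxE.
apply/seteqP; split=> p /=.
  by move=> /ball_row3P[_ H] i; have := H i; rewrite ltr_distlC !addV oppV cst.
move=> H; apply/ball_row3P; split => // i; have := H i.
by rewrite ltr_distlC !addV oppV cst.
Qed.

Lemma measurable_closed3 U : closed U -> measurable (vec3 @^-1` U : set T3).
Proof.
move=> cU; rewrite -[U]setCK preimage_setC; apply: measurableC.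
exact: (measurable_open3 (closed_openC cU)).
Qed.

Lemma continuous_measurable3 f : continuous f -> measurable_fun setT (f \o vec3 : T3 -> R).
Proof.
move=> /continuousP cf; apply: (measurability _ (RGenOpens.measurableE R)).
move=> _ [_ [a [b ->] <-]]; rewrite setTI comp_preimage; apply: measurable_open3.
exact/cf/interval_open.
Qed.

End Space.

(** * Local boundedness and bounded support *)

Section Supports.
Context {R : realType}.
Local Notation V3 := 'rV[R]_3.
Local Notation T1 := (measurableTypeR R).
Local Notation T3 := (T1 * T1 * T1)%type.
Local Notation mu1 := (@lebesgue_measure R).
Implicit Types (f g : V3 -> R) (U D : set V3) (x y v : V3).

(** The closed ball of the sup norm; it is empty for negative [N]. *)
Definition cube (N : R) : set V3 := [set x | `|x| <= N].

Lemma closed_cube_norm N : closed (cube N).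
Proof.
have -> : cube N = closed_ball_ Num.norm 0 N.
  by apply/seteqP; split=> x; rewrite /closed_ball_/= sub0r normrN.
exact: closed_closed_ball_.
Qed.

(** Functions with bounded support. *)
Definition bsupp f := exists N : R, forall x, N < `|x| -> f x = 0.

(** Measurable functions that are bounded on bounded sets. *)
Definition locbdd f := measurable_fun setT (f \o vec3 : T3 -> R) /\
  forall N : R, exists M : R, forall x, `|x| <= N -> `|f x| <= M.

(** Bounded measurable functions with bounded support: these are integrable,
    also against square integrable functions. *)
Definition bm f := locbdd f /\ bsupp f.

Lemma locbdd_continuous f : continuous f -> locbdd f.
Proof.
move=> cf; split; first exact: continuous_measurable3.
move=> N; have [N0|N0] := ltP N 0.
  by exists 0 => x xN; have := le_lt_trans xN N0; rewrite normr_lt0.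
have cK : compact [set x : V3 | `|x| <= N].
  apply: bounded_closed_compact.
    by exists N; split; [exact: num_real|move=> M NM x /= /le_trans; apply; exact: ltW].
  exact: closed_cube_norm.
have K0 : [set x : V3 | `|x| <= N] !=set0 by exists 0; rewrite /= normr0.
have [c _ Hc] : exists2 c, c \in [set x : V3 | `|x| <= N] &
    forall t, t \in [set x : V3 | `|x| <= N] -> `|f t| <= `|f c|.
  apply: (@EVT_max_rV R 3 (fun x => `|f x|)) => //.
  by apply: continuous_subspaceT => x; apply: (continuous_comp (cf x)); exact: norm_continuous.
by exists `|f c| => x xN; apply: Hc; rewrite inE.
Qed.

Lemma locbdd_bounded f (M : R) : measurable_fun setT (f \o vec3 : T3 -> R) ->
  (forall x, `|f x| <= M) -> locbdd f.
Proof. by move=> mf fM; split=> // N; exists M. Qed.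

Lemma locbddD f g : locbdd f -> locbdd g -> locbdd (fun x => f x + g x).
Proof.
move=> [mf bf] [mg bg]; split; first exact: measurable_funD.
move=> N; have [M HM] := bf N; have [M' HM'] := bg N; exists (M + M') => x xN.
by rewrite (le_trans (ler_normD _ _))// lerD ?HM ?HM'.
Qed.

Lemma locbddM f g : locbdd f -> locbdd g -> locbdd (fun x => f x * g x).
Proof.
move=> [mf bf] [mg bg]; split; first exact: measurable_funM.
move=> N; have [M HM] := bf N; have [M' HM'] := bg N; exists (M * M') => x xN.
by rewrite normrM ler_pM// ?HM ?HM'.
Qed.

Lemma locbdd_cst c : locbdd (fun=> c).
Proof. by apply: locbdd_continuous; exact: cst_continuous. Qed.

Lemma locbdd_sum I (r : seq I) (F : I -> V3 -> R) : (forall i, locbdd (F i)) ->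
  locbdd (fun x => \sum_(i <- r) F i x).
Proof.
move=> sF; elim: r => [|i r IH].
  by under eq_fun do rewrite big_nil; exact: locbdd_cst.
by under eq_fun do rewrite big_cons; exact: locbddD.
Qed.

Lemma locbdd_opp f : locbdd f -> locbdd (fun x => - f x).
Proof.
move=> bf; have -> : (fun x => - f x) = (fun x => -1 * f x).
  by apply/funext => x; rewrite mulN1r.
by apply: locbddM => //; exact: locbdd_cst.
Qed.

Lemma locbdd_dot (u w : V3 -> V3) : (forall i, locbdd (fun x => u x 0 i)) ->
  (forall i, locbdd (fun x => w x 0 i)) -> locbdd (fun x => dot (u x) (w x)).
Proof. by move=> bu bw; apply: locbdd_sum => i; exact: locbddM. Qed.

Lemma locbdd_affine (g x0 : V3) : locbdd (fun x => dot g (x - x0)).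
Proof. exact/locbdd_continuous/smooth_continuous/smooth_affine. Qed.

Lemma measurable_pos f : measurable_fun setT (f \o vec3 : T3 -> R) ->
  measurable_fun setT (fun p : T3 => ((0 < f (vec3 p))%R%:R : R)).
Proof.
move=> mf; have -> : (fun p : T3 => ((0 < f (vec3 p))%R%:R : R)) =
    \1_(vec3 @^-1` [set x | 0 < f x]).
  apply/funext => p; rewrite indicE; congr (nat_of_bool _)%:R.
  by apply/idP/idP; rewrite inE.
apply: measurable_indic.
rewrite [X in measurable X](_ : _ = setT `&` (f \o vec3) @^-1` `]0, +oo[%classic).
  by apply: mf => //; exact: measurable_itv.
by rewrite setTI; apply/seteqP; split=> p; rewrite /= in_itv/= andbT.
Qed.

Lemma locbdd_pos f : continuous f -> locbdd (fun x => (0 < f x)%R%:R).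
Proof.
move=> cf; apply: (@locbdd_bounded _ 1).
  exact: (measurable_pos (continuous_measurable3 cf)).
by move=> x; case: (0 < f x); rewrite ?normr1// normr0.
Qed.

Lemma bsuppMl f g : bsupp g -> bsupp (fun x => f x * g x).
Proof. by move=> [N HN]; exists N => x /HN ->; rewrite mulr0. Qed.

Lemma bsuppD f g : bsupp f -> bsupp g -> bsupp (fun x => f x + g x).
Proof.
move=> [N HN] [M HM]; exists (Num.max N M) => x.
by rewrite gt_max => /andP[/HN -> /HM ->]; rewrite addr0.
Qed.

Lemma bmMl f g : locbdd f -> bm g -> bm (fun x => f x * g x).
Proof. by move=> bf [bg sg]; split; [exact: locbddM|exact: bsuppMl]. Qed.

Lemma bmMr f g : locbdd g -> bm f -> bm (fun x => f x * g x).
Proof.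
by move=> bg bf; under eq_fun do rewrite mulrC; exact: bmMl.
Qed.

Lemma bmD f g : bm f -> bm g -> bm (fun x => f x + g x).
Proof. by move=> [bf sf] [bg sg]; split; [exact: locbddD|exact: bsuppD]. Qed.

Lemma bmN f : bm f -> bm (fun x => - f x).
Proof.
move=> bf; have -> : (fun x => - f x) = (fun x => -1 * f x).
  by apply/funext => x; rewrite mulN1r.
by apply: bmMl => //; exact: locbdd_cst.
Qed.

Lemma bm_sum I (r : seq I) (F : I -> V3 -> R) : (forall i, bm (F i)) ->
  bm (fun x => \sum_(i <- r) F i x).
Proof.
move=> sF; elim: r => [|i r IH].
  under eq_fun do rewrite big_nil.
  by split; [exact: locbdd_cst|exists 0].
by under eq_fun do rewrite big_cons; exact: bmD.
Qed.

Lemma bm_continuous f : continuous f -> bsupp f -> bm f.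
Proof. by move=> cf sf; split=> //; exact: locbdd_continuous. Qed.

Lemma bm_bounded f : bm f -> exists2 M : R, 0 <= M & forall x, `|f x| <= M.
Proof.
move=> [[_ bf] [N HN]]; have [M HM] := bf N; exists `|M| => // x.
have [/HM/le_trans->//|/HN ->] := leP `|x| N; first exact: ler_norm.
by rewrite normr0.
Qed.

Lemma leb3_cube_lty N : (leb3 (vec3 @^-1` cube N) < +oo)%E.
Proof.
have [N0|N0] := ltP N 0.
  rewrite [X in leb3 X](_ : _ = set0) /leb3; first by rewrite measure0.
  by apply/seteqP; split=> // p /= /le_lt_trans /(_ N0); rewrite normr_lt0.
have cE (c : R) i : (const_mx c : V3) 0 i = c by rewrite mxE.
apply: (@le_lt_trans _ _ (leb3 (vec3 @^-1` box3 (const_mx (- (N + 1))) (const_mx (N + 1))))).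
  rewrite /leb3; apply: le_measure; rewrite ?inE.
  - exact: (measurable_closed3 (@closed_cube_norm N)).
  - exact: measurable_box3.
  - move=> p /= pN i; rewrite !cE -ltr_norml; apply: le_lt_trans (coord_norm_le _ _) _.
    by apply: (le_lt_trans pN); rewrite ltrDl.
rewrite leb3_box3 ?ltry// => i; rewrite !cE.
lra.
Qed.

(** Integrability with respect to the measure of [int3]. *)
Definition integrable3 U f := leb3.-integrable (vec3 @^-1` U : set T3) (EFin \o (f \o vec3)).

Lemma bm_integrable U f : measurable (vec3 @^-1` U : set T3) -> bm f -> integrable3 U f.
Proof.
move=> mU bf; have [M M0 HM] := bm_bounded bf; case: bf => -[mf _] [N HN].
suff H : integrable3 setT f by apply: (integrableS _ mU _ H); [exact: measurableT|exact: subsetT].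
have mN : measurable (vec3 @^-1` cube N : set T3).
  exact: (measurable_closed3 (@closed_cube_norm N)).
have : leb3.-integrable (vec3 @^-1` cube N : set T3) (EFin \o (f \o vec3)).
  apply: (@bounded_integrable _ _ _ leb3 _ _ M) => //; first exact: leb3_cube_lty.
    exact: measurable_funTS.
  by move=> p _; exact: HM.
move=> /(integrable_mkcond _ mN) H; apply: eq_integrable H => // p _.
rewrite patchE; case: ifPn => //; rewrite notin_setE /= => /negP.
by rewrite -ltNge => /HN ->.
Qed.

End Supports.

(** * The Lebesgue measure of the plane *)

(** The product measure under a name of its own, so that it carries the
    structure of a sigma-finite measure that the iterated Fubini theorem in
    dimension three asks for. *)
Definition leb2 (R : realType) : set (measurableTypeR R * measurableTypeR R) -> \bar R :=
  (@lebesgue_measure R \x @lebesgue_measure R)%E.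
HB.instance Definition _ (R : realType) := Measure.copy (@leb2 R)
  (product_measure1 (@lebesgue_measure R) (@lebesgue_measure R)).
Lemma leb2_sigma_finite (R : realType) : sigma_finite setT (@leb2 R).
Proof.
have /sigma_finiteP[F [TF ndF Foo]] := @sigma_finiteT _ _ R (@lebesgue_measure R).
exists (fun n => F n `*` F n).
  rewrite -setXTT [setT `*` _](_ : _ = (\bigcup_n F n) `*` (\bigcup_n F n)); last by rewrite -TF.
  apply/seteqP; split=> -[x y] /=.
    move=> [[n _ Fnx] [k _ Gky]]; exists (maxn n k) => //; split.
    - by move: x Fnx; exact/subsetPset/ndF/leq_maxl.
    - by move: y Gky; exact/subsetPset/ndF/leq_maxr.
  by move=> [n _ []/= ? ?]; split; exists n.
move=> k; have [? ?] := Foo k.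
split; first exact: measurableX.
by rewrite /leb2 product_measure1E// lte_mul_pinfty// ge0_fin_numE.
Qed.
HB.instance Definition _ (R : realType) := Measure_isSigmaFinite.Build _ _ _ (@leb2 R)
  (@leb2_sigma_finite R).

Lemma Fubini_eq0_l {R : realType} d1 d2 (X : measurableType d1) (Y : measurableType d2)
    (m1 : {sigma_finite_measure set X -> \bar R}) (m2 : {sigma_finite_measure set Y -> \bar R})
    (F : X * Y -> \bar R) : (m1 \x m2)%E.-integrable setT F ->
  (forall y, \int[m1]_x F (x, y) = 0)%E -> (\int[m1 \x m2]_p F p = 0)%E.
Proof.
move=> iF F0; rewrite -integral21_prod_meas1//.
by apply: integral0_eq => y _; exact: F0.
Qed.

Lemma Fubini_eq0_r {R : realType} d1 d2 (X : measurableType d1) (Y : measurableType d2)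
    (m1 : {sigma_finite_measure set X -> \bar R}) (m2 : {sigma_finite_measure set Y -> \bar R})
    (F : X * Y -> \bar R) : (m1 \x m2)%E.-integrable setT F ->
  (forall x, \int[m2]_y F (x, y) = 0)%E -> (\int[m1 \x m2]_p F p = 0)%E.
Proof.
move=> iF F0; rewrite -integral12_prod_meas1//.
by apply: integral0_eq => x _; exact: F0.
Qed.

(** * The divergence theorem in the whole space *)

Section ZeroDivergence.
Context {R : realType}.
Local Notation V3 := 'rV[R]_3.
Local Notation T1 := (measurableTypeR R).
Local Notation T3 := (T1 * T1 * T1)%type.
Local Notation mu1 := (@lebesgue_measure R).
Implicit Types (f g : V3 -> R) (U D : set V3) (x y v : V3).

Lemma FTC2_derive (F h : R -> R) (a b : R) : a < b -> continuous h ->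
  (forall t : R, is_derive t 1 F (h t)) ->
  (\int[mu1]_(t in `[a, b]) (h t)%:E = (F b - F a)%:E)%E.
Proof.
move=> ab ch dF; have cF : continuous F.
  by move=> t; apply: differentiable_continuous; apply/derivable1_diffP; case: (dF t).
rewrite (@continuous_FTC2 R h F)//.
- exact: continuous_subspaceT.
- split=> [t _||]; first by case: (dF t).
  + exact: (cvg_at_right_filter (cF a)).
  + exact: (cvg_at_left_filter (cF b)).
- by move=> t _; rewrite derive1E; case: (dF t).
Qed.

Lemma integral_derive_bsupp (F h : R -> R) (N : R) : continuous h ->
  (forall t : R, is_derive t 1 F (h t)) -> (forall t, N < `|t| -> F t = 0 /\ h t = 0) ->
  (\int[mu1]_t (h t)%:E = 0)%E.
Proof.
move=> ch dF HN; pose M := Num.max N 0 + 1.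
have NM : N < M by rewrite /M; have : N <= Num.max N 0 by [rewrite le_max lexx]; lra.
have M0 : 0 < M by rewrite /M; have : 0 <= Num.max N 0 by [rewrite le_max lexx orbT]; lra.
have MM : -M < M by lra.
transitivity (\int[mu1]_(t in `[(- M)%R, M]) (h t)%:E)%E.
  rewrite [RHS]integral_mkcond; apply: eq_integral => t _; rewrite patchE.
  case: ifPn => //; rewrite notin_setE/= in_itv/= -ler_norml => /negP; rewrite -ltNge => Mt.
  by have [_ ->] := HN t (lt_trans NM Mt).
rewrite (FTC2_derive MM ch dF).
have [|-> _] := HN M; first by rewrite gtr0_norm.
by have [|-> _] := HN (- M); rewrite ?subrr// normrN gtr0_norm.
Qed.

Lemma partial_outside (C : set V3) f i : closed C -> (forall x, ~ C x -> f x = 0) ->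
  forall x, ~ C x -> partial i f x = 0.
Proof.
move=> cC f0 x nCx; rewrite /partial (@near_eq_derive _ _ _ f (cst 0)) ?derive_cst//.
have : nbhs x (~` C) by apply: open_nbhs_nbhs; split=> //; exact: closed_openC.
by apply: filterS => y; exact: f0.
Qed.

Lemma bsupp_partial f i : bsupp f -> bsupp (partial i f).
Proof.
move=> [N HN]; exists N => x Nx; apply: (@partial_outside (cube N)).
- exact: closed_cube_norm.
- by move=> y /negP; rewrite -ltNge; exact: HN.
- by apply/negP; rewrite -ltNge.
Qed.

Lemma integral_partial_line f (i : 'I_3) x : smooth f -> bsupp f ->
  (\int[mu1]_t (partial i f (t *: delta_mx 0 i + x))%:E = 0)%E.
Proof.
move=> sf bf; have [N HN] := bf; have [M HM] := bsupp_partial i bf.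
have sdf := smooth_partial i sf.
apply: (@integral_derive_bsupp (fun t => f (t *: delta_mx 0 i + x)) _ (Num.max N M + `|x|)).
- move=> t; apply: (@continuous_comp _ _ _ (fun t : R => t *: delta_mx 0 i + x)).
    apply: (@continuousD _ _ _ (fun t : R => t *: (delta_mx 0 i : V3)) (cst x)).
      exact: scalel_continuous.
    exact: cst_continuous.
  exact: smooth_continuous.
- by move=> t; apply: is_derive_along; apply: derivableP; exact: smooth_derivable.
- move=> t Nt; have H : Num.max N M < `|t *: (delta_mx 0 i : V3) + x|.
    apply: lt_le_trans (coord_norm_le _ i).
    rewrite !mxE !eqxx mulr1 -(opprK (x 0 i)); apply: lt_le_trans (lerB_dist _ _).
    rewrite normrN ltrBrDr; apply: le_lt_trans Nt.
    by rewrite lerD2l; exact: coord_norm_le.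
  by move: H; rewrite gt_max => /andP[/HN -> /HM ->].
Qed.

Lemma vec3_line0 (s y z : R) : vec3 (s, y, z) = s *: delta_mx 0 0 + vec3 (0, y, z).
Proof. by apply: row3P; rewrite !mxE/= ?(mulr1, mulr0, addr0, add0r). Qed.

Lemma vec3_line1 (s x z : R) : vec3 (x, s, z) = s *: delta_mx 0 1 + vec3 (x, 0, z).
Proof. by apply: row3P; rewrite !mxE/= ?(mulr1, mulr0, addr0, add0r). Qed.

Lemma vec3_line2 (s x y : R) : vec3 (x, y, s) = s *: delta_mx 0 2 + vec3 (x, y, 0).
Proof. by apply: row3P; rewrite !mxE/= ?(mulr1, mulr0, addr0, add0r). Qed.

Lemma integrable_slice f (z : R) : continuous f -> bsupp f ->
  (mu1 \x mu1)%E.-integrable setT (fun p : T1 * T1 => (f (vec3 (p, z)))%:E).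
Proof.
move=> cf bf; have [M _ HM] := bm_bounded (bm_continuous cf bf).
have mf := continuous_measurable3 cf; have [N HN] := bf.
pose K : set (T1 * T1) := `[(- N), N]%classic `*` `[(- N), N]%classic.
have mK : measurable K by apply: measurableX; exact: measurable_itv.
have : (mu1 \x mu1)%E.-integrable K (fun p : T1 * T1 => (f (vec3 (p, z)))%:E).
  apply: (@bounded_integrable _ _ _ (mu1 \x mu1)%E _ _ M) => //.
  - rewrite /K /= product_measure1E; [|exact: measurable_itv..].
    rewrite /= !lebesgue_measure_itv/= lte_fin; case: ifP => _; last by rewrite mule0 ltry.
    exact: ltry.
  - apply: measurable_funTS.
    exact: (measurable_fun_pair1 _ mf).
move=> /(integrable_mkcond _ mK) H; apply: eq_integrable H => // p _.
rewrite patchE; case: ifPn => //; rewrite notin_setE => nK.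
rewrite HN// ltNge; apply/negP => pN; apply: nK.
have /(_ _)/le_trans/(_ pN) H i := coord_norm_le (vec3 (p, z)) i.
have := H 0; have := H 1; rewrite !vec3E/= => h1 h0.
by split; rewrite /= in_itv/= -ler_norml.
Qed.

(** The integral of a partial derivative of a smooth function with bounded
    support vanishes: integrate first along the direction of differentiation. *)
Lemma int_partial0 f i : smooth f -> bsupp f -> int3 setT (partial i f) = 0.
Proof.
move=> sf bf; rewrite /int3 /Rintegral preimage_setT.
have sdf := smooth_partial i sf; have bdf := bsupp_partial i bf.
have cdf := smooth_continuous sdf.
have := bm_integrable (U := setT) _ (bm_continuous cdf bdf).
move=> /(_ measurableT); rewrite /integrable3 preimage_setT.
set F := EFin \o _ => iF.
suff -> : (\int[(@leb2 R \x mu1)]_p F p)%E = 0%E by [].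
move: i @F sdf bdf cdf iF; elim/I3_ind => F sdf bdf cdf iF.
- apply: (@Fubini_eq0_l _ _ _ _ _ (@leb2 R)) iF _ => z.
  apply: (@Fubini_eq0_l _ _ _ _ _ mu1); first exact: integrable_slice cdf bdf.
  move=> y; rewrite -[RHS](@integral_partial_line f 0 (vec3 (0, y, z)) sf bf).
  by apply: eq_integral => s _; rewrite /F /= vec3_line0.
- apply: (@Fubini_eq0_l _ _ _ _ _ (@leb2 R)) iF _ => z.
  apply: (@Fubini_eq0_r _ _ _ _ _ mu1); first exact: integrable_slice cdf bdf.
  move=> x; rewrite -[RHS](@integral_partial_line f 1 (vec3 (x, 0, z)) sf bf).
  by apply: eq_integral => s _; rewrite /F /= vec3_line1.
- apply: (@Fubini_eq0_r _ _ _ _ _ (@leb2 R)) iF _ => -[x y].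
  rewrite -[RHS](@integral_partial_line f 2 (vec3 (x, y, 0)) sf bf).
  by apply: eq_integral => s _; rewrite /F /= vec3_line2.
Qed.

End ZeroDivergence.

(** * The divergence theorem in a half-space *)

Section HalfSpace.
Context {R : realType}.
Local Notation V3 := 'rV[R]_3.
Local Notation T1 := (measurableTypeR R).
Local Notation T3 := (T1 * T1 * T1)%type.
Implicit Types (f g : V3 -> R) (U D : set V3) (x y v : V3).

Lemma eq_int3 U f g : (forall x, U x -> f x = g x) -> int3 U f = int3 U g.
Proof. by move=> fg; apply: eq_Rintegral => p /set_mem /= /fg. Qed.

Lemma int3D U f g : measurable (vec3 @^-1` U : set T3) ->
  integrable3 U f -> integrable3 U g ->
  int3 U (fun x => f x + g x) = int3 U f + int3 U g.
Proof. by move=> mU fi gi; rewrite /int3 RintegralD. Qed.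

Lemma int3Z U f (c : R) : measurable (vec3 @^-1` U : set T3) -> integrable3 U f ->
  int3 U (fun x => c * f x) = c * int3 U f.
Proof. by move=> mU fi; rewrite /int3 RintegralZl. Qed.

Lemma int3N U f : measurable (vec3 @^-1` U : set T3) -> integrable3 U f ->
  int3 U (fun x => - f x) = - int3 U f.
Proof.
by move=> mU fi; under eq_int3 do rewrite -mulN1r; rewrite int3Z// mulN1r.
Qed.

Lemma int3_0 U : int3 U (fun=> 0) = 0.
Proof. exact: Rintegral0. Qed.

Lemma int3_eq0 U f : (forall x, U x -> f x = 0) -> int3 U f = 0.
Proof. by move=> f0; rewrite -(int3_0 U); exact: eq_int3. Qed.

Lemma integrable3D U f g : measurable (vec3 @^-1` U : set T3) ->
  integrable3 U f -> integrable3 U g -> integrable3 U (fun x => f x + g x).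
Proof. by move=> mU fi gi; apply: eq_integrable (integrableD mU fi gi). Qed.

Lemma integrable3_sum U I (r : seq I) (F : I -> V3 -> R) : measurable (vec3 @^-1` U : set T3) ->
  (forall i, integrable3 U (F i)) -> integrable3 U (fun x => \sum_(i <- r) F i x).
Proof.
move=> mU iF; elim: r => [|i r IH].
  under eq_fun do rewrite big_nil.
  by apply: bm_integrable => //; split; [exact: locbdd_cst|exists 0].
by under eq_fun do rewrite big_cons; exact: integrable3D.
Qed.

Lemma int3_sum U I (r : seq I) (F : I -> V3 -> R) : measurable (vec3 @^-1` U : set T3) ->
  (forall i, integrable3 U (F i)) ->
  int3 U (fun x => \sum_(i <- r) F i x) = \sum_(i <- r) int3 U (F i).
Proof.
move=> mU iF; elim: r => [|i r IH].
  by rewrite big_nil; under eq_fun do rewrite big_nil; exact: int3_0.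
rewrite big_cons -IH -int3D//; last exact: integrable3_sum.
by under eq_fun do rewrite big_cons.
Qed.

Lemma int3_mkcond U f : (forall x, ~ U x -> f x = 0) -> int3 U f = int3 setT f.
Proof.
move=> f0; rewrite /int3 preimage_setT Rintegral_mkcond; apply: eq_Rintegral => p _.
by rewrite patchE; case: ifPn => //; rewrite notin_setE => /f0.
Qed.

Lemma bm_norm f : bm f -> bm (fun x => `|f x|).
Proof.
move=> [[mf bf] [N HN]]; split; last by exists N => x /HN ->; rewrite normr0.
split; first exact: measurableT_comp.
by move=> M; have [K HK] := bf M; exists K => x /HK; rewrite normr_id.
Qed.

Lemma cvg_flat_cut (s a b : R) :
  flat 1 (n.+1%:R * s) * a + flat 'X (n.+1%:R * s) * b @[n --> \oo] --> (0 < s)%R%:R * a.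
Proof.
rewrite -[X in _ --> X]addr0; apply: cvgD.
  by apply: cvgM; [exact: cvg_flat1|exact: cvg_cst].
by rewrite -(mul0r b); apply: cvgM; [exact: cvg_flatX|exact: cvg_cst].
Qed.

Lemma is_derive_affine f x v (a : R) : (forall h : R, f (h *: v + x) = h * a + f x) ->
  is_derive x v f a.
Proof.
move=> H; apply/is_derive_line.
have -> : (fun h : R => f (h *: v + x)) = (fun h : R => h * a + f x) by apply/funext.
have -> : a = (a *: 1 + 0) :> R by rewrite addr0 /GRing.scale/= mulr1.
have := is_deriveD (is_deriveZ a (is_derive_id (0:R) 1)) (is_derive_cst (f x) (0 : R) 1).
congr (is_derive _ _ _ _); apply/funext => h /=.
by rewrite /GRing.scale/= addr0 mulr1 [h * _]mulrC.
Qed.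

Lemma partial_affine (g x0 : V3) i x : partial i (fun y => dot g (y - x0)) x = g 0 i.
Proof.
have [|_] // := @is_derive_affine (fun y => dot g (y - x0)) x (delta_mx 0 i) (g 0 i).
move=> h; rewrite -addrA [LHS]dotDr dotZr; congr (_ * _ + _).
rewrite /dot (bigD1 i)//= big1 ?addr0; first by rewrite mxE !eqxx mulr1.
by move=> j /negPf ji; rewrite mxE eqxx/= ji mulr0.
Qed.

(** The divergence theorem in a half-space for a field with vanishing normal
    trace: cut the field off by [flat 1 (n t)]. The error [n t flat' (n t) Y] is
    bounded and tends to [0]. *)
Lemma int3_halfspace_div (g x0 : V3) (X : 'I_3 -> V3 -> R) (Y : V3 -> R) :
  (forall i, smooth (X i)) -> (forall i, bsupp (X i)) -> bm Y ->
  (forall x, \sum_i g 0 i * X i x = dot g (x - x0) * Y x) ->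
  int3 setT (fun x => (0 < dot g (x - x0))%R%:R * \sum_i partial i (X i) x) = 0.
Proof.
move=> sX bX bY XY; pose t x := dot g (x - x0).
have mT : measurable (vec3 @^-1` setT : set T3) by rewrite preimage_setT.
pose tn (n : nat) x := n.+1%:R * t x.
have stn n : smooth (tn n) by apply: smoothZ; exact: smooth_affine.
pose W n i x := flat 1 (tn n x) * X i x.
have sW n i : smooth (W n i) by apply: smoothM => //; exact: smooth_flat.
have bW n i : bsupp (W n i) by exact: bsuppMl.
have WE n x : \sum_i partial i (W n i) x =
    flat 1 (tn n x) * (\sum_i partial i (X i) x) + flat 'X (tn n x) * Y x.
  have E i : partial i (W n i) x = flat 1 (tn n x) * partial i (X i) x +
      flat (dflat 1) (tn n x) * n.+1%:R * (g 0 i * X i x).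
    rewrite (partial_smoothM i x (smooth_flat 1 (stn n)) (sX i)).
    rewrite (partial_smooth_flat i 1 x (stn n)) (partialZ i _ x (smooth_affine g x0)).
    by rewrite partial_affine; ring.
  rewrite (eq_bigr _ (fun i _ => E i)) big_split/= -!mulr_sumr XY -flat_mulX.
  by rewrite /tn /t; ring.
have bdiv : bm (fun x => \sum_i partial i (X i) x).
  apply: bm_sum => i; apply: bm_continuous; last exact: bsupp_partial.
  exact/smooth_continuous/smooth_partial.
have [C C0 HC] := flat_bounded ('X : {poly R}).
have mdiv : measurable_fun setT (fun p : T3 => \sum_i partial i (X i) (vec3 p)) := bdiv.1.1.
have mY : measurable_fun setT (fun p : T3 => Y (vec3 p)) := bY.1.1.
have mfl P n : measurable_fun setT (fun p : T3 => flat P (tn n (vec3 p))).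
  by apply: (continuous_measurable3 (f := fun x => flat P (tn n x))); apply/smooth_continuous/smooth_flat.
rewrite /int3 preimage_setT.
apply: (@dominated_Rintegral_cst _ _ _ leb3 _
  (fun n p => \sum_i partial i (W n i) (vec3 p)) _
  (fun p => `|\sum_i partial i (X i) (vec3 p)| + C * `|Y (vec3 p)|)) => //.
- move=> n; under eq_fun do rewrite WE.
  by apply: measurable_funD; apply: measurable_funM => //; exact: mfl.
- move=> p _; under eq_fun do rewrite WE.
  exact: cvg_flat_cut.
- have := bm_integrable mT (bmD (bm_norm bdiv) (bmMl (locbdd_cst C) (bm_norm bY))).
  by rewrite /integrable3 preimage_setT.
- move=> n p _; rewrite WE (le_trans (ler_normD _ _))// !normrM lerD//.
    by rewrite ler_piMl// ger0_norm ?flat1_le1// flat1_ge0.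
  by rewrite ler_wpM2r.
- move=> n; have := @int3_sum setT _ (index_enum 'I_3) (fun i => partial i (W n i)) mT.
  rewrite /int3 preimage_setT => ->.
    by apply: big1 => i _; have := int_partial0 i (sW n i) (bW n i); rewrite /int3 preimage_setT.
  move=> i; apply: bm_integrable => //; apply: bm_continuous; last exact: bsupp_partial.
  exact/smooth_continuous/smooth_partial.
Qed.

End HalfSpace.

Lemma ae_imp {R : realType} d (T : measurableType d) (mu : {measure set T -> \bar R})
    (P Q : T -> Prop) : (forall x, P x -> Q x) -> {ae mu, forall x, P x} -> {ae mu, forall x, Q x}.
Proof. by move=> PQ; apply: filterS. Qed.

(** A function whose integrals over the members of a generating pi-system
    vanish is zero almost everywhere. *)
Lemma ae_eq0_pi_system {R : realType} d (T : measurableType d)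
    (mu : {measure set T -> \bar R}) (G : set (set T)) (D : set T) (F : T -> R) :
  measurable = <<s G >> -> setI_closed G -> measurable D ->
  mu.-integrable D (EFin \o F) -> Rintegral mu D F = 0 ->
  (forall A, G A -> Rintegral mu (D `&` A) F = 0) ->
  {ae mu, forall x, D x -> F x = 0}.
Proof.
move=> GE GI mD iF F0 FG.
have iFS A : measurable A -> A `<=` D -> mu.-integrable A (EFin \o F).
  by move=> mA AD; exact: integrableS iF.
have toE A : measurable A -> A `<=` D -> Rintegral mu A F = 0 ->
    (\int[mu]_(x in A) (F x)%:E = 0)%E.
  move=> mA AD; rewrite /Rintegral => H.
  by rewrite -[LHS]fineK ?H//; exact/integrable_fin_num/iFS.
have mDI A : measurable A -> measurable (D `&` A) by move=> mA; exact: measurableI.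
have H A : measurable A -> Rintegral mu (D `&` A) F = 0.
  move=> mA; have : <<s G >> A by rewrite -GE.
  move: A {mA}; apply: (@dynkin_induction _ _ G (fun A => Rintegral mu (D `&` A) F = 0) GE GI) => //.
  - by rewrite setIT.
  - move=> S mS HS.
    have := @Rintegral_setU _ _ _ mu (D `&` S) (D `&` ~` S) F (mDI _ mS).
    rewrite -setIUr setUv setIT F0 HS add0r => <- //; first exact/mDI/measurableC.
    by apply/disj_setPS => x [[_ Sx] [_]].
  - move=> B mB tB HB; rewrite setI_bigcupr /Rintegral integral_bigcup.
    + by rewrite eseries0// => i _ _; apply: toE => //; exact: mDI.
    + exact: trivIset_setIl.
    + by move=> k; exact: mDI.
    + rewrite -setI_bigcupr; apply: iFS => //.
      by apply: mDI; exact: bigcupT_measurable.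
have /= := @integral_ae_eq _ _ _ mu D mD (cst 0%E) (EFin \o F) iF (measurable_cst _).
move=> K; have {K} : ae_eq mu D (EFin \o F) (cst 0%E).
  apply: K => E ED mE; rewrite integral0; apply: toE => //.
  by rewrite -(setIidr ED); exact: H.
by apply: filterS => x + Dx => /(_ Dx) /= [].
Qed.

(** * The fundamental lemma of the calculus of variations *)

Section DuBoisReymond.
Context {R : realType}.
Local Notation V3 := 'rV[R]_3.
Local Notation T1 := (measurableTypeR R).
Local Notation T3 := (T1 * T1 * T1)%type.
Implicit Types (f g : V3 -> R) (U D : set V3) (x y v a q : V3) (r : R).

(** The open octants with arbitrary corner; their traces on triples form a
    pi-system that generates the measurable sets. *)
Definition octant a : set V3 := [set x | forall i, a 0 i < x 0 i].

Lemma octantE a : (vec3 @^-1` octant a : set T3) =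
  (`]a 0 0, +oo[%classic `*` `]a 0 1, +oo[%classic) `*` `]a 0 2, +oo[%classic.
Proof.
apply/seteqP; split=> [p H|p [[/= H0 H1] H2]].
  have := H 0; have := H 1; have := H 2; rewrite !vec3E => h2 h1 h0.
  by split; [split|]; rewrite /= in_itv/= andbT.
rewrite /preimage /octant /=.
by elim/I3_ind; rewrite vec3E; [move: H0|move: H1|move: H2]; rewrite in_itv/= andbT.
Qed.

Definition octants : set (set T3) := [set A | exists a, A = vec3 @^-1` octant a].

Lemma octantsI : setI_closed octants.
Proof.
move=> _ _ [a ->] [b ->]; exists (\row_i Num.max (a 0 i) (b 0 i)).
apply/seteqP; split=> p /=.
  by move=> [Ha Hb] i; rewrite mxE gt_max Ha Hb.
by move=> H; split=> i; have := H i; rewrite mxE gt_max => /andP[].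
Qed.

Lemma measurable_octants : @measurable _ T3 = <<s octants >>.
Proof.
apply/seteqP; split; last first.
  apply: smallest_sub; first exact: sigma_algebra_measurable.
  move=> _ [a ->]; rewrite octantE; apply: measurableX; last exact: measurable_itv.
  by apply: measurableX; exact: measurable_itv.
pose S := g_sigma_algebraType octants.
have mcoord (i : 'I_3) : measurable_fun setT (fun p : S => (vec3 p 0 i : T1)).
  apply: (measurability _ (RGenOInfty.measurableE R)) => _ [_ [a ->] <-].
  rewrite setTI.
  rewrite [X in measurable X](_ : _ = \bigcup_n
     (vec3 @^-1` octant (\row_j if j == i then a else - n%:R) : set S)).
    apply: bigcupT_measurable => n; apply: sub_sigma_algebra; by eexists.
  apply/seteqP; split=> p /=; last first.
    by move=> [n _ /(_ i)]; rewrite mxE eqxx in_itv/= andbT.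
  rewrite in_itv/= andbT => ap.
  have [n _ /(_ n (leqnn n)) Hn] := nbhs_infty_gtr `|vec3 p : V3|.
  exists n => // j; rewrite mxE; case: eqP => [->//|_].
  rewrite ltrNl; apply: le_lt_trans Hn; apply: le_trans (coord_norm_le _ j).
  by rewrite -normrN ler_norm.
have mid : measurable_fun setT (id : S -> T3).
  have -> : (id : S -> T3) = (fun p => ((vec3 p 0 0, vec3 p 0 1), vec3 p 0 2)).
    by apply/funext => -[[p q] r]; rewrite !vec3E.
  apply: measurable_fun_pair; last exact: mcoord.
  by apply: measurable_fun_pair; exact: mcoord.
by move=> A mA; have := mid measurableT A mA; rewrite setTI.
Qed.

(** A smooth function that is positive exactly on the open box [ball q r]. *)
Definition box_bump (q : V3) (r : R) (x : V3) : R :=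
  \prod_(i < 3) (flat 1 (r - (x 0 i - q 0 i)) * flat 1 (r + (x 0 i - q 0 i))).

Lemma smooth_prod I (s : seq I) (F : I -> V3 -> R) : (forall i, smooth (F i)) ->
  smooth (fun x => \prod_(i <- s) F i x).
Proof.
move=> sF; elim: s => [|i s IH].
  by rewrite (_ : (fun x => _) = cst 1); [exact: smooth_cst|apply/funext => x; rewrite big_nil].
have -> : (fun x => \prod_(j <- i :: s) F j x) = (fun x => F i x * \prod_(j <- s) F j x).
  by apply/funext => x; rewrite big_cons.
exact: smoothM (sF i) IH.
Qed.

Lemma smooth_box_bump q r : smooth (box_bump q r).
Proof.
have sc i : smooth (fun x : V3 => x 0 i - q 0 i).
  by apply: smoothD; [exact: smooth_coord|exact: smooth_cst].
apply: smooth_prod => i; apply: smoothM; apply: smooth_flat; apply: smoothD => //;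
  try exact: smooth_cst.
by under eq_fun do rewrite -mulN1r; exact: smoothZ.
Qed.

Lemma box_bump_gt0 q r x : ball q r x -> 0 < box_bump q r x.
Proof.
move=> /ball_row3P[r0 H]; apply: prodr_gt0 => i _.
have := H i; rewrite distrC ltr_norml => /andP[h1 h2].
by rewrite mulr_gt0// flat1_gt0; lra.
Qed.

Lemma box_bump_out q r x : ~ (forall i, `|q 0 i - x 0 i| <= r) -> box_bump q r x = 0.
Proof.
move=> /existsNP[i /negP]; rewrite -ltNge distrC ltr_normr => H.
rewrite /box_bump (bigD1 i)//=; case/orP: H => H.
  have -> : flat 1 (r - (x 0 i - q 0 i)) = 0 by apply: flat_le0; lra.
  by rewrite !mul0r.
have -> : flat 1 (r + (x 0 i - q 0 i)) = 0 by apply: flat_le0; lra.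
by rewrite mulr0 mul0r.
Qed.

Lemma compact_box (q : V3) (r : R) : compact [set x : V3 | forall i, `|q 0 i - x 0 i| <= r].
Proof.
have := @rV_compact R^o 3 (fun i => `[q 0 i - r, q 0 i + r]%classic) (fun i => @segment_compact R _ _).
congr compact; apply/seteqP; split=> x H i; have := H i;
  rewrite /= in_itv/= ler_distlC; by [].
Qed.

Lemma test_box_bump U q r : (forall y, (forall i, `|q 0 i - y 0 i| <= r) -> U y) ->
  test_fun U (box_bump q r).
Proof.
move=> HU; split; first exact: smooth_box_bump.
exists [set x : V3 | forall i, `|q 0 i - x 0 i| <= r]; split=> //.
  exact: compact_box.
by move=> x; exact: box_bump_out.
Qed.

Lemma test_bsupp U f : test_fun U f -> bsupp f.
Proof.
move=> [_ [C [cC _ f0]]]; have [M [_ HM]] := compact_bounded cC.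
exists (`|M| + 1) => x xM; apply: f0 => Cx.
have := HM (`|M| + 1); rewrite (le_lt_trans (ler_norm M))// ?ltrDl// => /(_ isT x Cx).
by rewrite /= leNgt xM.
Qed.

Lemma test_bm U f : test_fun U f -> bm f.
Proof.
move=> tf; apply: bm_continuous; last exact: test_bsupp tf.
by case: tf => sf _; exact: smooth_continuous.
Qed.

Lemma test_mul U f g : smooth g -> test_fun U f -> test_fun U (fun x => g x * f x).
Proof.
move=> sg [sf [C [cC CU f0]]]; split; first exact: smoothM.
by exists C; split=> // x /f0 ->; rewrite mulr0.
Qed.

Lemma test_partial U f i : test_fun U f -> test_fun U (partial i f).
Proof.
move=> [sf [C [cC CU f0]]]; split; first exact: smooth_partial.
exists C; split=> //; apply: partial_outside => //.
by apply: compact_closed cC; exact: norm_hausdorff.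
Qed.

Lemma test_out U f x : test_fun U f -> ~ U x -> f x = 0.
Proof. by move=> [_ [C [_ CU f0]]] nUx; apply: f0 => /CU. Qed.

Lemma L2_bm_integrable U f g : measurable (vec3 @^-1` U : set T3) -> L2 U f -> bm g ->
  integrable3 U (fun x => f x * g x).
Proof.
move=> mU [mf f2] bg; have [[mg _] _] := bg.
apply: (@integrableM_L2 _ _ _ leb3 _ (f \o vec3) (g \o vec3)) => //.
  exact: measurable_funTS.
have := bm_integrable mU (bmMr bg.1 bg) => /integrableP[_].
apply: le_lt_trans; rewrite le_eqVlt; apply/orP; left; apply/eqP.
by apply: eq_integral => p _ /=; rewrite -expr2 ger0_norm// sqr_ge0.
Qed.

(** The fundamental lemma of the calculus of variations. The open set is a
    countable union of boxes on which a test function is positive, and the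
    integrals of [f] times this function over octants vanish, since the
    indicator of an octant is a limit of smooth functions. *)
Lemma int3_test_eq0 U f : open U -> L2 U f ->
  (forall phi, test_fun U phi -> int3 U (fun x => f x * phi x) = 0) ->
  ae_on U (fun x => f x = 0).
Proof.
move=> oU Lf H; have mU := measurable_open3 oU.
have [q [r [UE UI]]] := open_ball_cover oU.
pose F n (p : T3) := f (vec3 p) * box_bump (q n) (r n) (vec3 p).
have tb n : 0 < r n -> test_fun U (box_bump (q n) (r n)).
  by move=> r0; apply: test_box_bump => y yr; exact: UI yr r0.
have Fae n : {ae leb3, forall p, (vec3 @^-1` U) p -> 0 < r n -> F n p = 0}.
  have [r0|r0] := leP (r n) 0.
    by apply: aeW.
  have iF := L2_bm_integrable mU Lf (test_bm (tb n r0)).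
  have [mf _] := Lf; have [[mb _] _] := test_bm (tb n r0).
  suff : {ae leb3, forall p, (vec3 @^-1` U) p -> F n p = 0}.
    by apply: ae_imp => p Hp Up _; exact: Hp.
  apply: (ae_eq0_pi_system measurable_octants octantsI mU iF); first exact: H (tb n r0).
  move=> _ [a ->]; rewrite Rintegral_mkcondr.
  pose c m (x : V3) := \prod_(i < 3) flat 1 (m.+1%:R * (x 0 i - a 0 i)).
  have sc m : smooth (c m).
    apply: smooth_prod => i; apply: smooth_flat; apply: smoothZ.
    by apply: smoothD; [exact: smooth_coord|exact: smooth_cst].
  have c01 m x : 0 <= c m x <= 1.
    apply: (big_ind (fun y : R => 0 <= y <= 1)); first by rewrite ler01 lexx.
      move=> y z /andP[y0 y1] /andP[z0 z1].
      by rewrite mulr_ge0//= mulr_ile1.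
    by move=> i _; rewrite flat1_ge0 flat1_le1.
  apply: (@dominated_Rintegral_cst _ _ _ leb3 _ (fun m p => F n p * c m (vec3 p)) _
    (fun p => `|F n p|)) => //.
  - move=> m; have mc : measurable_fun setT (fun p : T3 => c m (vec3 p)).
      exact: continuous_measurable3 (smooth_continuous (sc m)).
    apply: measurable_funM; last exact: measurable_funTS mc.
    by apply: measurable_funM => //; exact: measurable_funTS.
  - move=> p _; have -> : ((F n) \_ (vec3 @^-1` octant a)) p =
        F n p * \prod_(i < 3) (0 < vec3 p 0 i - a 0 i)%R%:R.
      rewrite patchE; case: ifPn => [/set_mem Hp|/negP Hp].
        by rewrite big1 ?mulr1// => i _; rewrite subr_gt0 Hp.
      have [i /negP nai] : exists i, ~ (a 0 i < vec3 p 0 i).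
        by apply/existsNP => K; apply: Hp; exact/mem_set.
      by rewrite (bigD1 i)//= subr_gt0 (negPf nai) mul0r mulr0.
    apply: cvgM; first exact: cvg_cst.
    rewrite !big_ord_recl big_ord0; under eq_fun do rewrite /c !big_ord_recl big_ord0.
    by do 3 (apply: cvgM; first exact: cvg_flat1); exact: cvg_cst.
  - exact: integrable_norm.
  - move=> m p _; rewrite normrM ler_piMr//.
    by have /andP[h1 h2] := c01 m (vec3 p); rewrite ger0_norm.
  - move=> m; rewrite -[RHS](H _ (test_mul (sc m) (tb n r0))).
    by apply: eq_Rintegral => p _; rewrite /F mulrAC -mulrA.
have := ae_foralln Fae; apply: ae_imp => p Hp Up.
have [n _ /[dup] b /ball_row3P[r0 _]] : (\bigcup_n ball (q n) (r n)) (vec3 p) by rewrite -UE.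
have /eqP := Hp n Up r0; rewrite /F mulf_eq0 => /orP[/eqP//|].
by rewrite gt_eqF// box_bump_gt0.
Qed.

End DuBoisReymond.

(** * Derivatives of indicators of half-spaces *)

Section PlanesAndJumps.
Context {R : realType}.
Local Notation V3 := 'rV[R]_3.
Local Notation T1 := (measurableTypeR R).
Local Notation T3 := (T1 * T1 * T1)%type.
Implicit Types (f q phi : V3 -> R) (U D : set V3) (x y v g d : V3).

Lemma L2_locbdd U f (N : R) : measurable (vec3 @^-1` U : set T3) -> U `<=` cube N ->
  locbdd f -> L2 U f.
Proof.
move=> mU UN [mf bf]; have [M HM] := bf N; split; first exact: measurable_funTS.
have Hi : leb3.-integrable (vec3 @^-1` U : set T3) (EFin \o (fun p => f (vec3 p) ^+ 2)).
  apply: (@bounded_integrable _ _ _ leb3 _ _ (M ^+ 2)) => //.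
  - apply: le_lt_trans (leb3_cube_lty N); rewrite /leb3; apply: le_measure; rewrite ?inE//.
    + exact: (measurable_closed3 (@closed_cube_norm _ N)).
    + by move=> p /UN.
  - by apply: measurable_funX; exact: measurable_funTS.
  - move=> p /UN /HM fM; rewrite normrX lerXn2r// ?nnegrE//.
    by rewrite (le_trans _ fM).
have /integrableP[_] := Hi; apply: le_lt_trans; rewrite le_eqVlt; apply/orP; left; apply/eqP.
by apply: eq_integral => p _ /=; rewrite ger0_norm// sqr_ge0.
Qed.

Lemma measurable_setT3 : measurable (vec3 @^-1` setT : set T3).
Proof. by rewrite preimage_setT. Qed.

Lemma int3_partial_sum0 (X : 'I_3 -> V3 -> R) : (forall i, smooth (X i)) ->
  (forall i, bsupp (X i)) -> int3 setT (fun x => \sum_i partial i (X i) x) = 0.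
Proof.
move=> sX bX; rewrite (@int3_sum _ _ _ _ (fun i => partial i (X i)) measurable_setT3).
  by apply: big1 => i _; exact: int_partial0.
move=> i; apply: bm_integrable; first exact: measurable_setT3.
apply: bm_continuous; last exact: bsupp_partial.
exact/smooth_continuous/smooth_partial.
Qed.

Lemma locbdd_half g x0 : locbdd (fun x => (0 < dot g (x - x0))%R%:R).
Proof. exact/locbdd_pos/smooth_continuous/smooth_affine. Qed.

Lemma partial_affine_mul g x0 (c : R) i phi x : smooth phi ->
  partial i (fun y => c * dot g (y - x0) * phi y) x =
  c * (g 0 i * phi x + dot g (x - x0) * partial i phi x).
Proof.
move=> sphi; have sa := smooth_affine g x0.
rewrite (partial_smoothM i x (smoothZ c sa) sphi) (partialZ i c x sa) partial_affine; ring.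
Qed.

(** Integration by parts for the ramp [(g . (x - x0))^+]. *)
Lemma int3_ramp g x0 i phi : smooth phi -> bsupp phi ->
  int3 setT (fun x => (0 < dot g (x - x0))%R%:R *
    (g 0 i * phi x + dot g (x - x0) * partial i phi x)) = 0.
Proof.
move=> sphi bphi; have sa := smooth_affine g x0.
pose X j x := (j == i)%:R * dot g (x - x0) * phi x.
rewrite -[RHS](@int3_halfspace_div _ g x0 X (fun x => g 0 i * phi x)).
- apply: eq_int3 => x _; congr (_ * _).
  rewrite (bigD1 i)//= big1 ?addr0.
    by rewrite partial_affine_mul// eqxx mul1r.
  by move=> j /negPf ji; rewrite partial_affine_mul// ji mul0r.
- by move=> j; exact: (smoothM (smoothZ (j == i)%:R sa) sphi).
- by move=> j; exact: bsuppMl.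
- apply: bmMl; first exact: locbdd_cst.
  by apply: bm_continuous => //; exact: smooth_continuous.
- move=> x; rewrite (bigD1 i)//= big1 ?addr0.
    by rewrite /X eqxx mul1r; ring.
  by move=> j /negPf ji; rewrite /X ji !mul0r mulr0.
Qed.

(** The indicator of the plane is [1] minus those of the two open half-spaces;
    integrating the three ramps [t], [t^+] and [t^-] by parts, its integral
    against every test function vanishes. *)
Lemma plane_negligible g x0 : g != 0 ->
  {ae leb3, forall p : T3, dot g (vec3 p - x0) != 0}.
Proof.
move=> g0; have [i gi] : exists i, g 0 i != 0.
  apply: contrapT => /forallNP H; move/eqP: g0; apply; apply/rowP => i.
  by have /negP/negPn/eqP -> := H i; rewrite mxE.
pose t x := dot g (x - x0).
pose f x : R := 1 - (0 < t x)%R%:R - (0 < - t x)%R%:R.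
have fE x : f x = (t x == 0)%:R.
  by rewrite /f oppr_gt0; case: ltrgtP; rewrite ?subr0 ?subrr.
have tN x : - t x = dot (- g) (x - x0) by rewrite dotNl.
have lf : locbdd f.
  apply: locbddD; last by apply: locbdd_opp; under eq_fun do rewrite tN; exact: locbdd_half.
  by apply: locbddD; [exact: locbdd_cst|apply: locbdd_opp; exact: locbdd_half].
have H n : ae_on (ball (0 : V3) n%:R) (fun x => f x = 0).
  apply: int3_test_eq0.
  - exact: ball_open.
  - apply: (@L2_locbdd _ _ n%:R) => //.
      by apply: measurable_open3; exact: ball_open.
    by move=> x; rewrite -ball_normE /= sub0r normrN => /ltW.
  - move=> phi tphi; have bphi := test_bsupp tphi; have [sphi _] := tphi.
    have bmphi := test_bm tphi; have bmd := test_bm (test_partial i tphi).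
    pose G x := g 0 i * phi x + t x * partial i phi x.
    have bG : bm G.
      apply: bmD; first by apply: bmMl => //; exact: locbdd_cst.
      by apply: bmMl => //; exact: locbdd_affine.
    have E0 : int3 setT G = 0.
      have := @int3_partial_sum0 (fun j x => (j == i)%:R * t x * phi x).
      rewrite (_ : (fun x => _) = G) => [|]; last first.
        apply/funext => x; rewrite (bigD1 i)//= big1 ?addr0.
          by rewrite partial_affine_mul// eqxx mul1r.
        by move=> j /negPf ji; rewrite partial_affine_mul// ji mul0r.
      apply=> j; last exact: bsuppMl.
      exact: (smoothM (smoothZ (j == i)%:R (smooth_affine g x0)) sphi).
    have E1 := int3_ramp g x0 i sphi bphi.
    have E2 := int3_ramp (- g) x0 i sphi bphi.
    have mT := measurable_setT3.
    rewrite int3_mkcond; last by move=> x nx; rewrite (test_out tphi nx) mulr0.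
    apply/eqP; rewrite -(mulrI_eq0 _ (mulfI gi)) -int3Z//; last first.
      by apply: bm_integrable => //; exact: bmMl.
    pose H1 x := (0 < t x)%R%:R * G x.
    pose H2 x := (0 < dot (- g) (x - x0))%R%:R *
      ((- g) 0 i * phi x + dot (- g) (x - x0) * partial i phi x).
    have bH1 : bm H1 by apply: bmMl => //; exact: locbdd_half.
    have bH2 : bm H2.
      apply: bmMl; first exact: locbdd_half.
      apply: bmD; first by apply: bmMl => //; exact: locbdd_cst.
      by apply: bmMl => //; exact: locbdd_affine.
    apply/eqP; rewrite (_ : 0 = int3 setT G + - int3 setT H1 + int3 setT H2); last first.
      by rewrite E0 E1 E2 oppr0 !addr0.
    have iG := bm_integrable mT bG; have iH1 := bm_integrable mT bH1.
    have iH2 := bm_integrable mT bH2; have iN := bm_integrable mT (bmN bH1).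
    rewrite -int3N// -int3D// -int3D//; last exact: integrable3D.
    apply: eq_int3 => x _; rewrite /H1 /H2 -tN oppV /f /G oppr_gt0.
    by case: (ltrgtP (t x) 0) => [_|_|->]/=; ring.
have := ae_foralln H; apply: ae_imp => p Hp; apply/negP => /eqP tp.
have [n _ /(_ n (leqnn n)) Hn] := nbhs_infty_gtr `|vec3 p : V3|.
have bp : ball (0 : V3) n%:R (vec3 p) by rewrite -ball_normE /= sub0r normrN.
by have := Hp n bp; rewrite fE /t tp eqxx => /eqP; rewrite oner_eq0.
Qed.

(** If a distributional derivative of the indicator of a half-space is square
    integrable, it is zero, because it is carried by the bounding plane: test
    with functions cut off to one side of the plane. *)
Lemma jump_test0 U q g x0 d : open U -> g != 0 -> L2 U q ->
  (forall phi, test_fun U phi -> int3 U (fun x => (0 < dot g (x - x0))%R%:R *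
     \sum_i d 0 i * partial i phi x) = int3 U (fun x => q x * phi x)) ->
  forall phi, test_fun U phi -> int3 U (fun x => q x * phi x) = 0.
Proof.
move=> oU g0 Lq H phi tphi; have mU := measurable_open3 oU.
have [sphi _] := tphi; have bphi := test_bsupp tphi; have bmphi := test_bm tphi.
pose t x := dot g (x - x0); have st : smooth t := smooth_affine g x0.
have [mq _] := Lq; have [[mphi _] _] := bmphi.
have iq := L2_bm_integrable mU Lq bmphi.
have side (s : R) : s = 1 \/ s = -1 ->
    int3 U (fun x => (0 < s * t x)%R%:R * (q x * phi x)) = 0.
  move=> s1; pose c n x := flat 1 (n.+1%:R * (s * t x)).
  have sst n : smooth (fun x => n.+1%:R * (s * t x)) by exact: smoothZ _ (smoothZ s st).
  have sc n : smooth (c n) := smooth_flat 1 (sst n).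
  have tc n : test_fun U (fun x => c n x * phi x) := test_mul (sc n) tphi.
  have dc n i x : partial i (fun x => c n x * phi x) x = c n x * partial i phi x +
      flat (dflat 1) (n.+1%:R * (s * t x)) * (n.+1%:R * (s * g 0 i)) * phi x.
    rewrite (partial_smoothM i x (sc n) sphi); congr (_ + _ * _).
    rewrite (partial_smooth_flat i 1 x (sst n)); congr (_ * _).
    by rewrite (partialZ i _ x (smoothZ s st)) (partialZ i _ x st) partial_affine.
  have dc0 n i x : s * t x <= 0 -> partial i (fun x => c n x * phi x) x = 0.
    move=> st0; have st1 : n.+1%:R * (s * t x) <= 0 by rewrite mulr_ge0_le0.
    by rewrite dc /c !flat_le0// !mul0r addr0.
  have K n : int3 U (fun x => q x * (c n x * phi x)) = 0.
    rewrite -(H _ (tc n)); case: s1 => s1.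
      transitivity (int3 setT (fun x => \sum_i partial i (fun y => d 0 i * (c n y * phi y)) x)).
        rewrite int3_mkcond => [|x nUx]; last first.
          rewrite big1 ?mulr0// => i _.
          by rewrite (test_out (test_partial i (tc n)) nUx) mulr0.
        apply: eq_int3 => x _; rewrite mulr_sumr; apply: eq_bigr => i _.
        rewrite (partialZ i _ x (tc n).1).
        by case: ltP => tx; rewrite ?mul1r// dc0 ?mulr0// s1 mul1r.
      apply: int3_partial_sum0 => i.
        exact: smoothZ (tc n).1.
      exact/bsuppMl/test_bsupp/tc.
    apply: int3_eq0 => x _; case: ltP => tx; rewrite ?mul0r//.
    by rewrite big1 ?mulr0// => i _; rewrite dc0 ?mulr0// s1; rewrite mulN1r oppr_le0 ltW.
  apply: (@dominated_Rintegral_cst _ _ _ leb3 _ (fun n p => q (vec3 p) * (c n (vec3 p) * phi (vec3 p))) _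
    (fun p => `|q (vec3 p) * phi (vec3 p)|)) => //.
  - move=> n; apply: measurable_funM => //; apply: measurable_funM; last exact: measurable_funTS.
    apply: measurable_funTS; exact: continuous_measurable3 (smooth_continuous (sc n)).
  - move=> p _; rewrite mulrCA; apply: cvgM; first exact: cvg_cst.
    by apply: cvgM; [exact: cvg_flat1|exact: cvg_cst].
  - exact: integrable_norm.
  - move=> n p _; rewrite !normrM ler_wpM2l// ler_piMl//.
    by rewrite ger0_norm ?flat1_le1// flat1_ge0.
have mpos (s : R) : measurable_fun (vec3 @^-1` U : set T3) (fun p => ((0 < s * t (vec3 p))%R%:R : R)).
  apply: measurable_funTS; apply: (measurable_pos (f := fun x => s * t x)).
  exact: continuous_measurable3 (smooth_continuous (smoothZ s st)).
have mqphi : measurable_fun (vec3 @^-1` U : set T3) (fun p => q (vec3 p) * phi (vec3 p)).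
  by apply: measurable_funM => //; exact: measurable_funTS.
have iside (s : R) : integrable3 U (fun x => (0 < s * t x)%R%:R * (q x * phi x)).
  have := @integrableM_bounded _ _ _ leb3 _ _ _ 1 mU iq (mpos s).
  move=> K; apply: eq_integrable (K _) => //.
    by move=> p _ /=; rewrite mulrC.
  by move=> p _; case: (0 < _); rewrite ?normr1// normr0 ler01.
transitivity (int3 U (fun x => (0 < 1 * t x)%R%:R * (q x * phi x) +
    (0 < -1 * t x)%R%:R * (q x * phi x))).
  apply: ae_eq_Rintegral => //.
  - by apply: measurable_funD; exact: measurable_funM (mpos _) mqphi.
  - apply: ae_imp (plane_negligible x0 g0) => p tp _; rewrite mul1r mulN1r oppr_gt0 /t.
    by move: tp; case: ltrgtP; rewrite ?mul0r ?mul1r ?addr0 ?add0r.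
by rewrite int3D// !side ?addr0//; [right|left].
Qed.

Lemma leb3_open_neq0 U : open U -> U !=set0 -> {ae leb3, forall p : T3, ~ U (vec3 p)} -> False.
Proof.
move=> oU [x Ux] H.
have /nbhs_ballP[e /= e0 eU] : nbhs x U by exact: open_nbhs_nbhs.
pose B := box3 (x - const_mx e) (x + const_mx e).
have cE i : (const_mx e : V3) 0 i = e by rewrite mxE.
have BU : B `<=` U.
  move=> y By; apply: eU; apply/ball_row3P; split=> // i.
  by have := By i; rewrite ltr_distlC !addV oppV cE.
have : leb3 (vec3 @^-1` B) = 0%E.
  have [A [mA A0 AU]] := H.
  apply/eqP; rewrite eq_le measure_ge0 andbT -A0; apply: le_measure; rewrite ?inE//.
    exact: measurable_box3.
  by move=> p /BU Up; apply: AU => /=; exact.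
rewrite leb3_box3 => [|i]; last by rewrite !addV oppV cE; lra.
move=> [] /eqP; rewrite !addV !oppV !cE; apply/negP; rewrite !mulf_neq0//; rewrite gt_eqF//; lra.
Qed.

Lemma smooth_sqdist z : smooth (fun x => dot (x - z) (x - z)).
Proof.
apply: smooth_sum => i; apply: smoothM;
  by under eq_fun do rewrite addV oppV; exact: smoothD (smooth_coord i) (smooth_cst _).
Qed.

Lemma partial_smoothD i f q x : smooth f -> smooth q ->
  partial i (fun y => f y + q y) x = partial i f x + partial i q x.
Proof. by move=> sf sg; apply: (@partialD _ i f q x); exact: smooth_derivable. Qed.

Lemma partial_sqdist i z x : partial i (fun y => dot (y - z) (y - z)) x = 2 * (x - z) 0 i.
Proof.
have sc j : smooth (fun y : V3 => y 0 j + - z 0 j) := smoothD (smooth_coord j) (smooth_cst _).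
have pc j : partial i (fun y : V3 => y 0 j + - z 0 j) x = (i == j)%:R.
  by rewrite (partial_smoothD i x (smooth_coord j) (smooth_cst _)) partial_cst addr0 partial_coord.
have ss j := smoothM (sc j) (sc j).
rewrite (_ : (fun y => _) = fun y => (y 0 0 + - z 0 0) * (y 0 0 + - z 0 0) +
  (y 0 1 + - z 0 1) * (y 0 1 + - z 0 1) + (y 0 2 + - z 0 2) * (y 0 2 + - z 0 2)); last first.
  by apply/funext => y; rewrite dotE !addV !oppV.
rewrite (partial_smoothD i x (smoothD (ss 0) (ss 1)) (ss 2)) (partial_smoothD i x (ss 0) (ss 1)).
rewrite !(partial_smoothM i x (sc _) (sc _)) !pc addV oppV.
by move: i {pc}; elim/I3_ind => /=; ring.
Qed.

Lemma flat_dflat1_gt0 (s : R) : 0 < s -> 0 < flat (dflat 1) s.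
Proof.
move=> s0; have := flat_mulX s; rewrite -(pmulr_rgt0 _ s0) => ->.
by rewrite -(mul1r 'X) -(pmulr_lgt0 _ s0) flatX flat1_gt0.
Qed.

Lemma flat_dflat1_ge0 (s : R) : 0 <= flat (dflat 1) s.
Proof. by have [s0|s0] := leP s 0; [rewrite flat_le0|exact/ltW/flat_dflat1_gt0]. Qed.

(** A half-space with boundary through [U] has zero derivative in [U] along
    tangential directions only. If [dot g d] were nonzero, [g] would be a
    combination of [d] and of a tangential direction, so the derivative along
    [g] would vanish as well; it does not on a bump centred on the plane, whose
    derivative along [g] is negative on the positive side. *)
Lemma jump_normal0 U g z d : open U -> U z -> g != 0 ->
  (forall phi, test_fun U phi -> int3 U (fun x => (0 < dot g (x - z))%R%:R *
     \sum_i d 0 i * partial i phi x) = 0) -> dot g d = 0.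
Proof.
move=> oU Uz g0 H; apply/eqP; apply: contraT => c0.
have mU := measurable_open3 oU; pose t x := dot g (x - z).
have /nbhs_ballP[e /= e0 eU] : nbhs z U by exact: open_nbhs_nbhs.
pose r := e / 2; have r0 : 0 < r by rewrite divr_gt0.
have gg : 0 < dot g g by rewrite lt_neqAle dotvv_ge0 andbT eq_sym dotvv_eq0.
pose rho x := r ^+ 2 - dot (x - z) (x - z).
pose phi x := flat 1 (rho x).
have rhoE : rho = fun x => r ^+ 2 + -1 * dot (x - z) (x - z).
  by apply/funext => x; rewrite mulN1r.
have srho : smooth rho.
  by rewrite rhoE; exact: smoothD (smooth_cst _) (smoothZ _ (smooth_sqdist z)).
have sphi : smooth phi by exact: smooth_flat.
have drho i x : partial i rho x = -2 * (x - z) 0 i.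
  rewrite rhoE (partial_smoothD i x (smooth_cst _) (smoothZ _ (smooth_sqdist z))).
  by rewrite partial_cst (partialZ i _ x (smooth_sqdist z)) partial_sqdist; ring.
have tphi : test_fun U phi.
  split=> //; exists [set x : V3 | forall i, `|z 0 i - x 0 i| <= r]; split.
  - exact: compact_box.
  - move=> x Hx; apply: eU; apply/ball_row3P; split=> // i.
    by apply: (le_lt_trans (Hx i)); rewrite /r; lra.
  - move=> x /existsNP[i /negP]; rewrite -ltNge => Hi; apply: flat_le0.
    rewrite subr_le0 /dot (bigD1 i)//= addV oppV ler_wpDr//.
      by apply: sumr_ge0 => j _; rewrite -expr2 sqr_ge0.
    rewrite -expr2 -[leRHS]real_normK ?num_real// distrC lerXn2r ?nnegrE ?ltW//.
    by rewrite (lt_trans r0).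
have bphi := test_bsupp tphi; have bmd i := test_bm (test_partial i tphi).
(* the projection of [g] to the tangential directions, parallel to [d] *)
pose tau := g - (dot g g / dot g d) *: d.
have gtau : dot g tau = 0 by rewrite dotDr dotNr dotZr divfK// subrr.
have Htau : int3 U (fun x => (0 < t x)%R%:R * \sum_i tau 0 i * partial i phi x) = 0.
  rewrite int3_mkcond => [|x nUx]; last first.
    by rewrite big1 ?mulr0// => i _; rewrite (test_out (test_partial i tphi) nUx) mulr0.
  rewrite -[RHS](@int3_halfspace_div _ g z (fun i x => tau 0 i * phi x) (fun=> 0)).
  - apply: eq_int3 => x _; congr (_ * _); apply: eq_bigr => i _.
    by rewrite partialZ.
  - by move=> i; exact: smoothZ.
  - by move=> i; exact: bsuppMl.
  - by split; [exact: locbdd_cst|exists 0].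
  - move=> x; rewrite mulr0; transitivity (dot g tau * phi x); last by rewrite gtau mul0r.
    by rewrite /dot mulr_suml; apply: eq_bigr => i _; rewrite mulrA.
(* [-2 h] is the derivative of [phi] along [g] in the half-space *)
pose h x := (0 < t x)%R%:R * (flat (dflat 1) (rho x) * t x).
have bh : bm (fun x => (0 < t x)%R%:R * \sum_i d 0 i * partial i phi x).
  apply: bmMl; first exact: locbdd_half.
  by apply: bm_sum => i; apply: bmMl => //; exact: locbdd_cst.
have bt : bm (fun x => (0 < t x)%R%:R * \sum_i tau 0 i * partial i phi x).
  apply: bmMl; first exact: locbdd_half.
  by apply: bm_sum => i; apply: bmMl => //; exact: locbdd_cst.
have hE x : h x = (- 2)^-1 * (dot g g / dot g d) * ((0 < t x)%R%:R * \sum_i d 0 i * partial i phi x)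
     + (-2)^-1 * ((0 < t x)%R%:R * \sum_i tau 0 i * partial i phi x).
  have S (w : V3) : \sum_i w 0 i * partial i phi x = flat (dflat 1) (rho x) * (-2 * dot w (x - z)).
    rewrite /dot !mulr_sumr; apply: eq_bigr => i _.
    by rewrite (partial_smooth_flat i 1 x srho) drho; ring.
  rewrite /h !S dotDl dotNl dotZl -/(t x).
  move: c0 (t x) (flat _ _) (_ < _) => c0' T F B.
  by field.
have h0 : int3 U h = 0.
  rewrite (eq_int3 (fun x _ => hE x)) int3D//; last 2 first.
  - by apply: bm_integrable => //; apply: bmMl => //; exact: locbdd_cst.
  - by apply: bm_integrable => //; apply: bmMl => //; exact: locbdd_cst.
  by rewrite !int3Z ?H ?Htau ?mulr0 ?addr0//; exact: bm_integrable.
have hge0 x : 0 <= h x.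
  rewrite /h; case: ltP => [tx|_]; last by rewrite mul0r.
  by rewrite mul1r mulr_ge0 ?flat_dflat1_ge0 ?(ltW tx).
have bmh : bm h.
  apply: bmMl; first exact: locbdd_half.
  apply: bmMr; first exact: locbdd_affine.
  split; first exact: (locbdd_continuous (smooth_continuous (smooth_flat _ srho))).
  have [N HN] := bphi; exists N => x /HN; rewrite /phi.
  move=> f0; apply: flat_le0; rewrite leNgt; apply/negP => r1.
  by have := flat1_gt0 (rho x); rewrite f0 r1 ltxx.
have hae : {ae leb3, forall p : T3, (vec3 @^-1` U) p -> h (vec3 p) = 0}.
  have mh : measurable_fun (vec3 @^-1` U : set T3) (EFin \o (h \o vec3)).
    by apply/measurable_EFinP; apply: measurable_funTS; exact: bmh.1.1.
  have /(ae_eq_integral_abs leb3 mU mh) : (\int[leb3]_(p in vec3 @^-1` U) `|(EFin \o (h \o vec3)) p|)%E = 0%E.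
    have := h0; rewrite /int3 /Rintegral => H0.
    rewrite (eq_integral (fun p : T3 => (h (vec3 p))%:E)); last by move=> p _ /=; rewrite ger0_norm.
    by rewrite -[LHS]fineK ?H0//; exact/integrable_fin_num/(bm_integrable mU bmh).
  by apply: ae_imp => p Hp Up; have [] := Hp Up.
have oO : open [set x | (0 < t x) && (0 < rho x)].
  have ct : continuous t := smooth_continuous (smooth_affine g z).
  have cr : continuous rho := smooth_continuous srho.
  rewrite (_ : [set x | _] = t @^-1` [set y | 0 < y] `&` rho @^-1` [set y | 0 < y]).
    by apply: openI; apply: open_comp => //; exact: open_gt.
  by apply/seteqP; split=> x /=; [move/andP|move=> [-> ->]].
exfalso; apply: (leb3_open_neq0 oO).
  (* a point on the positive side of the plane, so close to [z] that the bump
     is positive there *)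
  pose eps := r / (2 * (1 + dot g g)).
  have d0 : 0 < 2 * (1 + dot g g) by lra.
  have e1 : 0 < eps by rewrite divr_gt0.
  have er : eps * (2 * (1 + dot g g)) = r by rewrite divfK// gt_eqF.
  exists (z + eps *: g); rewrite /= /t /rho addrC addKr dotZr dotZl dotZr mulr_gt0//=.
  rewrite -er (_ : _ - _ = eps * eps * (4 + 7 * dot g g + 4 * (dot g g * dot g g))); last by ring.
  have g2 : 0 < dot g g * dot g g by exact: mulr_gt0.
  apply: mulr_gt0; first exact: mulr_gt0.
  lra.
apply: ae_imp hae => p Hp /andP[tp rp].
have Up : U (vec3 p).
  apply: contrapT => nU; have := flat1_gt0 (rho (vec3 p)).
  by rewrite -/(phi (vec3 p)) (test_out tphi nU) ltxx rp.
by have := Hp Up; rewrite /h tp mul1r => /eqP; rewrite mulf_eq0 (gt_eqF tp) orbF gt_eqF// flat_dflat1_gt0.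
Qed.

End PlanesAndJumps.

(** * Tetrahedra *)

Section Tetrahedra.
Context {R : realType}.
Local Notation V3 := 'rV[R]_3.
Implicit Types (v : 'I_4 -> V3) (x y z g d : V3).

Lemma tetra_vertex v i : tetra v (v i).
Proof.
exists (fun j => (j == i)%:R); split=> //.
- by move=> j; rewrite inE.
- by rewrite (bigD1 i)//= eqxx big1 ?addr0// => j /negPf ->.
- by rewrite (bigD1 i)//= eqxx scale1r big1 ?addr0// => j /negPf ->; rewrite scale0r.
Qed.

Lemma tetra_convex v x y (s : R) : 0 <= s <= 1 -> tetra v x -> tetra v y ->
  tetra v ((1 - s) *: x + s *: y).
Proof.
move=> /andP[s0 s1] [l [l0 _ l1 ->]] [m [m0 _ m1 ->]].
exists (fun i => (1 - s) * l i + s * m i); split.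
- by move=> i; rewrite addr_ge0// mulr_ge0// subr_ge0.
- by move=> i; rewrite inE.
- by rewrite big_split/= -!mulr_sumr l1 m1 !mulr1 subrK.
- rewrite !scaler_sumr -big_split/=; apply: eq_bigr => i _.
  by rewrite [RHS]scalerDl !scalerA.
Qed.

Lemma enorm_le x (a : R) : 0 <= a -> (forall i, `|x 0 i| <= a) -> enorm x <= 2 * a.
Proof.
move=> a0 H; rewrite -(@ger0_norm _ (2 * a)) ?mulr_ge0// -sqrtr_sqr /enorm ler_sqrt ?sqr_ge0//.
have S i : x 0 i * x 0 i <= a * a.
  by rewrite -expr2 -real_normK ?num_real// -expr2 lerXn2r// nnegrE.
have := S 0; have := S 1; have := S 2; have : 0 <= a * a by rewrite mulr_ge0.
by rewrite dotE exprMn (expr2 a); lra.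
Qed.

(** If the tetrahedron contains a ball about [c], then on the segment from one
    of its points to [c] every point, except possibly the first, is interior. *)
Lemma tetra_interior v c (r : R) y (s : R) : 0 < r ->
  (forall z, enorm (z - c) <= r -> tetra v z) -> tetra v y -> 0 < s <= 1 ->
  (tetra v)° ((1 - s) *: y + s *: c).
Proof.
move=> r0 Hr ty /andP[s0 s1]; apply/nbhs_ballP; exists (s * r / 2).
  by rewrite /= divr_gt0// mulr_gt0.
move=> z /ball_row3P[_ Hz].
have -> : z = (1 - s) *: y + s *: (c + s^-1 *: (z - ((1 - s) *: y + s *: c))).
  rewrite [s *: (c + _)]scalerDr scalerA divff ?gt_eqF// scale1r addrA.
  by rewrite addrC subrK.
apply: tetra_convex => //; first by rewrite ltW.
apply: Hr; rewrite addrC addKr.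
rewrite (_ : r = 2 * (r / 2)); last by field.
apply: enorm_le => [|i]; first by rewrite divr_ge0// ltW.
rewrite scaleV normrM gtr0_norm ?invr_gt0// -ler_pdivlMl ?invr_gt0// invrK mulrA.
have := Hz i; move: ((1 - s) *: y + s *: c) => w.
by rewrite distrC addV oppV => /ltW.
Qed.

Lemma face_normal_neq0 v j : Defs.nondegenerate v -> face_normal v j != 0.
Proof.
move=> nd; apply/negP => /eqP f0; move: nd; rewrite /Defs.nondegenerate.
suff [e E] : exists e : R, dot (v 1 - v 0) (cross (v 2 - v 0) (v 3 - v 0)) =
    e * dot (v j - v (lift j 0)) (face_normal v j).
  by rewrite E f0 dot0r mulr0 eqxx.
rewrite /face_normal {f0}.
have L : forall (j : 'I_4) (k : 'I_3) (i : 'I_4), bump j k = i :> nat -> lift j k = i.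
  by move=> j' k i H; apply: val_inj.
case: j => -[|[|[|[|//]]]] Hj.
- exists (-1); rewrite (L _ 0 1)// (L _ 1 2)// (L _ 2 3)// (_ : Ordinal Hj = 0); last exact: val_inj.
  rewrite !coordE; ring.
- exists 1; rewrite (L _ 0 0)// (L _ 1 2)// (L _ 2 3)// (_ : Ordinal Hj = 1); last exact: val_inj.
  rewrite !coordE; ring.
- exists (-1); rewrite (L _ 0 0)// (L _ 1 1)// (L _ 2 3)// (_ : Ordinal Hj = 2); last exact: val_inj.
  rewrite !coordE; ring.
- exists 1; rewrite (L _ 0 0)// (L _ 1 1)// (L _ 2 2)// (_ : Ordinal Hj = 3); last exact: val_inj.
  rewrite !coordE; ring.
Qed.

Lemma dot_comb3 (a b c : R) x y z d :
  dot (a *: x + b *: y + c *: z) d = a * dot x d + b * dot y d + c * dot z d.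
Proof. rewrite !coordE; ring. Qed.

(** A point of a tetrahedron is interior or lies in the plane of a face. *)
Lemma tetra_boundary v (sg : R) x : shape_regular_tetra sg v -> tetra v x ->
  (tetra v)° x \/ exists j, dot (face_normal v j) (x - v (lift j 0)) = 0.
Proof.
move=> [c [r [r0 Hr _]]] tx; have [l [l0 _ l1 xE]] := tx.
have [[j lj]|] := pselect (exists j, l j = 0).
  right; exists j; rewrite xE -[v (lift j 0)]scale1r -l1 scaler_suml.
  rewrite -sumrB (bigD1_ord j)//= lj !scale0r subrr add0r dotC.
  have -> : dot (\sum_(i < 3) (l (lift j i) *: v (lift j i) - l (lift j i) *: v (lift j 0)))
      (face_normal v j) =
      \sum_(i < 3) l (lift j i) * dot (v (lift j i) - v (lift j 0)) (face_normal v j).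
    by rewrite !sum3E -!scalerBr dot_comb3.
  rewrite sum3E /face_normal subrr dot0l mulr0 add0r.
  rewrite !coordE; ring.
move=> /forallNP ln; left.
have lp i : 0 < l i by rewrite lt_neqAle l0 andbT eq_sym; apply/eqP/ln.
have tc : tetra v c by apply: Hr; rewrite subrr /enorm dot0l sqrtr0 ltW.
have [m [m0 _ m1 cE]] := tc.
have [s [s0 s1 sl]] : exists s : R, [/\ 0 < s, s < 1 & forall i, s * m i <= l i].
  (* the initial value 1/2 of the minimum keeps [e < 1] *)
  pose e := \big[Num.min/2^-1]_(i < 4) l i.
  have e0 : 0 < e by apply: lt_bigmin => //; rewrite invr_gt0.
  exists e; split=> //.
    by apply: le_lt_trans (bigmin_le_id _ _ _ _) _; rewrite invf_lt1// ltr1n.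
  move=> i; have mi1 : m i <= 1.
    by rewrite -m1 (bigD1 i)//= lerDl sumr_ge0.
  by apply: (@le_trans _ _ e); [rewrite ler_piMr// ltW|exact: bigmin_le].
have s1' : 1 - s != 0 by rewrite subr_eq0 eq_sym lt_eqF.
have -> : x = (1 - s) *: ((1 - s)^-1 *: (x - s *: c)) + s *: c.
  by rewrite scalerA divff// scale1r subrK.
apply: (tetra_interior r0 Hr); last by rewrite s0 ltW.
exists (fun i => (1 - s)^-1 * (l i - s * m i)); split.
- by move=> i; rewrite mulr_ge0// ?invr_ge0 ?subr_ge0// ltW.
- by move=> i; rewrite inE.
- by rewrite -mulr_sumr sumrB -mulr_sumr l1 m1 mulr1 mulVf.
- rewrite xE cE !scaler_sumr -sumrB scaler_sumr; apply: eq_bigr => i _.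
  by rewrite scalerA -scalerBl scalerA.
Qed.

End Tetrahedra.

(** * The mesh *)

Section Mesh.
Context {R : realType} (G : ife_setting R).
Local Notation V3 := 'rV[R]_3.
Local Notation T1 := (measurableTypeR R).
Local Notation T3 := (T1 * T1 * T1)%type.
Implicit Types (K : elt G) (x y z g d : V3).

Lemma elt_op_open K : open (elt_op K).
Proof. exact: open_interior. Qed.

Lemma elt_op_cl K : elt_op K `<=` elt_cl K.
Proof. exact: interior_subset. Qed.

Lemma elt_cl_closed_cube K : elt_cl K `<=` closed_cube (corner G) (side G).
Proof.
have [k kK] := elt_in_cell K; move=> x /kK Hx i; have := Hx i.
have n0 : (0 : R) < (ncell G)%:R by rewrite ltr0n ncell_gt0.
rewrite addV mxE; set h := side G / _ => /andP[h1 h2].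
have hp : 0 < h by rewrite divr_gt0// side_gt0.
have sE : (ncell G)%:R * h = side G by rewrite mulrCA divff ?mulr1// gt_eqF.
have kn : (k i)%:R + 1 <= (ncell G)%:R :> R by rewrite -[1]/(1%:R) -natrD ler_nat addn1.
have k0 : 0 <= (k i)%:R * h by rewrite mulr_ge0// ltW.
have : ((k i)%:R + 1) * h <= (ncell G)%:R * h by rewrite ler_pM2r.
rewrite sE mulrDl mul1r => k1; apply/andP; split; lra.
Qed.

Lemma elt_op_Omega K : elt_op K `<=` Omega G.
Proof.
move=> x Kx i; have /nbhs_ballP[e /= e0 eK] : nbhs x (elt_cl K) by [].
have [d e2 de] : exists2 d : R, 0 < d & d < e by exists (e / 2); lra.
have shift (s : R) : `|s| = 1 -> corner G 0 i <= x 0 i + s * d <= corner G 0 i + side G.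
  move=> s1; have := @elt_cl_closed_cube K (x + (s * d) *: delta_mx 0 i) _ i.
  rewrite addV scaleV mxE !eqxx mulr1; apply; apply: eK; apply/ball_row3P; split=> // j.
  rewrite addV scaleV opprD addrA subrr add0r normrN !normrM s1 mul1r mxE eqxx/=.
  rewrite (gtr0_norm e2); case: (j == i); by rewrite ?normr1 ?normr0 ?mulr0// mulr1.
have := shift 1 (normr1 _); have := shift (-1) _; rewrite normrN normr1 => /(_ erefl).
move=> /andP[h1 h2] /andP[h3 h4]; apply/andP; split; lra.
Qed.

Lemma Omega_bounded : exists N : R, Omega G `<=` cube N.
Proof.
exists (`|corner G| + side G) => x Hx.
have s0 := side_gt0 G; apply/norm_leP; first by rewrite addr_ge0// ltW.
move=> i; have /andP[h1 h2] := Hx i; have := coord_norm_le (corner G) i.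
rewrite !ler_norml => /andP[c1 c2]; apply/andP; split; lra.
Qed.

Lemma Omega_box : Omega G = box3 (corner G) (corner G + const_mx (side G)).
Proof.
apply/seteqP; split=> x Hx i; have := Hx i;
  by rewrite addV (mxE _ (fun _ _ => side G)).
Qed.

Lemma measurable_Omega : measurable (vec3 @^-1` Omega G : set T3).
Proof. by rewrite Omega_box; exact: measurable_box3. Qed.

Lemma measurable_elt_op K : measurable (vec3 @^-1` elt_op K : set T3).
Proof. exact: (measurable_open3 (elt_op_open (K := K))). Qed.

Lemma elt_op_disjoint K1 K2 x : elt_op K1 x -> elt_op K2 x -> K1 = K2.
Proof.
move=> h1 h2; apply/eqP; apply: contraT => /elt_disjoint/seteqP[H _].
by have := H x (conj h1 h2).
Qed.

Lemma Omega_elt_cl x : Omega G x -> exists K, elt_cl K x.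
Proof.
move=> Hx; have n0 : (0 : R) < (ncell G)%:R by rewrite ltr0n ncell_gt0.
set h := side G / (ncell G)%:R.
have hp : 0 < h by rewrite divr_gt0// side_gt0.
have sE : (ncell G)%:R * h = side G by rewrite mulrCA divff ?mulr1// gt_eqF.
have /choice[k Hk] : forall i : 'I_3, exists k : 'I_(ncell G),
    corner G 0 i + k%:R * h <= x 0 i <= corner G 0 i + k%:R * h + h.
  move=> i; have /andP[h1 h2] := Hx i.
  pose y := (x 0 i - corner G 0 i) / h.
  have y0 : 0 <= y by rewrite divr_ge0// ?subr_ge0 ltW.
  have yn : y < (ncell G)%:R by rewrite ltr_pdivrMr// sE; lra.
  have /andP[t1 t2] := truncn_itv y0.
  have tn : (Num.truncn y < ncell G)%N by rewrite -(ltr_nat R) (le_lt_trans t1).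
  exists (Ordinal tn) => /=.
  have xE : x 0 i = corner G 0 i + y * h by rewrite divfK ?gt_eqF//; lra.
  rewrite xE -addrA !lerD2l ler_pM2r// t1 /=.
  by move: t2; rewrite -addn1 natrD -(ltr_pM2r hp) mulrDl mul1r => /ltW.
have [K /= KC Kx] : (\bigcup_(K in [set K : elt G | tetra (vtx K) `<=` cell k]) tetra (vtx K)) x.
  by apply: cell_covered => i; rewrite addV mxE; exact: Hk.
by exists K.
Qed.

Lemma ae_forall_count (I : countType) (P : I -> T3 -> Prop) :
  (forall i, {ae leb3, forall p, P i p}) -> {ae leb3, forall p, forall i, P i p}.
Proof.
move=> H; pose Q n p := if unpickle n is Some i then P i p else True.
have /ae_foralln : forall n, {ae leb3, forall p, Q n p}.
  by move=> n; rewrite /Q; case: (unpickle n) => [i|]; [exact: H|exact: aeW].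
by apply: ae_imp => p Hp i; have := Hp (pickle i); rewrite /Q pickleK.
Qed.

(** Almost every point of the domain lies in the interior of an element. *)
Lemma ae_Omega_elt_op : ae_on (Omega G) (fun x => exists K, elt_op K x).
Proof.
have : {ae leb3, forall p : T3, forall Kj : elt G * 'I_4,
    dot (face_normal (vtx Kj.1) Kj.2) (vec3 p - vtx Kj.1 (lift Kj.2 0)) != 0}.
  apply: ae_forall_count => -[K j]; apply: plane_negligible.
  exact/face_normal_neq0/elt_nondegenerate.
apply: ae_imp => p Hp /Omega_elt_cl[K Kp]; exists K.
have [//|[j /eqP jp]] := tetra_boundary (elt_shape_regular K) Kp.
by have := Hp (K, j); rewrite /= jp.
Qed.

Lemma ae0_elements (f : V3 -> R) :
  (forall K, ae_on (elt_op K) (fun x => f x = 0)) -> ae_on (Omega G) (fun x => f x = 0).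
Proof.
move=> H; have := ae_forall_count (H : forall K : elt G, _).
have := ae_Omega_elt_op => A B.
have : {ae leb3, forall p : T3, (Omega G (vec3 p) -> exists K, elt_op K (vec3 p)) /\
    forall K : elt G, elt_op K (vec3 p) -> f (vec3 p) = 0}.
  have := @ae_forall_count bool (fun b p => if b then (Omega G (vec3 p) -> exists K, elt_op K (vec3 p))
     else forall K : elt G, elt_op K (vec3 p) -> f (vec3 p) = 0).
  move=> C; apply: ae_imp (C _).
    by move=> p Hp; split; [exact: (Hp true)|exact: (Hp false)].
  by case.
by apply: ae_imp => p [h1 h2] /h1[K /h2].
Qed.

(** The function equal to [F K] in the interior of each element [K]. *)
Definition eltwise (F : elt G -> V3 -> R) (x : V3) : R :=
  \sum_(K : elt G) (if `[< elt_op K x >] then F K x else 0).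

Lemma eltwiseE (F : elt G -> V3 -> R) K x : elt_op K x -> eltwise F x = F K x.
Proof.
move=> Kx; rewrite /eltwise (bigD1 K)//= asboolT// big1 ?addr0// => L LK.
by rewrite asboolF// => Lx; move/eqP: LK; apply; exact: elt_op_disjoint Lx Kx.
Qed.

Lemma eltwise_L2 (F : elt G -> V3 -> R) : (forall K, locbdd (F K)) -> L2 (Omega G) (eltwise F).
Proof.
move=> bF; have [N HN] := Omega_bounded.
apply: (L2_locbdd measurable_Omega HN); apply: locbdd_sum => K.
have := bF K => -[mF HF]; split.
  apply: measurable_fun_ifT => //.
  apply: (measurable_fun_bool true).
  rewrite setTI [X in measurable X](_ : _ = vec3 @^-1` elt_op K); first exact: measurable_elt_op.
  by apply/seteqP; split=> p /=; [move/asboolP|move=> H; apply/asboolP].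
move=> M; have [C HC] := HF M; exists `|C| => x xM; case: ifP => _; last by rewrite normr0.
exact: le_trans (HC x xM) (ler_norm C).
Qed.

End Mesh.

(** * Weak derivatives of piecewise affine fields *)

Section PiecewiseFields.
Context {R : realType}.
Local Notation V3 := 'rV[R]_3.
Local Notation T1 := (measurableTypeR R).
Local Notation T3 := (T1 * T1 * T1)%type.
Implicit Types (phi q : V3 -> R) (Phi : V3 -> V3) (U : set V3) (x y z g a b l : V3) (i j k : 'I_3).

(** The field equal to [b + l] in the open half-space [g . (x - z) > 0] and to
    [b] in its complement. *)
Definition pw g z b l x : V3 := b + (0 < dot g (x - z))%R%:R *: l.

Lemma pwE g z b l x i : pw g z b l x 0 i = b 0 i + (0 < dot g (x - z))%R%:R * l 0 i.
Proof. by rewrite addV scaleV. Qed.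

Lemma pw0 g z b x : pw g z b 0 x = b.
Proof. by rewrite /pw scaler0 addr0. Qed.

Lemma locbdd_pw g z b l i : locbdd (fun x => pw g z b l x 0 i).
Proof.
under eq_fun do rewrite pwE.
apply: locbddD; first exact: locbdd_cst.
by apply: locbddM; [exact: locbdd_half|exact: locbdd_cst].
Qed.

Lemma curlE Phi x :
  ((curl Phi x 0 0 = partial 1 (fun y => Phi y 0 2) x - partial 2 (fun y => Phi y 0 1) x) *
   (curl Phi x 0 1 = partial 2 (fun y => Phi y 0 0) x - partial 0 (fun y => Phi y 0 2) x) *
   (curl Phi x 0 2 = partial 0 (fun y => Phi y 0 1) x - partial 1 (fun y => Phi y 0 0) x))%type.
Proof.
have E1 : (1 + 1 : 'I_3) = 2 by apply: val_inj.
have E2 : (1 + 2 : 'I_3) = 0 by apply: val_inj.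
have E3 : (2 + 1 : 'I_3) = 0 by apply: val_inj.
have E4 : (2 + 2 : 'I_3) = 1 by apply: val_inj.
by split; [split|]; rewrite !mxE ?add0r ?E1 ?E2 ?E3 ?E4.
Qed.

Lemma dot_grad a phi x : dot a (grad phi x) = \sum_i a 0 i * partial i phi x.
Proof. by apply: eq_bigr => i _; rewrite mxE. Qed.

(** A first kind edge element field of lowest order, centred at [z]. *)
Definition aff a z b x : V3 := cross a (x - z) + b.

Lemma smooth_aff a z b i : smooth (fun x => aff a z b x 0 i).
Proof.
have -> : (fun x => aff a z b x 0 i) = (fun x => dot (cross (delta_mx 0 i) a) (x - z) + b 0 i).
  apply/funext => x; rewrite /aff addV; congr (_ + _).
  by move: i; elim/I3_ind; rewrite !coordE !mxE/=; ring.
exact: smoothD (smooth_affine _ _) (smooth_cst _).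
Qed.

Lemma partial_aff a z b i j x :
  partial i (fun y => aff a z b y 0 j) x = cross a (delta_mx 0 i) 0 j.
Proof.
have [|_] // := @is_derive_affine R (fun y => aff a z b y 0 j) x (delta_mx 0 i)
  (cross a (delta_mx 0 i) 0 j).
by move=> h; rewrite /aff !addV addrA; congr (_ + _); move: j; elim/I3_ind; rewrite !coordE; ring.
Qed.

(** The product rule [div (Phi x F) = F . curl Phi - Phi . curl F], in which
    [curl F = 2 a]. *)
Lemma div_cross Phi a z b x : (forall i, smooth (fun y => Phi y 0 i)) ->
  \sum_i partial i (fun y => cross (Phi y) (aff a z b y) 0 i) x =
  dot (aff a z b x) (curl Phi x) - 2 * dot a (Phi x).
Proof.
move=> sP; have sF := smooth_aff a z b.
have D i j k : partial i (fun y => Phi y 0 j * aff a z b y 0 k + -1 * (Phi y 0 k * aff a z b y 0 j)) x =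
    Phi x 0 j * cross a (delta_mx 0 i) 0 k + partial i (fun y => Phi y 0 j) x * aff a z b x 0 k
    - (Phi x 0 k * cross a (delta_mx 0 i) 0 j + partial i (fun y => Phi y 0 k) x * aff a z b x 0 j).
  rewrite (partial_smoothD i x (smoothM (sP j) (sF k)) (smoothZ _ (smoothM (sP k) (sF j)))).
  rewrite (partialZ i _ x (smoothM (sP k) (sF j))).
  by rewrite (partial_smoothM i x (sP j) (sF k)) (partial_smoothM i x (sP k) (sF j)) !partial_aff mulN1r.
rewrite sum3E.
rewrite (_ : (fun y => cross (Phi y) (aff a z b y) 0 0) =
  fun y => Phi y 0 1 * aff a z b y 0 2 + -1 * (Phi y 0 2 * aff a z b y 0 1)); last first.
  by apply/funext => y; rewrite crossE mulN1r.
rewrite (_ : (fun y => cross (Phi y) (aff a z b y) 0 1) =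
  fun y => Phi y 0 2 * aff a z b y 0 0 + -1 * (Phi y 0 0 * aff a z b y 0 2)); last first.
  by apply/funext => y; rewrite crossE mulN1r.
rewrite (_ : (fun y => cross (Phi y) (aff a z b y) 0 2) =
  fun y => Phi y 0 0 * aff a z b y 0 1 + -1 * (Phi y 0 1 * aff a z b y 0 0)); last first.
  by apply/funext => y; rewrite crossE mulN1r.
rewrite !D [dot (aff _ _ _ _) _]dotE !curlE [dot a _]dotE.
move: (aff a z b x) => F; rewrite !crossE !mxE/=.
ring.
Qed.

Lemma smooth_cross Phi a z b i : (forall j, smooth (fun y => Phi y 0 j)) ->
  smooth (fun y => cross (Phi y) (aff a z b y) 0 i).
Proof.
move=> sP; have sF := smooth_aff a z b.
have H j k : smooth (fun y => Phi y 0 j * aff a z b y 0 k + -1 * (Phi y 0 k * aff a z b y 0 j)).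
  exact: smoothD (smoothM (sP j) (sF k)) (smoothZ _ (smoothM (sP k) (sF j))).
by under eq_fun do rewrite mxE -mulN1r; exact: H.
Qed.

Lemma test_field_bm U Phi : test_field U Phi -> forall i, bm (fun x => Phi x 0 i).
Proof. by move=> tP i; exact: test_bm (tP i). Qed.

Lemma bm_curl U Phi i : test_field U Phi -> bm (fun x => curl Phi x 0 i).
Proof.
move=> tP; under eq_fun do rewrite mxE.
by apply: bmD; [|apply: bmN]; exact: test_bm (test_partial _ (tP _)).
Qed.

Lemma bm_dot (u w : V3 -> V3) : (forall i, locbdd (fun x => u x 0 i)) ->
  (forall i, bm (fun x => w x 0 i)) -> bm (fun x => dot (u x) (w x)).
Proof. by move=> bu bw; apply: bm_sum => i; exact: bmMl. Qed.

Lemma bsupp_cross U Phi a z b i : test_field U Phi ->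
  bsupp (fun y => cross (Phi y) (aff a z b y) 0 i).
Proof.
move=> tP; have H j k : bsupp (fun y => aff a z b y 0 k * Phi y 0 j + aff a z b y 0 j * (-1 * Phi y 0 k)).
  by apply: bsuppD; do ![apply: bsuppMl]; exact: test_bsupp (tP _).
suff -> : (fun y => cross (Phi y) (aff a z b y) 0 i) = (fun y => aff a z b y 0 (i + 2) * Phi y 0 (i + 1) +
    aff a z b y 0 (i + 1) * (-1 * Phi y 0 (i + 2))) by exact: H.
by apply/funext => y; rewrite mxE; ring.
Qed.

Lemma test_field_out U Phi x : test_field U Phi -> ~ U x -> Phi x = 0.
Proof. by move=> tP nU; apply/rowP => i; rewrite (test_out (tP i) nU) mxE. Qed.

Lemma curl_out U Phi x : test_field U Phi -> ~ U x -> curl Phi x = 0.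
Proof.
move=> tP nU; apply/rowP => i; rewrite !mxE.
by rewrite !(test_out (test_partial _ (tP _)) nU) subrr.
Qed.

(** Green's identity for the curl. The contribution of the jump is the integral
    over a half-space of the divergence of [Phi x aff la z lb], whose normal
    trace vanishes by the two interface conditions. The identities for the
    gradient and the divergence below are proved in the same way. *)
Lemma weak_curl_pw U g z a la b lb : dot g la = 0 -> cross g lb = 0 ->
  weak_curl U (fun x => cross (pw g z a la x) (x - z) + pw g z b lb x)
    (fun x => 2 *: pw g z a la x).
Proof.
move=> gla glb Phi tP; have sP i : smooth (fun y => Phi y 0 i) := (tP i).1.
have bP := test_field_bm tP; have mT := @measurable_setT3 R.
pose D c d x := dot (aff c z d x) (curl Phi x) - 2 * dot c (Phi x).
have bD c d : bm (D c d).
  apply: bmD; first by apply: bm_dot => i; [exact/locbdd_continuous/smooth_continuous/smooth_aff|exact: bm_curl].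
  apply/bmN/bmMl; first exact: locbdd_cst.
  by apply: bm_dot => // i; exact: locbdd_cst.
have E0 : int3 setT (D a b) = 0.
  rewrite -[RHS](@int3_partial_sum0 _ (fun i y => cross (Phi y) (aff a z b y) 0 i)).
  - by apply: eq_int3 => x _; rewrite div_cross.
  - by move=> i; exact: smooth_cross.
  - by move=> i; exact: bsupp_cross tP.
have E1 : int3 setT (fun x => (0 < dot g (x - z))%R%:R * D la lb x) = 0.
  rewrite -[RHS](@int3_halfspace_div _ g z (fun i y => cross (Phi y) (aff la z lb y) 0 i)
    (fun x => - dot la (Phi x))).
  - by apply: eq_int3 => x _; rewrite div_cross.
  - by move=> i; exact: smooth_cross.
  - by move=> i; exact: bsupp_cross tP.
  - by apply/bmN/bm_dot => // i; exact: locbdd_cst.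
  - move=> x; rewrite -[LHS]/(dot g (cross (Phi x) (aff la z lb x))).
    have e0 : g 0 1 * lb 0 2 - g 0 2 * lb 0 1 = 0 by rewrite -(crossE g lb) glb mxE.
    have e1 : g 0 2 * lb 0 0 - g 0 0 * lb 0 2 = 0 by rewrite -(crossE g lb) glb mxE.
    have e2 : g 0 0 * lb 0 1 - g 0 1 * lb 0 0 = 0 by rewrite -(crossE g lb) glb mxE.
    rewrite dotE in gla; rewrite /aff; move: (x - z) (Phi x) => y P; rewrite !coordE.
    move: gla; move: (g 0 0) (g 0 1) (g 0 2) (la 0 0) (la 0 1) (la 0 2) (lb 0 0) (lb 0 1) (lb 0 2) (P 0 0) (P 0 1) (P 0 2) (y 0 0) (y 0 1) (y 0 2) e0 e1 e2 => g0 g1 g2 a0 a1 a2 b0 b1 b2 P0 P1 P2 y0 y1 y2 e0 e1 e2 ga.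
    apply/eqP; rewrite -subr_eq0; apply/eqP.
    transitivity ((P0 * y0 + P1 * y1 + P2 * y2) * (g0 * a0 + g1 * a1 + g2 * a2) + P0 * (g1 * b2 - g2 * b1) * (-1) + P1 * (g2 * b0 - g0 * b2) * (-1) + P2 * (g0 * b1 - g1 * b0) * (-1)); last first.
      by rewrite e0 e1 e2 ga; ring.
    ring.
have H : int3 setT (fun x => D a b x + (0 < dot g (x - z))%R%:R * D la lb x) = 0.
  rewrite int3D// ?E0 ?E1 ?addr0//; apply: bm_integrable => //.
  by apply: bmMl => //; exact: locbdd_half.
rewrite int3_mkcond => [|x nU]; last by rewrite (curl_out tP nU) dot0r.
rewrite [RHS]int3_mkcond => [|x nU]; last by rewrite (test_field_out tP nU) dot0r.
have b2 : bm (fun x => dot (2 *: pw g z a la x) (Phi x)).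
  apply: bm_dot => // i; under eq_fun do rewrite scaleV.
  by apply: locbddM; [exact: locbdd_cst|exact: locbdd_pw].
rewrite -[RHS]add0r -{}H -int3D//.
- apply: eq_int3 => x _; rewrite /D /aff /pw; move: (x - z) (Phi x) (curl Phi x) (_%:R : R) => y P C s.
  rewrite !coordE; ring.
- apply: bm_integrable => //; apply: bmD => //.
  by apply: bmMl => //; exact: locbdd_half.
- exact: bm_integrable.
Qed.

Lemma cross_eq0_dot g l y i : cross g l = 0 -> dot l y * g 0 i = l 0 i * dot g y.
Proof.
move=> gl.
have e0 : g 0 1 * l 0 2 - g 0 2 * l 0 1 = 0 by rewrite -(crossE g l) gl mxE.
have e1 : g 0 2 * l 0 0 - g 0 0 * l 0 2 = 0 by rewrite -(crossE g l) gl mxE.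
have e2 : g 0 0 * l 0 1 - g 0 1 * l 0 0 = 0 by rewrite -(crossE g l) gl mxE.
apply/eqP; rewrite -subr_eq0; apply/eqP; rewrite !dotE; move: i; elim/I3_ind.
- transitivity (y 0 1 * (g 0 0 * l 0 1 - g 0 1 * l 0 0) - y 0 2 * (g 0 2 * l 0 0 - g 0 0 * l 0 2)); first by ring.
  by rewrite e1 e2; ring.
- transitivity (- y 0 0 * (g 0 0 * l 0 1 - g 0 1 * l 0 0) + y 0 2 * (g 0 1 * l 0 2 - g 0 2 * l 0 1)); first by ring.
  by rewrite e0 e2; ring.
- transitivity (y 0 0 * (g 0 2 * l 0 0 - g 0 0 * l 0 2) - y 0 1 * (g 0 1 * l 0 2 - g 0 2 * l 0 1)); first by ring.
  by rewrite e0 e1; ring.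
Qed.

Lemma weak_grad_pw U g z b l (c : R) : cross g l = 0 ->
  weak_grad U (fun x => dot (pw g z b l x) (x - z) + c) (pw g z b l).
Proof.
move=> gl phi tp i; have [sp _] := tp; have bp := test_bm tp; have bsp := test_bsupp tp.
have bd := test_bm (test_partial i tp); have mT := @measurable_setT3 R.
pose D (d : V3) (e : R) x := d 0 i * phi x + (dot d (x - z) + e) * partial i phi x.
have sA d e : smooth (fun x => dot d (x - z) + e) := smoothD (smooth_affine d z) (smooth_cst e).
pose X (d : V3) (e : R) (j : 'I_3) x := (j == i)%:R * ((dot d (x - z) + e) * phi x).
have sX d e j : smooth (X d e j) := smoothZ _ (smoothM (sA d e) sp).
have bX d e j : bsupp (X d e j) by do 2 apply: bsuppMl.
have dX d e x : \sum_j partial j (X d e j) x = D d e x.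
  rewrite (bigD1 i)//= big1 ?addr0.
    rewrite (partialZ i _ x (smoothM (sA d e) sp)) eqxx mul1r (partial_smoothM i x (sA d e) sp).
    rewrite (partial_smoothD i x (smooth_affine d z) (smooth_cst e)) partial_affine partial_cst.
    by rewrite /D; ring.
  by move=> j /negPf ji; rewrite (partialZ j _ x (smoothM (sA d e) sp)) ji mul0r.
have bD d e : bm (D d e).
  apply: bmD; apply: bmMl => //; first exact: locbdd_cst.
  exact/locbdd_continuous/smooth_continuous/sA.
have E0 : int3 setT (D b c) = 0.
  by rewrite -[RHS](int3_partial_sum0 (sX b c) (bX b c)); apply: eq_int3 => x _; rewrite dX.
have E1 : int3 setT (fun x => (0 < dot g (x - z))%R%:R * D l 0 x) = 0.
  rewrite -[RHS](@int3_halfspace_div _ g z (X l 0) (fun x => l 0 i * phi x)).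
  - by apply: eq_int3 => x _; rewrite dX.
  - exact: sX.
  - exact: bX.
  - by apply: bmMl => //; exact: locbdd_cst.
  - move=> x; rewrite (bigD1 i)//= big1 ?addr0; last first.
      by move=> j /negPf ji; rewrite /X ji mul0r mulr0.
    rewrite /X eqxx mul1r addr0.
    rewrite mulrA [g 0 i * _]mulrC; suff -> : dot l (x - z) * g 0 i = l 0 i * dot g (x - z) by ring.
    exact: cross_eq0_dot.
have H : int3 setT (fun x => D b c x + (0 < dot g (x - z))%R%:R * D l 0 x) = 0.
  rewrite int3D// ?E0 ?E1 ?addr0//; apply: bm_integrable => //.
  by apply: bmMl => //; exact: locbdd_half.
rewrite int3_mkcond => [|x nU]; last by rewrite (test_out (test_partial i tp) nU) mulr0.
rewrite [in RHS]int3_mkcond => [|x nU]; last by rewrite (test_out tp nU) mulr0.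
have b2 : bm (fun x => pw g z b l x 0 i * phi x) by apply: bmMl => //; exact: locbdd_pw.
rewrite -[RHS]add0r -{}H -int3N//; last exact: bm_integrable.
rewrite -int3D//.
- apply: eq_int3 => x _; rewrite /D /pw; move: (x - z) (phi x) (partial i phi x) (_%:R : R) => y P C s.
  rewrite addV scaleV dotDl dotZl; ring.
- apply: bm_integrable => //; apply: bmD => //.
  by apply: bmMl => //; exact: locbdd_half.
- exact/bm_integrable/bmN.
Qed.

Lemma weak_div_pw U g z a la (c : R) : dot g la = 0 ->
  weak_div U (fun x => c *: (x - z) + pw g z a la x) (fun=> 3 * c).
Proof.
move=> gla phi tp; have [sp _] := tp; have bp := test_bm tp; have bsp := test_bsupp tp.
have bd i := test_bm (test_partial i tp); have mT := @measurable_setT3 R.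
have sC i : smooth (fun x : V3 => x 0 i + - z 0 i) := smoothD (smooth_coord i) (smooth_cst _).
pose X (e : R) (d : V3) (j : 'I_3) x := (e * (x 0 j + - z 0 j) + d 0 j) * phi x.
have sA (e : R) (d : V3) j : smooth (fun x : V3 => e * (x 0 j + - z 0 j) + d 0 j).
  exact: smoothD (smoothZ e (sC j)) (smooth_cst _).
have sX (e : R) (d : V3) j : smooth (X e d j) := smoothM (sA e d j) sp.
have bX e d j : bsupp (X e d j) by exact: bsuppMl.
pose D (e : R) (d : V3) x := 3 * e * phi x + dot (e *: (x - z) + d) (grad phi x).
have dX e d x : \sum_j partial j (X e d j) x = D e d x.
  have P j : partial j (X e d j) x = (e * (x 0 j + - z 0 j) + d 0 j) * partial j phi x + e * phi x.
    rewrite (partial_smoothM j x (sA e d j) sp); congr (_ + _ * _).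
    rewrite (partial_smoothD j x (smoothZ e (sC j)) (smooth_cst _)) partial_cst addr0.
    rewrite (partialZ j _ x (sC j)) (partial_smoothD j x (smooth_coord j) (smooth_cst _)).
    by rewrite partial_cst addr0 partial_coord eqxx mulr1.
  rewrite /D dot_grad !sum3E !P !addV !scaleV !addV !oppV.
  move: (partial 0 phi x) (partial 1 phi x) (partial 2 phi x) (phi x) => p0 p1 p2 p; ring.
have bD e d : bm (D e d).
  apply: bmD; first by apply: bmMl => //; exact: locbdd_cst.
  apply: bm_dot => i; last by under eq_fun do rewrite mxE.
  apply/locbdd_continuous/smooth_continuous; under eq_fun do rewrite addV scaleV addV oppV.
  exact: sA.
have E0 : int3 setT (D c a) = 0.
  by rewrite -[RHS](int3_partial_sum0 (sX c a) (bX c a)); apply: eq_int3 => x _; rewrite dX.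
have E1 : int3 setT (fun x => (0 < dot g (x - z))%R%:R * D 0 la x) = 0.
  rewrite -[RHS](@int3_halfspace_div _ g z (X 0 la) (fun=> 0)).
  - by apply: eq_int3 => x _; rewrite dX.
  - exact: sX.
  - exact: bX.
  - by split; [exact: locbdd_cst|exists 0].
  - move=> x; rewrite mulr0 -[RHS](mul0r (phi x)) -[X in X * phi x]gla /dot mulr_suml.
    by apply: eq_bigr => i _; rewrite /X; ring.
have H : int3 setT (fun x => D c a x + (0 < dot g (x - z))%R%:R * D 0 la x) = 0.
  rewrite int3D// ?E0 ?E1 ?addr0//; apply: bm_integrable => //.
  by apply: bmMl => //; exact: locbdd_half.
rewrite int3_mkcond => [|x nU]; last first.
  by rewrite dot_grad big1// => i _; rewrite (test_out (test_partial i tp) nU) mulr0.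
rewrite [in RHS]int3_mkcond => [|x nU]; last by rewrite (test_out tp nU) mulr0.
have b2 : bm (fun x => 3 * c * phi x) by apply: bmMl => //; exact: locbdd_cst.
rewrite -[RHS]add0r -{}H -int3N//; last exact: bm_integrable.
rewrite -int3D//.
- apply: eq_int3 => x _; rewrite /D /pw; move: (x - z) (phi x) (grad phi x) (_%:R : R) => y P C s.
  by rewrite scale0r add0r !dotDl !dotZl; ring.
- apply: bm_integrable => //; apply: bmD => //.
  by apply: bmMl => //; exact: locbdd_half.
- exact/bm_integrable/bmN.
Qed.

Lemma L2N U q : L2 U q -> L2 U (fun x => - q x).
Proof.
move=> [mq q2]; split; first exact: measurableT_comp.
by under eq_integral do rewrite sqrrN.
Qed.

(** The jump of a piecewise constant field in H(curl) is normal to the plane.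
    The plane is given by two of its points: [x0], in the formula for the field,
    and [z], which is interior to [U]. *)
Lemma Hcurl_pw U g x0 z b l : open U -> U z -> g != 0 ->
  (forall x, dot g (x - x0) = dot g (x - z)) ->
  Hcurl U (pw g x0 b l) -> cross g l = 0.
Proof.
move=> oU Uz g0 gz [_ [w [Lw wc]]]; have mU := measurable_open3 oU.
suff K k : dot g (cross (delta_mx 0 k) l) = 0.
  have := K 0; have := K 1; have := K 2; rewrite !coordE !mxE/= => k2 k1 k0.
  by apply: row3P; rewrite crossE mxE; lra.
apply: (jump_normal0 oU Uz g0) => phi tphi.
pose Phi (phi : V3 -> R) (x : V3) : V3 := phi x *: delta_mx 0 k.
have sP (psi : V3 -> R) : test_fun U psi -> test_field U (Phi psi).
  move=> tp i; rewrite /Phi; under eq_fun do rewrite scaleV mulrC.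
  by apply: test_mul => //; exact: smooth_cst.
have cP (psi : V3 -> R) x : smooth psi ->
    dot l (curl (Phi psi) x) = \sum_i cross (delta_mx 0 k) l 0 i * partial i psi x.
  move=> sp.
  have P i j : partial i (fun y => Phi psi y 0 j) x = (k == j)%:R * partial i psi x.
    rewrite -(partialZ i _ x sp); congr (partial i _ x); apply/funext => y.
    by rewrite scaleV mxE eqxx mulrC eq_sym.
  rewrite dotE !curlE !P sum3E !crossE !mxE/=.
  move: (partial 0 psi x) (partial 1 psi x) (partial 2 psi x) (l 0 0) (l 0 1) (l 0 2) => p0 p1 p2 l0 l1 l2.
  by move: k {Phi P sP}; elim/I3_ind => /=; ring.
have J (psi : V3 -> R) : test_fun U psi -> int3 U (fun x => (0 < dot g (x - x0))%R%:R *
     \sum_i cross (delta_mx 0 k) l 0 i * partial i psi x) = int3 U (fun x => w x 0 k * psi x).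
  move=> tp; have := wc _ (sP _ tp).
  have := @weak_curl_pw U 0 x0 0 0 b 0 _ _ (Phi psi) (sP _ tp).
  have -> : dot (0 : V3) 0 = 0 by rewrite dot0l.
  have -> : cross (0 : V3) 0 = 0 by exact: cross0l.
  move=> /(_ erefl erefl).
  have bC i : bm (fun x => curl (Phi psi) x 0 i) by exact: bm_curl (sP _ tp).
  rewrite (eq_int3 (g := fun x => dot b (curl (Phi psi) x))); last first.
    by move=> x _; rewrite !pw0; congr (dot _ _); apply: row3P; rewrite addV crossE !mxE; ring.
  rewrite [X in _ = X -> _](int3_eq0 (f := fun x => dot (2 *: pw 0 x0 0 0 x) (Phi psi x))); last first.
    by move=> x _; rewrite pw0 scaler0 dot0l.
  move=> E0.
  have bb : bm (fun x => dot b (curl (Phi psi) x)).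
    by apply: bm_dot => // i; exact: locbdd_cst.
  have bl : bm (fun x => (0 < dot g (x - x0))%R%:R * dot l (curl (Phi psi) x)).
    apply: bmMl; first exact: locbdd_half.
    by apply: bm_dot => // i; exact: locbdd_cst.
  rewrite (eq_int3 (g := fun x => dot b (curl (Phi psi) x) +
     (0 < dot g (x - x0))%R%:R * dot l (curl (Phi psi) x))); last first.
    by move=> x _; rewrite /pw dotDl dotZl.
  rewrite int3D//; try exact: bm_integrable.
  rewrite E0 add0r => E1.
  transitivity (int3 U (fun x => (0 < dot g (x - x0))%R%:R * dot l (curl (Phi psi) x))).
    by apply: eq_int3 => x _; rewrite cP//; case: tp.
  rewrite E1; apply: eq_int3 => x _; rewrite /Phi dotZr mulrC; congr (_ * _).
  by rewrite /dot (bigD1 k)//= big1 ?addr0 ?mxE ?eqxx ?mulr1// => i /negPf ik; rewrite mxE ik andbF mulr0.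
apply: etrans (jump_test0 oU g0 (Lw k) J tphi); rewrite -(J _ tphi).
by apply: eq_int3 => x _; rewrite gz.
Qed.

(** The jump of a piecewise constant field in H(div) is tangential. *)
Lemma Hdiv_pw U g x0 z a l : open U -> U z -> g != 0 ->
  (forall x, dot g (x - x0) = dot g (x - z)) ->
  Hdiv U (pw g x0 a l) -> dot g l = 0.
Proof.
move=> oU Uz g0 gz [_ [q [Lq wd]]]; have mU := measurable_open3 oU.
apply: (jump_normal0 oU Uz g0) => phi tphi.
have J (psi : V3 -> R) : test_fun U psi -> int3 U (fun x => (0 < dot g (x - x0))%R%:R *
     \sum_i l 0 i * partial i psi x) = int3 U (fun x => - q x * psi x).
  move=> tp; have := wd _ tp.
  have := @weak_div_pw U 0 x0 a 0 0 (dot0l _) psi tp.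
  have bG i : bm (fun x => grad psi x 0 i).
    by under eq_fun do rewrite mxE; exact: test_bm (test_partial i tp).
  rewrite (eq_int3 (g := fun x => dot a (grad psi x))); last first.
    by move=> x _; rewrite pw0 scale0r add0r.
  rewrite [X in _ = - X -> _](_ : _ = 0); last first.
    by apply: int3_eq0 => x _; rewrite mulr0 mul0r.
  rewrite oppr0 => E0.
  have ba : bm (fun x => dot a (grad psi x)) by apply: bm_dot => // i; exact: locbdd_cst.
  have bl : bm (fun x => (0 < dot g (x - x0))%R%:R * dot l (grad psi x)).
    apply: bmMl; first exact: locbdd_half.
    by apply: bm_dot => // i; exact: locbdd_cst.
  rewrite (eq_int3 (g := fun x => dot a (grad psi x) +
     (0 < dot g (x - x0))%R%:R * dot l (grad psi x))); last first.
    by move=> x _; rewrite /pw dotDl dotZl.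
  rewrite int3D//; try exact: bm_integrable.
  rewrite E0 add0r => E1.
  transitivity (int3 U (fun x => (0 < dot g (x - x0))%R%:R * dot l (grad psi x))).
    by apply: eq_int3 => x _; rewrite dot_grad.
  rewrite E1 -int3N//; last exact: L2_bm_integrable mU Lq (test_bm tp).
  by apply: eq_int3 => x _; rewrite mulNr.
apply: etrans (jump_test0 oU g0 (L2N Lq) J tphi); rewrite -(J _ tphi).
by apply: eq_int3 => x _; rewrite gz.
Qed.

End PiecewiseFields.

(** * Extensionality and uniqueness of the weak operators *)

Section WeakOperators.
Context {R : realType}.
Local Notation V3 := 'rV[R]_3.
Local Notation T1 := (measurableTypeR R).
Local Notation T3 := (T1 * T1 * T1)%type.
Implicit Types (f q phi : V3 -> R) (u w Phi : V3 -> V3) (U D : set V3) (x y : V3) (i : 'I_3).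
Local Notation measurable3 U := (measurable (vec3 @^-1` U : set T3)).

Lemma L2_eq U f q : (forall x, U x -> f x = q x) -> L2 U f -> L2 U q.
Proof.
move=> fq [mf f2]; split.
  by apply: eq_measurable_fun mf => p /set_mem /= /fq.
by rewrite (eq_integral (fun p : T3 => (f (vec3 p) ^+ 2)%:E))// => p /set_mem /= /fq ->.
Qed.

Lemma L2_subset U D f : measurable3 U -> measurable3 D -> U `<=` D -> L2 D f -> L2 U f.
Proof.
move=> mU mD UD [mf f2]; have UD' : vec3 @^-1` U `<=` vec3 @^-1` D by move=> p; exact: UD.
split; first exact: measurable_funS mD UD' mf.
apply: le_lt_trans f2; apply: ge0_subset_integral => //.
  by apply/measurable_EFinP; apply: measurable_funX.
by move=> p _; rewrite lee_fin sqr_ge0.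
Qed.

Lemma L2B U f q : measurable3 U -> L2 U f -> L2 U q -> L2 U (fun x => f x - q x).
Proof.
move=> mU [mf f2] [mq q2]; split; first exact: measurable_funB.
apply: (@le_lt_trans _ _ (\int[leb3]_(p in vec3 @^-1` U)
    (2%:E * ((f (vec3 p) ^+ 2)%:E + (q (vec3 p) ^+ 2)%:E)))%E).
  apply: ge0_le_integral => //.
  - by move=> p _; rewrite lee_fin sqr_ge0.
  - by apply/measurable_EFinP; apply: measurable_funX; exact: measurable_funB.
  - apply: measurable_funeM; apply: emeasurable_funD; apply/measurable_EFinP; exact: measurable_funX.
  - move=> p _; rewrite -EFinD -EFinM lee_fin.
    by have := sqr_ge0 (f (vec3 p) + q (vec3 p)); rewrite !expr2; nra.
have m2 (h : V3 -> R) : measurable_fun (vec3 @^-1` U : set T3) (fun p => h (vec3 p)) ->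
    measurable_fun (vec3 @^-1` U : set T3) (fun p => (h (vec3 p) ^+ 2)%:E).
  by move=> mh; apply/measurable_EFinP; exact: measurable_funX.
have p2 (h : V3 -> R) (p : T3) : (vec3 @^-1` U) p -> (0 <= (h (vec3 p) ^+ 2)%:E)%E.
  by move=> _; rewrite lee_fin sqr_ge0.
have m2f := m2 f mf; have m2q := m2 q mq.
rewrite ge0_integralZl//; [|exact: emeasurable_funD|by move=> p Up; rewrite adde_ge0// p2].
rewrite ge0_integralD//; [|exact: p2|exact: p2].
by rewrite lte_mul_pinfty// lte_add_pinfty.
Qed.

Lemma ae_on_and U (I : countType) (P : I -> V3 -> Prop) :
  (forall j : I, ae_on U (P j)) -> ae_on U (fun x => forall j : I, P j x).
Proof.
move=> H; have := ae_forall_count (H : forall j : I, _).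
by apply: ae_imp => p Hp Up j; exact: Hp.
Qed.

Lemma ae_on_imp U (P Q : V3 -> Prop) : (forall x, U x -> P x -> Q x) -> ae_on U P -> ae_on U Q.
Proof. by move=> PQ; apply: ae_imp => p Pp Up; exact: PQ (Pp Up). Qed.

Lemma int3_ae U f q phi : measurable3 U -> ae_on U (fun x => f x = q x) ->
  measurable_fun (vec3 @^-1` U : set T3) (fun p => f (vec3 p)) ->
  measurable_fun (vec3 @^-1` U : set T3) (fun p => q (vec3 p)) -> bm phi ->
  int3 U (fun x => f x * phi x) = int3 U (fun x => q x * phi x).
Proof.
move=> mU fq mf mq [[mp _] _].
have mp' : measurable_fun (vec3 @^-1` U : set T3) (fun p => phi (vec3 p)) by exact: measurable_funTS.
apply: ae_eq_Rintegral => //; try exact: measurable_funM.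
by apply: ae_imp fq => p fq Up; rewrite fq.
Qed.

Lemma int3_dot U u Phi : measurable3 U -> L2v U u -> (forall i, bm (fun x => Phi x 0 i)) ->
  int3 U (fun x => dot (u x) (Phi x)) = \sum_i int3 U (fun x => u x 0 i * Phi x 0 i).
Proof.
move=> mU Lu bP; rewrite /dot (@int3_sum _ U _ _ (fun i x => u x 0 i * Phi x 0 i))//.
by move=> i; exact: L2_bm_integrable.
Qed.

Lemma weak_grad_ae U f q w : measurable3 U -> L2 U f -> L2 U q ->
  ae_on U (fun x => f x = q x) -> weak_grad U f w -> weak_grad U q w.
Proof.
move=> mU [mf _] [mq _] fq H phi tp i; rewrite -(H _ tp); apply/esym.
exact: int3_ae mU fq mf mq (test_bm (test_partial i tp)).
Qed.

Lemma weak_grad_eq U f w w' : (forall x, U x -> w x = w' x) -> weak_grad U f w -> weak_grad U f w'.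
Proof.
move=> ww H phi tp i; rewrite (H _ tp); congr (- _); apply: eq_int3 => x Ux.
by rewrite ww.
Qed.

Lemma weak_curl_ae U u u' w : measurable3 U -> L2v U u -> L2v U u' ->
  ae_on U (fun x => u x = u' x) -> weak_curl U u w -> weak_curl U u' w.
Proof.
move=> mU Lu Lu' uu H Phi tP; rewrite -(H _ tP).
have bC i := bm_curl i tP.
rewrite !int3_dot//; apply: eq_bigr => i _; apply/esym; apply: int3_ae => //.
- by apply: ae_on_imp uu => x _ ->.
- by have [] := Lu i.
- by have [] := Lu' i.
Qed.

Lemma weak_curl_eq U u w w' : (forall x, U x -> w x = w' x) -> weak_curl U u w -> weak_curl U u w'.
Proof. by move=> ww H Phi tP; rewrite (H _ tP); apply: eq_int3 => x Ux; rewrite ww. Qed.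

Lemma weak_div_ae U u u' q : measurable3 U -> L2v U u -> L2v U u' ->
  ae_on U (fun x => u x = u' x) -> weak_div U u q -> weak_div U u' q.
Proof.
move=> mU Lu Lu' uu H phi tp; rewrite -(H _ tp).
have bG i : bm (fun x => grad phi x 0 i).
  by under eq_fun do rewrite mxE; exact: test_bm (test_partial i tp).
rewrite !int3_dot//; apply: eq_bigr => i _; apply/esym; apply: int3_ae => //.
- by apply: ae_on_imp uu => x _ ->.
- by have [] := Lu i.
- by have [] := Lu' i.
Qed.

Lemma weak_div_eq U u q q' : (forall x, U x -> q x = q' x) -> weak_div U u q -> weak_div U u q'.
Proof. by move=> qq H phi tp; rewrite (H _ tp); congr (- _); apply: eq_int3 => x Ux; rewrite qq. Qed.

(** Weak derivatives are unique almost everywhere because test functions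
    separate square integrable functions. *)
Lemma int3_test_inj U f q : open U -> L2 U f -> L2 U q ->
  (forall phi, test_fun U phi -> int3 U (fun x => f x * phi x) = int3 U (fun x => q x * phi x)) ->
  ae_on U (fun x => f x = q x).
Proof.
move=> oU Lf Lq H; have mU := measurable_open3 oU.
have := int3_test_eq0 oU (L2B mU Lf Lq) _.
move=> K; have {K} : ae_on U (fun x => f x - q x = 0).
  apply: K => phi tp; have bp := test_bm tp.
  under eq_int3 do rewrite mulrBl.
  rewrite int3D//; [|exact: L2_bm_integrable|]; last first.
    have := L2_bm_integrable mU (L2N Lq) bp; apply: eq_integrable => // p _ /=.
    by rewrite mulNr.
  by rewrite int3N ?H ?subrr//; exact: L2_bm_integrable.
by apply: ae_on_imp => x _ /eqP; rewrite subr_eq0 => /eqP.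
Qed.

Lemma weak_grad_unique U f w w' : open U -> L2v U w -> L2v U w' ->
  weak_grad U f w -> weak_grad U f w' -> ae_on U (fun x => w x = w' x).
Proof.
move=> oU Lw Lw' H H'.
have : ae_on U (fun x => forall i : 'I_3, w x 0 i = w' x 0 i).
  apply: ae_on_and => i; apply: int3_test_inj => // phi tp.
  by apply: oppr_inj; rewrite -(H _ tp) -(H' _ tp).
by apply: ae_on_imp => x _ ww; apply/rowP.
Qed.

Lemma weak_curl_unique U u w w' : open U -> L2v U w -> L2v U w' ->
  weak_curl U u w -> weak_curl U u w' -> ae_on U (fun x => w x = w' x).
Proof.
move=> oU Lw Lw' H H'.
have : ae_on U (fun x => forall i : 'I_3, w x 0 i = w' x 0 i).
  apply: ae_on_and => i; apply: int3_test_inj => // phi tp.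
  pose Phi (x : V3) : V3 := phi x *: delta_mx 0 i.
  have tP : test_field U Phi.
    move=> j; rewrite /Phi; under eq_fun do rewrite scaleV mulrC.
    by apply: test_mul => //; exact: smooth_cst.
  have E (v : V3 -> V3) : int3 U (fun x => v x 0 i * phi x) = int3 U (fun x => dot (v x) (Phi x)).
    apply: eq_int3 => x _; rewrite /Phi dotZr mulrC; congr (_ * _).
    by rewrite /dot (bigD1 i)//= big1 ?addr0 ?mxE ?eqxx ?mulr1// => j /negPf ji; rewrite mxE ji andbF mulr0.
  by rewrite !E -(H _ tP) -(H' _ tP).
by apply: ae_on_imp => x _ ww; apply/rowP.
Qed.

Lemma weak_div_unique U u q q' : open U -> L2 U q -> L2 U q' ->
  weak_div U u q -> weak_div U u q' -> ae_on U (fun x => q x = q' x).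
Proof.
move=> oU Lq Lq' H H'; apply: int3_test_inj => // phi tp.
by apply: oppr_inj; rewrite -(H _ tp) -(H' _ tp).
Qed.

Lemma L2Z U f (c : R) : measurable3 U -> L2 U f -> L2 U (fun x => c * f x).
Proof.
move=> mU [mf f2]; split; first exact: measurable_funM.
under eq_integral do rewrite exprMn EFinM.
rewrite ge0_integralZl//.
- by rewrite lte_mul_pinfty// lee_fin sqr_ge0.
- by apply/measurable_EFinP; exact: measurable_funX.
- by move=> p _; rewrite lee_fin sqr_ge0.
- by rewrite lee_fin sqr_ge0.
Qed.

Lemma L2vZ U u (c : R) : measurable3 U -> L2v U u -> L2v U (fun x => c *: u x).
Proof. by move=> mU Lu i; apply: L2_eq (L2Z c mU (Lu i)) => x _; rewrite scaleV. Qed.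

Lemma int3_dotZ U u Phi (c : R) : measurable3 U -> L2v U u -> (forall i, bm (fun x => Phi x 0 i)) ->
  int3 U (fun x => dot (c *: u x) (Phi x)) = c * int3 U (fun x => dot (u x) (Phi x)).
Proof.
move=> mU Lu bP; rewrite !int3_dot//; last exact: L2vZ.
rewrite mulr_sumr; apply: eq_bigr => i _.
rewrite -int3Z//; last exact: L2_bm_integrable.
by apply: eq_int3 => x _; rewrite scaleV mulrA.
Qed.

Lemma HcurlZ U u (c : R) : measurable3 U -> Hcurl U u -> Hcurl U (fun x => c *: u x).
Proof.
move=> mU [Lu [w [Lw H]]]; split; first exact: L2vZ.
exists (fun x => c *: w x); split; first exact: L2vZ.
move=> Phi tP; rewrite !int3_dotZ// ?H// => i; first exact: test_field_bm tP i.
exact: bm_curl tP.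
Qed.

Lemma HdivZ U u (c : R) : measurable3 U -> Hdiv U u -> Hdiv U (fun x => c *: u x).
Proof.
move=> mU [Lu [q [Lq H]]]; split; first exact: L2vZ.
exists (fun x => c * q x); split; first exact: L2Z.
move=> phi tp; rewrite int3_dotZ// => [|i]; last first.
  by under eq_fun do rewrite mxE; exact: test_bm (test_partial i tp).
rewrite (H _ tp) mulrN -int3Z//; last exact: L2_bm_integrable mU Lq (test_bm tp).
by congr (- _); apply: eq_int3 => x _; rewrite mulrA.
Qed.

Lemma L2v_eq U u w : (forall x, U x -> u x = w x) -> L2v U u -> L2v U w.
Proof. by move=> uw Lu i; apply: L2_eq (Lu i) => x /uw ->. Qed.

Lemma Hcurl_eq U u w : (forall x, U x -> u x = w x) -> Hcurl U u -> Hcurl U w.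
Proof.
move=> uw [Lu [c [Lc H]]]; split; first exact: L2v_eq Lu.
exists c; split=> // Phi tP; rewrite -(H _ tP).
by apply: eq_int3 => x Ux; rewrite uw.
Qed.

Lemma Hdiv_eq U u w : (forall x, U x -> u x = w x) -> Hdiv U u -> Hdiv U w.
Proof.
move=> uw [Lu [c [Lc H]]]; split; first exact: L2v_eq Lu.
exists c; split=> // phi tp; rewrite -(H _ tp).
by apply: eq_int3 => x Ux; rewrite uw.
Qed.

Lemma L2_cst0 U : L2 U (fun=> 0).
Proof.
split; first exact: measurable_cst.
by rewrite integral0_eq// => p _; rewrite expr0n.
Qed.

Lemma Hcurl0 U : Hcurl U (fun=> 0).
Proof.
have L0 : L2v U (fun=> 0) by move=> i; apply: L2_eq (L2_cst0 U) => x _; rewrite mxE.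
split=> //; exists (fun=> 0); split=> // Phi tP.
by apply: eq_int3 => x _; rewrite !dot0l.
Qed.

Lemma Hdiv0 U : Hdiv U (fun=> 0).
Proof.
have L0 : L2v U (fun=> 0) by move=> i; apply: L2_eq (L2_cst0 U) => x _; rewrite mxE.
split=> //; exists (fun=> 0); split; first exact: L2_cst0.
by move=> phi tp; rewrite !int3_eq0 ?oppr0// => x _; rewrite ?dot0l ?mul0r.
Qed.

End WeakOperators.

(** * Line integrals and integrals over the unit triangle *)

Section EdgesAndFaces.
Context {R : realType}.
Local Notation V3 := 'rV[R]_3.
Local Notation T1 := (measurableTypeR R).
Local Notation T3 := (T1 * T1 * T1)%type.
Local Notation mu1 := (@lebesgue_measure R).
Implicit Types (f W D : V3 -> R) (x y z g p q r a b l : V3) (i : 'I_3).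

Lemma continuous_line p (e : V3) : continuous (fun s : R => p + s *: e).
Proof.
move=> s; apply: (@continuousD _ _ _ (cst p) (fun s : R => s *: e)).
  exact: cst_continuous.
exact: scalel_continuous.
Qed.

Lemma continuous_linel p (e : V3) : continuous (fun s : R => s *: e + p).
Proof.
move=> s; apply: (@continuousD _ _ _ (fun s : R => s *: e) (cst p)).
  exact: scalel_continuous.
exact: cst_continuous.
Qed.

Lemma integrable_segment (h : R -> R) (c d : R) : continuous h ->
  mu1.-integrable `[c, d] (EFin \o h).
Proof.
move=> ch; apply: continuous_compact_integrable; first exact: segment_compact.
exact: continuous_subspaceT.
Qed.

Lemma Rintegral_FTC (F h : R -> R) (c d : R) : c <= d -> continuous h ->
  (forall t : R, is_derive t 1 F (h t)) ->
  \int[mu1]_(t in `[c, d]) h t = F d - F c.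
Proof.
rewrite le_eqVlt => /predU1P[<-|cd] ch dF.
  by rewrite subrr set_itv1 Rintegral_set1.
by rewrite /Rintegral (FTC2_derive cd ch dF).
Qed.

(** The unit triangle, over which faces are parametrised by [tpt]. *)
Definition utri : set (R * R) := [set s : R * R | [/\ 0 <= s.1, 0 <= s.2 & s.1 + s.2 <= 1]].

Lemma measurable_utri : measurable (utri : set (T1 * T1)).
Proof.
have -> : (utri : set (T1 * T1)) = (fst @^-1` `[0, +oo[%classic `&` snd @^-1` `[0, +oo[%classic) `&`
    (fun s => s.1 + s.2) @^-1` `]-oo, 1]%classic.
  by apply/seteqP; split=> s /=; rewrite !in_itv/= !andbT; [move=> []|move=> [[]]].
apply: measurableI; first apply: measurableI.
- by rewrite -[X in measurable X]setTI; apply: measurable_fst => //; exact: measurable_itv.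
- by rewrite -[X in measurable X]setTI; apply: measurable_snd => //; exact: measurable_itv.
- rewrite -[X in measurable X]setTI.
  have m : measurable_fun setT (fun s : T1 * T1 => s.1 + s.2 : T1).
    by apply: measurable_funD; [exact: measurable_fst|exact: measurable_snd].
  by apply: m => //; exact: measurable_itv.
Qed.

Lemma leb2_utri_lty : ((mu1 \x mu1) utri < +oo)%E.
Proof.
apply: (@le_lt_trans _ _ ((mu1 \x mu1) (`[0%R, 1%R]%classic `*` `[0%R, 1%R]%classic))%E).
  apply: le_measure; rewrite ?inE.
  - exact: measurable_utri.
  - by apply: measurableX; exact: measurable_itv.
  - by move=> s [s1 s2 s12]; split; rewrite /= in_itv/=; apply/andP; split=> //; lra.
rewrite /= product_measure1E; [|exact: measurable_itv..].
by rewrite /= !lebesgue_measure_itv/= lte_fin ltr01 -EFinB -EFinM ltry.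
Qed.

(** The affine parametrisation of the plane through [p] with directions [e1]
    and [e2]. *)
Definition tpt p (e1 e2 : V3) (s : R * R) : V3 := p + s.1 *: e1 + s.2 *: e2.

Lemma measurable_tpt f p (e1 e2 : V3) : continuous f ->
  measurable_fun setT (fun s : T1 * T1 => f (tpt p e1 e2 s)).
Proof.
move=> cf; have -> : (fun s : T1 * T1 => f (tpt p e1 e2 s)) =
    (f \o vec3) \o (fun s : T1 * T1 => (unvec3 (tpt p e1 e2 s) : T3)).
  by apply/funext => s; rewrite /= unvec3K.
apply: measurableT_comp; first exact: continuous_measurable3.
have m i : measurable_fun setT (fun s : T1 * T1 => tpt p e1 e2 s 0 i : T1).
  have -> : (fun s : T1 * T1 => tpt p e1 e2 s 0 i : T1) =
      fun s => p 0 i + s.1 * e1 0 i + s.2 * e2 0 i.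
    by apply/funext => s; rewrite !addV !scaleV.
  apply: measurable_funD; first apply: measurable_funD => //.
    by apply: measurable_funM => //; exact: measurable_fst.
  by apply: measurable_funM => //; exact: measurable_snd.
apply: (@measurable_fun_pair _ _ _ _ _ _ (fun s : T1 * T1 => (tpt p e1 e2 s 0 0, tpt p e1 e2 s 0 1) : T1 * T1) (fun s : T1 * T1 => tpt p e1 e2 s 0 2 : T1)); last exact: m.
by apply: measurable_fun_pair; exact: m.
Qed.

Lemma utri_bounded f p (e1 e2 : V3) : continuous f ->
  exists M : R, forall s, utri s -> `|f (tpt p e1 e2 s)| <= M.
Proof.
move=> cf; have [_ H] := locbdd_continuous cf.
have [M HM] := H (`|p| + `|e1| + `|e2|); exists M => s [s1 s2 s12]; apply: HM.
apply: (le_trans (ler_normD _ _)); apply: lerD; last first.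
  by rewrite normrZ ger0_norm// ler_piMl//; lra.
apply: (le_trans (ler_normD _ _)); apply: lerD => //.
by rewrite normrZ ger0_norm// ler_piMl//; lra.
Qed.

Lemma integrable_utri f p (e1 e2 : V3) : continuous f ->
  (mu1 \x mu1)%E.-integrable utri (EFin \o (fun s => f (tpt p e1 e2 s))).
Proof.
move=> cf; have [M HM] := utri_bounded p e1 e2 cf.
apply: (@bounded_integrable _ _ _ (mu1 \x mu1)%E _ _ M) => //.
- exact: measurable_utri.
- exact: leb2_utri_lty.
- by apply: measurable_funTS; exact: measurable_tpt.
Qed.

(** Fubini on the unit triangle, with the inner integral along the first,
    respectively the second, coordinate. *)
Lemma utri_Fubini1 f p (e1 e2 : V3) (h : R -> R) : continuous f ->
  (forall s, 0 <= s <= 1 -> \int[mu1]_(t in `[0, 1 - s]) f (tpt p e1 e2 (t, s)) = h s) ->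
  \int[(mu1 \x mu1)%E]_(s in utri) f (tpt p e1 e2 s) = \int[mu1]_(s in `[0, 1]) h s.
Proof.
move=> cf Hh; have iT := integrable_utri p e1 e2 cf.
rewrite /Rintegral; congr fine; rewrite [LHS]integral_mkcond [RHS]integral_mkcond.
move/(integrable_mkcond _ measurable_utri): iT => iT.
rewrite -(integral21_prod_meas1 iT); apply: eq_integral => s _; rewrite /fubini_G.
rewrite [RHS]patchE; case: ifPn => [|/negP ns].
  rewrite inE/= in_itv/= => s01; rewrite -Hh//.
  rewrite /Rintegral fineK; last first.
    apply: integrable_fin_num; first exact: measurable_itv.
    apply: integrable_segment; move=> t.
    have -> : (fun t : R => f (tpt p e1 e2 (t, s))) = (fun t : R => f ((p + s *: e2) + t *: e1)).
      by apply/funext => t'; rewrite /tpt/= addrAC.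
    apply: (@continuous_comp _ _ _ (fun t : R => (p + s *: e2) + t *: e1)); first exact: continuous_line.
    exact: cf.
  rewrite [RHS]integral_mkcond; apply: eq_integral => t _; rewrite !patchE.
  suff -> : ((t, s) \in utri) = (t \in `[0, 1 - s]%classic) by [].
  apply/idP/idP; rewrite !inE/= in_itv/=.
    by move=> [/= t0 _ ts]; rewrite t0/=; lra.
  by move=> /andP[t0 ts]; case/andP: s01 => s0 _; split=> //=; lra.
apply: integral0_eq => t _; rewrite patchE; case: ifPn => //.
rewrite inE => -[/= t0 s0 ts]; exfalso; apply: ns; rewrite inE/= in_itv/= s0/=; lra.
Qed.

Lemma utri_Fubini2 f p (e1 e2 : V3) (h : R -> R) : continuous f ->
  (forall s, 0 <= s <= 1 -> \int[mu1]_(t in `[0, 1 - s]) f (tpt p e1 e2 (s, t)) = h s) ->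
  \int[(mu1 \x mu1)%E]_(s in utri) f (tpt p e1 e2 s) = \int[mu1]_(s in `[0, 1]) h s.
Proof.
move=> cf Hh; have iT := integrable_utri p e1 e2 cf.
rewrite /Rintegral; congr fine; rewrite [LHS]integral_mkcond [RHS]integral_mkcond.
move/(integrable_mkcond _ measurable_utri): iT => iT.
rewrite -(integral12_prod_meas1 iT); apply: eq_integral => s _; rewrite /fubini_F.
rewrite [RHS]patchE; case: ifPn => [|/negP ns].
  rewrite inE/= in_itv/= => s01; rewrite -Hh//.
  rewrite /Rintegral fineK; last first.
    apply: integrable_fin_num; first exact: measurable_itv.
    apply: integrable_segment; move=> t.
    apply: (@continuous_comp _ _ _ (fun t : R => (p + s *: e1) + t *: e2)); first exact: continuous_line.
    exact: cf.
  rewrite [RHS]integral_mkcond; apply: eq_integral => t _; rewrite !patchE.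
  suff -> : ((s, t) \in utri) = (t \in `[0, 1 - s]%classic) by [].
  apply/idP/idP; rewrite !inE/= in_itv/=.
    by move=> [/= _ t0 ts]; rewrite t0/=; lra.
  by move=> /andP[t0 ts]; case/andP: s01 => s0 _; split=> //=; lra.
apply: integral0_eq => t _; rewrite patchE; case: ifPn => //.
rewrite inE => -[/= s0 t0 ts]; exfalso; apply: ns; rewrite inE/= in_itv/= s0/=; lra.
Qed.

Lemma utri_derive1 W D p (e1 e2 : V3) : continuous D -> (forall x, is_derive x e1 W (D x)) ->
  \int[(mu1 \x mu1)%E]_(s in utri) D (tpt p e1 e2 s) =
  \int[mu1]_(s in `[0, 1]) (W (p + (1 - s) *: e1 + s *: e2) - W (p + s *: e2)).
Proof.
move=> cD dW; apply: utri_Fubini1 => // s /andP[s0 s1].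
have E t : tpt p e1 e2 (t, s) = t *: e1 + (p + s *: e2) by rewrite /tpt/= addrAC addrC.
transitivity (\int[mu1]_(t in `[0, 1 - s]) D (t *: e1 + (p + s *: e2))).
  by apply: eq_Rintegral => t _; rewrite E.
have dh (t : R) : is_derive t 1 (fun t => W (t *: e1 + (p + s *: e2))) (D (t *: e1 + (p + s *: e2))).
  by apply: is_derive_along; exact: dW.
have ch : continuous (fun t : R => D (t *: e1 + (p + s *: e2))).
  move=> t; apply: (@continuous_comp _ _ _ (fun t : R => t *: e1 + (p + s *: e2))); last exact: cD.
  exact: continuous_linel.
rewrite (Rintegral_FTC _ ch dh) ?subr_ge0//.
by rewrite scale0r add0r [_ + (p + _)]addrC -addrA [s *: e2 + _]addrC addrA.
Qed.

Lemma utri_derive2 W D p (e1 e2 : V3) : continuous D -> (forall x, is_derive x e2 W (D x)) ->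
  \int[(mu1 \x mu1)%E]_(s in utri) D (tpt p e1 e2 s) =
  \int[mu1]_(s in `[0, 1]) (W (p + s *: e1 + (1 - s) *: e2) - W (p + s *: e1)).
Proof.
move=> cD dW; apply: utri_Fubini2 => // s /andP[s0 s1].
transitivity (\int[mu1]_(t in `[0, 1 - s]) D (t *: e2 + (p + s *: e1))).
  by apply: eq_Rintegral => t _; rewrite /tpt/= addrC.
have dh (t : R) : is_derive t 1 (fun t => W (t *: e2 + (p + s *: e1))) (D (t *: e2 + (p + s *: e1))).
  by apply: is_derive_along; exact: dW.
have ch : continuous (fun t : R => D (t *: e2 + (p + s *: e1))).
  move=> t; apply: (@continuous_comp _ _ _ (fun t : R => t *: e2 + (p + s *: e1))); last exact: cD.
  exact: continuous_linel.
rewrite (Rintegral_FTC _ ch dh) ?subr_ge0//.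
by rewrite scale0r add0r [X in W X - _]addrC.
Qed.

End EdgesAndFaces.

(** * Integral theorems across the interface *)

Section PiecewiseStokes.
Context {R : realType}.
Local Notation V3 := 'rV[R]_3.
Local Notation mu1 := (@lebesgue_measure R).
Implicit Types (V : V3 -> V3) (x y z g p q r a b l d e : V3).

(** The circulation of [V] along the oriented segment from [p] to [q]. *)
Definition circ V p q : R := \int[mu1]_(s in `[0, 1]) dot (V (p + s *: (q - p))) (q - p).

Lemma continuous_on_line (f : V3 -> R) p e : continuous f -> continuous (fun s : R => f (p + s *: e)).
Proof.
move=> cf s; apply: (@continuous_comp _ _ _ (fun s : R => p + s *: e)); last exact: cf.
exact: continuous_line.
Qed.

Lemma Rintegral_rev (h : R -> R) : continuous h ->
  \int[mu1]_(s in `[0, 1]) h (1 - s) = \int[mu1]_(s in `[0, 1]) h s.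
Proof.
move=> ch; rewrite [RHS]Rintegration_by_substitution_onem ?ler01 ?lexx//.
  by rewrite /unstable.onem subrr.
exact: continuous_subspaceT.
Qed.

Lemma smooth_dot_aff a z b e : smooth (fun y => dot (aff a z b y) e).
Proof. by apply: smooth_sum => i; apply: smoothM (smooth_aff a z b i) (smooth_cst _). Qed.

Lemma smooth_flat_affine P (m : R) g z : smooth (fun y : V3 => flat P (m * dot g (y - z))).
Proof. exact: smooth_flat (smoothZ m (smooth_affine g z)). Qed.

Lemma is_derive_dot_aff a z b e d x :
  is_derive x d (fun y => dot (aff a z b y) e) (dot (cross a d) e).
Proof.
apply: is_derive_affine => h; rewrite /aff !coordE; ring.
Qed.

Lemma is_derive_flat_affine P (m : R) g z d x :
  is_derive x d (fun y => flat P (m * dot g (y - z))) (flat (dflat P) (m * dot g (x - z)) * (m * dot g d)).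
Proof.
apply: (@is_derive_comp1 _ _ (flat P) (fun y => m * dot g (y - z))); first exact: is_derive_flat.
by apply: is_derive_affine => h; rewrite !coordE; ring.
Qed.

Lemma segmentB (f h : R -> R) : continuous f -> continuous h ->
  \int[mu1]_(s in `[0, 1]) (f s - h s) = \int[mu1]_(s in `[0, 1]) f s - \int[mu1]_(s in `[0, 1]) h s.
Proof.
move=> cf ch; rewrite RintegralB//.
- exact: (integrable_segment 0 1 cf).
- exact: (integrable_segment 0 1 ch).
Qed.

(** Stokes on a triangle for a field with continuous derivatives along its
    sides; [D12 - D21] is the component of the curl along
    [cross (q - p) (r - p)]. *)
Lemma triangle_circ V (D12 D21 : V3 -> R) p q r :
  (forall e, continuous (fun x => dot (V x) e)) -> continuous D12 -> continuous D21 ->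
  (forall x, is_derive x (q - p) (fun y => dot (V y) (r - p)) (D12 x)) ->
  (forall x, is_derive x (r - p) (fun y => dot (V y) (q - p)) (D21 x)) ->
  \int[(mu1 \x mu1)%E]_(s in utri) (D12 (tpt p (q - p) (r - p) s) - D21 (tpt p (q - p) (r - p) s)) =
  circ V p q + circ V q r - circ V p r.
Proof.
move=> cV c12 c21 d12 d21.
have mT := @measurable_utri R.
rewrite RintegralB//; [|exact: integrable_utri..].
rewrite (utri_derive1 p _ c12 d12) (utri_derive2 p _ c21 d21).
pose h (x e d : V3) (s : R) := dot (V (x + s *: e)) d.
have ch x e d : continuous (h x e d) by exact: (@continuous_on_line (fun y => dot (V y) d)).
have cr x e d : continuous (fun s : R => h x e d (1 - s)).
  have -> : (fun s : R => h x e d (1 - s)) = h (x + e) (- e) d; last exact: ch.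
  by apply/funext => s; congr (dot (V _) _); apply: row3P; rewrite !coordE; ring.
have -> : \int[mu1]_(s in `[0, 1]) (dot (V (p + (1 - s) *: (q - p) + s *: (r - p))) (r - p) - dot (V (p + s *: (r - p))) (r - p)) =
    \int[mu1]_(s in `[0, 1]) (h q (r - q) (r - p) s - h p (r - p) (r - p) s).
  apply: eq_Rintegral => s _; congr (dot (V _) _ - _).
  by apply: row3P; rewrite !coordE; ring.
have -> : \int[mu1]_(s in `[0, 1]) (dot (V (p + s *: (q - p) + (1 - s) *: (r - p))) (q - p) - dot (V (p + s *: (q - p))) (q - p)) =
    \int[mu1]_(s in `[0, 1]) (h q (r - q) (q - p) (1 - s) - h p (q - p) (q - p) s).
  apply: eq_Rintegral => s _; congr (dot (V _) _ - _).
  by apply: row3P; rewrite !coordE; ring.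
rewrite (segmentB (ch q (r - q) (r - p)) (ch p (r - p) (r - p))).
rewrite (segmentB (cr q (r - q) (q - p)) (ch p (q - p) (q - p))) (Rintegral_rev (ch q (r - q) (q - p))).
have -> : circ V q r = \int[mu1]_(s in `[0, 1]) h q (r - q) (r - p) s - \int[mu1]_(s in `[0, 1]) h q (r - q) (q - p) s.
  rewrite -(segmentB (ch q (r - q) (r - p)) (ch q (r - q) (q - p))); apply: eq_Rintegral => s _.
  by rewrite /h -dotBr; congr (dot _ _); apply: row3P; rewrite !coordE; ring.
rewrite -/(circ V p r) -/(circ V p q).
move: (circ V p r) (circ V p q) (Rintegral _ _ _) (Rintegral _ _ _) => A B C D; ring.
Qed.

(** Smooth approximations of the field with the jump [aff la z lb]: the
    indicator of the half-space is replaced by [flat 1 (m t)]. *)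
Definition cutoff g z a la b lb (m : R) y : V3 :=
  aff a z b y + flat 1 (m * dot g (y - z)) *: aff la z lb y.

Lemma dot_cutoff g z a la b lb m e y : dot (cutoff g z a la b lb m y) e =
  dot (aff a z b y) e + flat 1 (m * dot g (y - z)) * dot (aff la z lb y) e.
Proof. by rewrite /cutoff dotDl dotZl. Qed.

Lemma continuous_cutoff g z a la b lb m e :
  continuous (fun y => dot (cutoff g z a la b lb m y) e).
Proof.
apply: smooth_continuous; under eq_fun do rewrite dot_cutoff.
exact: smoothD (smooth_dot_aff _ _ _ _) (smoothM (smooth_flat_affine _ _ _ _) (smooth_dot_aff _ _ _ _)).
Qed.

(** The derivative along [d] of the component along [e] of a cutoff field; it
    does not depend on [b]. *)
Definition dcutoff g z a la lb (m : R) d e y : R := dot (cross a d) e +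
  (flat 1 (m * dot g (y - z)) * dot (cross la d) e +
   dot (aff la z lb y) e * (flat (dflat 1) (m * dot g (y - z)) * (m * dot g d))).

Lemma continuous_dcutoff g z a la lb m d e : continuous (dcutoff g z a la lb m d e).
Proof.
apply: smooth_continuous.
apply: smoothD (smooth_cst _) (smoothD (smoothM (smooth_flat_affine _ _ _ _) (smooth_cst _)) _).
exact: smoothM (smooth_dot_aff _ _ _ _) (smoothM (smooth_flat_affine _ _ _ _) (smooth_cst _)).
Qed.

Lemma is_derive_cutoff g z a la b lb m d e x :
  is_derive x d (fun y => dot (cutoff g z a la b lb m y) e) (dcutoff g z a la lb m d e x).
Proof.
have H := is_deriveD (is_derive_dot_aff a z b e d x)
  (is_deriveM (is_derive_flat_affine 1 m g z d x) (is_derive_dot_aff la z lb e d x)).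
by congr (is_derive _ _ _ _): H; apply/funext => y; rewrite dot_cutoff.
Qed.

(** In the curl of a cutoff field the derivative of the cutoff multiplies
    [cross g (aff la z lb)], which is [t la] by the interface conditions. *)
Lemma curl_cutoff g z a la lb m d e y : dot g la = 0 -> cross g lb = 0 ->
  dcutoff g z a la lb m d e y - dcutoff g z a la lb m e d y =
  2 * dot a (cross d e) +
  (2 * flat 1 (m * dot g (y - z)) + flat 'X (m * dot g (y - z))) * dot la (cross d e).
Proof.
move=> gla glb; rewrite -flat_mulX /dcutoff /aff.
have e0 : g 0 1 * lb 0 2 - g 0 2 * lb 0 1 = 0 by rewrite -(crossE g lb) glb mxE.
have e1 : g 0 2 * lb 0 0 - g 0 0 * lb 0 2 = 0 by rewrite -(crossE g lb) glb mxE.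
have e2 : g 0 0 * lb 0 1 - g 0 1 * lb 0 0 = 0 by rewrite -(crossE g lb) glb mxE.
have E : dot g d * dot (cross la (y - z) + lb) e - dot g e * dot (cross la (y - z) + lb) d =
    dot g (y - z) * dot la (cross d e).
  move: (y - z) gla e0 e1 e2 => w; rewrite !coordE.
  move: (g 0 0) (g 0 1) (g 0 2) (la 0 0) (la 0 1) (la 0 2) (lb 0 0) (lb 0 1) (lb 0 2) (d 0 0) (d 0 1) (d 0 2) (e 0 0) (e 0 1) (e 0 2) (w 0 0) (w 0 1) (w 0 2).
  move=> g0 g1 g2 a0 a1 a2 b0 b1 b2 d0 d1 d2 e0 e1 e2 w0 w1 w2 ga h0 h1 h2.
  apply/eqP; rewrite -subr_eq0; apply/eqP.
  transitivity ((d1 * e2 - d2 * e1) * (g1 * b2 - g2 * b1) + (d2 * e0 - d0 * e2) * (g2 * b0 - g0 * b2) +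
     (d0 * e1 - d1 * e0) * (g0 * b1 - g1 * b0) -
     ((d1 * e2 - d2 * e1) * w0 + (d2 * e0 - d0 * e2) * w1 + (d0 * e1 - d1 * e0) * w2) * (g0 * a0 + g1 * a1 + g2 * a2)).
    ring.
  by rewrite ga h0 h1 h2; ring.
have Ea : dot (cross a d) e - dot (cross a e) d = 2 * dot a (cross d e) by rewrite !coordE; ring.
have El : dot (cross la d) e - dot (cross la e) d = 2 * dot la (cross d e) by rewrite !coordE; ring.
move: (flat 1 (m * dot g (y - z))) (flat (dflat 1) (m * dot g (y - z))) => f f'.
move: (dot g (y - z)) (dot la (cross d e)) (dot a (cross d e)) (dot (cross a d) e) (dot (cross a e) d)
  (dot (cross la d) e) (dot (cross la e) d) (dot g d) (dot g e) (dot (cross la (y - z) + lb) e) (dot (cross la (y - z) + lb) d) E Ea El.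
move=> t L A ad ae ld le gd ge Fe Fd E Ea El.
transitivity ((ad - ae) + f * (ld - le) + m * f' * (gd * Fe - ge * Fd)); first by ring.
by rewrite E Ea El; ring.
Qed.

Lemma circ_cutoff_cvg g z a la b lb p q :
  let V x := cross (pw g z a la x) (x - z) + pw g z b lb x in
  mu1.-integrable `[0, 1] (EFin \o (fun s : R => dot (V (p + s *: (q - p))) (q - p))) /\
  circ (cutoff g z a la b lb n.+1%:R) p q @[n --> \oo] --> circ V p q.
Proof.
move=> V.
pose A (s : R) := dot (aff a z b (p + s *: (q - p))) (q - p).
pose L (s : R) := dot (aff la z lb (p + s *: (q - p))) (q - p).
have cA : continuous A.
  exact: (@continuous_on_line (fun y => dot (aff a z b y) (q - p)) _ _ (smooth_continuous (smooth_dot_aff _ _ _ _))).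
have cL : continuous L.
  exact: (@continuous_on_line (fun y => dot (aff la z lb y) (q - p)) _ _ (smooth_continuous (smooth_dot_aff _ _ _ _))).
pose B n (s : R) := dot (cutoff g z a la b lb n.+1%:R (p + s *: (q - p))) (q - p).
have cB n : continuous (B n).
  have H := @continuous_cutoff g z a la b lb n.+1%:R (q - p); exact: (continuous_on_line H).
have [|||||I L'] := @dominated_Rintegral _ _ _ mu1 `[0%R, 1%R]%classic B
  (fun s => dot (cross (pw g z a la (p + s *: (q - p))) (p + s *: (q - p) - z) + pw g z b lb (p + s *: (q - p))) (q - p))
  (fun s => `|A s| + `|L s|); last by split.
- exact: measurable_itv.
- move=> n; apply: measurable_funTS; exact: continuous_measurable_fun.
- move=> s _; rewrite /B; under eq_fun do rewrite dot_cutoff.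
  rewrite (_ : dot (_ + _) _ = A s + (0 < dot g (p + s *: (q - p) - z))%R%:R * L s).
    by apply: cvgD; [exact: cvg_cst|apply: cvgM; [exact: cvg_flat1|exact: cvg_cst]].
  rewrite /A /L /aff /pw; move: (_%:R : R) => c; move: (p + s *: (q - p)) => y; rewrite !coordE; ring.
- apply: integrable_segment => s; apply: (@continuousD _ _ _ (fun s => `|A s|) (fun s => `|L s|)).
    by apply: (@continuous_comp _ _ _ A (fun t => `|t|)); [exact: cA|exact: norm_continuous].
  by apply: (@continuous_comp _ _ _ L (fun t => `|t|)); [exact: cL|exact: norm_continuous].
- move=> n s _; rewrite /B dot_cutoff; apply: (le_trans (ler_normD _ _)); rewrite lerD2l.
  by rewrite normrM ger0_norm ?flat1_ge0// ler_piMl// flat1_le1.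
Qed.

(** Stokes' theorem on a triangle cut by the interface. *)
Lemma triangle_circ_pw g z a la b lb p q r : dot g la = 0 -> cross g lb = 0 ->
  let V x := cross (pw g z a la x) (x - z) + pw g z b lb x in
  (mu1 \x mu1)%E.-integrable utri (EFin \o (fun s : R * R =>
    dot (2 *: pw g z a la (tpt p (q - p) (r - p) s)) (cross (q - p) (r - p)))) /\
  \int[(mu1 \x mu1)%E]_(s in utri)
    dot (2 *: pw g z a la (tpt p (q - p) (r - p) s)) (cross (q - p) (r - p)) =
  circ V p q + circ V q r - circ V p r.
Proof.
move=> gla glb V; set N := cross _ _.
pose t s := dot g (tpt p (q - p) (r - p) s - z).
pose C n s : R := 2 * dot a N + (2 * flat 1 (n.+1%:R * t s) + flat 'X (n.+1%:R * t s)) * dot la N.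
have HC n : \int[(mu1 \x mu1)%E]_(s in utri) C n s = circ (cutoff g z a la b lb n.+1%:R) p q +
    circ (cutoff g z a la b lb n.+1%:R) q r - circ (cutoff g z a la b lb n.+1%:R) p r.
  have d1 x := @is_derive_cutoff g z a la b lb n.+1%:R (q - p) (r - p) x.
  have d2 x := @is_derive_cutoff g z a la b lb n.+1%:R (r - p) (q - p) x.
  have cV e := @continuous_cutoff g z a la b lb n.+1%:R e.
  rewrite -(triangle_circ cV (@continuous_dcutoff _ _ _ _ _ _ _ _) (@continuous_dcutoff _ _ _ _ _ _ _ _) d1 d2).
  by apply: eq_Rintegral => s _; rewrite curl_cutoff.
have [K K0 HK] := flat_bounded ('X : {poly R}).
have [|||||I H] := @dominated_Rintegral _ _ _ (mu1 \x mu1)%E utri C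
  (fun s => dot (2 *: pw g z a la (tpt p (q - p) (r - p) s)) N)
  (fun s => `|2 * dot a N| + (2 + K) * `|dot la N|).
- exact: measurable_utri.
- move=> n; apply: measurable_funTS.
  apply: (@measurable_tpt _ (fun y => 2 * dot a N + (2 * flat 1 (n.+1%:R * dot g (y - z)) + flat 'X (n.+1%:R * dot g (y - z))) * dot la N)).
  apply: smooth_continuous; apply: smoothD (smooth_cst _) (smoothM (smoothD _ _) (smooth_cst _)).
    exact: smoothZ (smooth_flat_affine _ _ _ _).
  exact: smooth_flat_affine.
- move=> s _; rewrite (_ : dot _ _ = 2 * dot a N + (2 * (0 < t s)%R%:R + 0) * dot la N).
    apply: cvgD; first exact: cvg_cst.
    apply: cvgM; last exact: cvg_cst.
    apply: cvgD; last exact: cvg_flatX.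
    by apply: cvgM; [exact: cvg_cst|exact: cvg_flat1].
  by rewrite /pw dotZl dotDl dotZl; ring.
- pose M : R := `|2 * dot a N| + (2 + K) * `|dot la N|.
  have cM : continuous (cst M : V3 -> R) by exact: cst_continuous.
  exact: (integrable_utri p (q - p) (r - p) cM).
- move=> n s _; apply: (le_trans (ler_normD _ _)); rewrite lerD2l normrM ler_wpM2r//.
  apply: (le_trans (ler_normD _ _)); apply: lerD => //.
  by rewrite ger0_norm ?mulr_ge0 ?flat1_ge0// ler_piMr// flat1_le1.
split; first exact: I.
apply: (cvg_unique (@Rhausdorff R) H).
rewrite /= (funext HC).
have C2 p' q' := (circ_cutoff_cvg g z a la b lb p' q').2.
by apply: cvgB; [apply: cvgD|]; exact: C2.
Qed.

(** The fundamental theorem of calculus on an edge cut by the interface. *)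
Lemma edge_circ_pw g z b l (c : R) p q : cross g l = 0 ->
  let U x := dot (pw g z b l x) (x - z) + c in
  circ (pw g z b l) p q = U q - U p.
Proof.
move=> gl U; pose t s := dot g (p + s *: (q - p) - z).
pose H (n : nat) (x : V3) := dot b (x - z) + flat 1 (n.+1%:R * dot g (x - z)) * dot l (x - z).
pose D n (s : R) : R := dot b (q - p) + (flat 1 (n.+1%:R * t s) + flat 'X (n.+1%:R * t s)) * dot l (q - p).
have cD n : continuous (D n).
  apply: (@continuous_on_line (fun y => dot b (q - p) + (flat 1 (n.+1%:R * dot g (y - z)) + flat 'X (n.+1%:R * dot g (y - z))) * dot l (q - p))).
  apply: smooth_continuous; apply: smoothD (smooth_cst _) (smoothM (smoothD _ _) (smooth_cst _)); exact: smooth_flat_affine.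
have gle x : dot l x * dot g (q - p) = dot l (q - p) * dot g x.
  rewrite {2}/dot {2}/dot mulr_sumr mulr_suml; apply: eq_bigr => i _.
  by rewrite mulrA cross_eq0_dot// mulrAC.
have HD n : \int[mu1]_(s in `[0, 1]) D n s = H n q - H n p.
  have dH x : is_derive x (q - p) (H n) (dot b (q - p) + (flat 1 (n.+1%:R * dot g (x - z)) + flat 'X (n.+1%:R * dot g (x - z))) * dot l (q - p)).
    have db (u : V3) : is_derive x (q - p) (fun x => dot u (x - z)) (dot u (q - p)).
      by apply: is_derive_affine => h; rewrite !coordE; ring.
    have := is_deriveD (db b) (is_deriveM (is_derive_flat_affine 1 n.+1%:R g z (q - p) x) (db l)).
    congr (is_derive _ _ _ _); congr (_ + _); rewrite -flat_mulX.
    rewrite /GRing.scale/=; have := gle (x - z).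
    move: (flat 1 (n.+1%:R * dot g (x - z))) (flat (dflat 1) (n.+1%:R * dot g (x - z))) => f f'.
    move: n.+1%:R (dot l (x - z)) (dot g (q - p)) (dot l (q - p)) (dot g (x - z)) => m lx gq lq gx E.
    by transitivity (f * lq + m * f' * (lx * gq)); [ring|rewrite E; ring].
  have dh (s : R) : is_derive s 1 (fun s => H n (s *: (q - p) + p)) (D n s).
    by apply: is_derive_along; rewrite /D /t addrC; exact: dH.
  by rewrite (Rintegral_FTC ler01 (cD n) dh) scale1r scale0r add0r subrK.
have [K K0 HK] := flat_bounded ('X : {poly R}).
have [|||||_ L] := @dominated_Rintegral _ _ _ mu1 `[0%R, 1%R]%classic D
  (fun s => dot (pw g z b l (p + s *: (q - p))) (q - p))
  (fun s => `|dot b (q - p)| + (1 + K) * `|dot l (q - p)|).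
- exact: measurable_itv.
- by move=> n; apply: measurable_funTS; exact: continuous_measurable_fun.
- move=> s _; rewrite (_ : dot _ _ = dot b (q - p) + ((0 < t s)%R%:R + 0) * dot l (q - p)).
    apply: cvgD; first exact: cvg_cst.
    apply: cvgM; last exact: cvg_cst.
    by apply: cvgD; [exact: cvg_flat1|exact: cvg_flatX].
  by rewrite /pw dotDl dotZl addr0.
- by apply: integrable_segment; exact: cst_continuous.
- move=> n s _; apply: (le_trans (ler_normD _ _)); rewrite lerD2l normrM ler_wpM2r//.
  apply: (le_trans (ler_normD _ _)); apply: lerD => //.
  by rewrite ger0_norm ?flat1_ge0// flat1_le1.
have HU x : H n x @[n --> \oo] --> dot (pw g z b l x) (x - z).
  rewrite /pw dotDl dotZl; apply: cvgD; first exact: cvg_cst.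
  by apply: cvgM; [exact: cvg_flat1|exact: cvg_cst].
apply: (cvg_unique (@Rhausdorff R) L).
rewrite /= (funext HD).
rewrite /U opprD addrACA subrr addr0.
by apply: cvgB.
Qed.

End PiecewiseStokes.

(** * Members of the local spaces as piecewise affine fields *)

Section LocalSpaces.
Context {R : realType} (G : ife_setting R).
Local Notation V3 := 'rV[R]_3.
Implicit Types (K : elt G) (x y z g a b l d : V3).

(** Since the nodal values of [phi_h] have a negative product of extrema, both
    signs occur among them. *)
Lemma phi_h_interface K : is_interface K ->
  exists2 g : V3, forall x, elt_cl K x -> phi_h G x = dot g (x - x_K K) &
    exists i j : 'I_4, phi_h G (vtx K i) < 0 < phi_h G (vtx K j).
Proof.
move=> iK; have [g [c Hg]] := phi_h_affine K; have [tx px] := x_K_in iK.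
have gx x : elt_cl K x -> phi_h G x = dot g (x - x_K K).
  by move=> Kx; rewrite dotBr Hg//; move: px; rewrite Hg//; lra.
exists g => //; move: iK; rewrite /is_interface; set m := \big[_/_]_(_ < _) _; set M := \big[_/_]_(_ < _) _ => mM.
have [i Hi] : exists i : 'I_4, phi_h G (vtx K i) < 0.
  apply: contrapT => /forallNP H; have {}H i : 0 <= phi_h G (vtx K i) by rewrite leNgt; apply/negP/H.
  move: mM; rewrite ltNge mulr_ge0//.
    by apply: (big_ind (fun t => 0 <= t)) => // u v u0 v0; rewrite le_min u0 v0.
  by apply: (big_ind (fun t => 0 <= t)) => // u v u0 v0; rewrite le_max u0.
have [j Hj] : exists j : 'I_4, 0 < phi_h G (vtx K j).
  apply: contrapT => /forallNP H; have {}H j : phi_h G (vtx K j) <= 0 by rewrite leNgt; apply/negP/H.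
  move: mM; rewrite ltNge mulr_le0//.
    by apply: (big_ind (fun t => t <= 0)) => // u v u0 v0; rewrite ge_min u0.
  by apply: (big_ind (fun t => t <= 0)) => // u v u0 v0; rewrite ge_max u0 v0.
by exists i, j; rewrite Hi.
Qed.

(** The discrete interface is a plane that meets the interior of every
    interface element. *)
Lemma interface_plane K : is_interface K ->
  exists g z, [/\ g != 0, elt_op K z, forall x, dot g (x - x_K K) = dot g (x - z) &
    forall x, elt_cl K x -> phi_h G x = dot g (x - x_K K)].
Proof.
move=> iK; have [g Hg [i [j /andP[Hi Hj]]]] := phi_h_interface iK.
have [c [r [r0 Hr _]]] := elt_shape_regular K.
have Kv k : elt_cl K (vtx K k) by exact: tetra_vertex.
have g0 : g != 0.
  by apply: contraTneq Hj => g0; rewrite Hg// g0 dot0l ltxx.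
set t := dot g (c - x_K K).
(* a vertex that the plane separates weakly from the centre [c] of an inscribed
   ball; the segment between them meets the plane in an interior point *)
have [k [k0 kt]] : exists k, dot g (vtx K k - x_K K) != 0 /\ dot g (vtx K k - x_K K) * t <= 0.
  rewrite !Hg// in Hi Hj; have [t0|t0] := leP 0 t.
    by exists i; rewrite lt_eqF// mulr_le0_ge0// ltW.
  by exists j; rewrite gt_eqF// mulr_ge0_le0// ltW.
set u := dot g (vtx K k - x_K K) in k0 kt.
have ut : u - t != 0.
  apply: contra_neq k0 => ut; have E : u * t = u ^+ 2 by rewrite expr2; congr (_ * _); lra.
  by apply/eqP; rewrite -sqrf_eq0 eq_le sqr_ge0 -E kt.
have s01 : 0 < u / (u - t) <= 1.
  have [u0|u0|u0] := ltrgtP u 0; last by rewrite u0 eqxx in k0.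
    have t0 : 0 <= t by move: kt; rewrite nmulr_rle0.
    have d0 : u - t < 0 by lra.
    by rewrite ltr_ndivlMr// mul0r u0 ler_ndivrMr// mul1r; lra.
  have t0 : t <= 0 by move: kt; rewrite pmulr_rle0.
  have d0 : 0 < u - t by lra.
  by rewrite divr_gt0//= ler_pdivrMr// mul1r; lra.
pose s := u / (u - t); exists g, ((1 - s) *: vtx K k + s *: c); split=> //.
  exact: (tetra_interior r0 Hr (Kv k) s01).
move=> x; suff : dot g ((1 - s) *: vtx K k + s *: c - x_K K) = 0 by rewrite !dotBr; lra.
have -> : dot g ((1 - s) *: vtx K k + s *: c - x_K K) = (1 - s) * u + s * t.
  by rewrite /u /t !coordE; ring.
by rewrite /s; field.
Qed.

Lemma piecewise_const_pw K (c : V3 -> V3) g : piecewise_const K c ->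
  (forall x, elt_cl K x -> phi_h G x = dot g (x - x_K K)) ->
  exists b l, forall x, elt_cl K x -> c x = pw g (x_K K) b l x.
Proof.
move=> [[cp Hp] [cm Hm]] Hg; exists cm, (cp - cm) => x Kx; rewrite /pw.
case: ltP => h.
  by rewrite scale1r subrKC; apply: Hp; split=> //; rewrite Hg.
by rewrite scale0r addr0; apply: Hm; split=> //; rewrite Hg.
Qed.

Lemma B_loc_pw K (c : V3 -> V3) g z : g != 0 -> elt_op K z ->
  (forall x, dot g (x - x_K K) = dot g (x - z)) ->
  (forall x, elt_cl K x -> phi_h G x = dot g (x - x_K K)) -> B_loc K c ->
  exists b l, cross g l = 0 /\ forall x, elt_cl K x -> c x = pw g (x_K K) b l x.
Proof.
move=> g0 Kz gz Hg [pc cc _]; have [b [l bl]] := piecewise_const_pw pc Hg.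
exists b, l; split=> //.
apply: (Hcurl_pw (b := b) (elt_op_open (K := K)) Kz g0 gz).
by apply: Hcurl_eq cc => x /elt_op_cl /bl.
Qed.

Lemma A_loc_pw K (c : V3 -> V3) g z : g != 0 -> elt_op K z ->
  (forall x, dot g (x - x_K K) = dot g (x - z)) ->
  (forall x, elt_cl K x -> phi_h G x = dot g (x - x_K K)) -> A_loc K c ->
  exists a l, dot g l = 0 /\ forall x, elt_cl K x -> c x = pw g (x_K K) a l x.
Proof.
move=> g0 Kz gz Hg [pc cc _]; have [b [l bl]] := piecewise_const_pw pc Hg.
exists b, l; split=> //.
apply: (Hdiv_pw (a := b) (elt_op_open (K := K)) Kz g0 gz).
by apply: Hdiv_eq cc => x /elt_op_cl /bl.
Qed.

Lemma piecewise_const_cst K d : piecewise_const K (fun=> d).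
Proof. by split; exists d. Qed.

Lemma A_loc0 K : A_loc K (fun=> 0).
Proof.
split; first exact: piecewise_const_cst.
  exact: Hdiv0.
by apply: Hcurl_eq (Hcurl0 _) => x _; rewrite scaler0.
Qed.

Lemma B_loc0 K : B_loc K (fun=> 0).
Proof.
split; first exact: piecewise_const_cst.
  exact: Hcurl0.
by apply: Hdiv_eq (Hdiv0 _) => x _; rewrite scaler0.
Qed.

Lemma A_locZ K (c : V3 -> V3) (e : R) : A_loc K c -> A_loc K (fun x => e *: c x).
Proof.
have mK := measurable_elt_op K.
move=> [[[cp Hp] [cm Hm]] dc cc]; split.
- by split; [exists (e *: cp) => x /Hp ->|exists (e *: cm) => x /Hm ->].
- exact: HdivZ.
- by apply: Hcurl_eq (HcurlZ e mK cc) => x _; rewrite !scalerA mulrC.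
Qed.

(** The local spaces of an element of either kind. *)
Definition Sn_elt K u := if is_interface K then Sn_loc K u else P1_loc K u.
Definition Se_elt K u := if is_interface K then Se_loc K u else ND0_loc K u.
Definition Sf_elt K u := if is_interface K then Sf_loc K u else RT0_loc K u.

(** On a noninterface element the formulas hold with [g = 0] and [l = 0], and
    the centre at the origin. *)
Lemma Sn_elt_pw K u : Sn_elt K u -> exists g z b l (c : R), [/\ cross g l = 0,
  forall x, elt_cl K x -> u x = dot (pw g z b l x) (x - z) + c & Se_elt K (pw g z b l)].
Proof.
rewrite /Sn_elt /Se_elt; case: ifP => iK.
  move=> [c [e [Bc Hu]]]; have [g [z [g0 Kz gz Hg]]] := interface_plane iK.
  have [b [l [gl bl]]] := B_loc_pw g0 Kz gz Hg Bc.
  exists g, (x_K K), b, l, e; split=> //; first by move=> x Kx; rewrite Hu// bl.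
  exists (fun=> 0), c; split=> //; first exact: A_loc0.
  by move=> x Kx; rewrite bl// cross0l add0r.
move=> [b [c Hu]]; exists 0, 0, b, 0, c; split.
- exact: cross0l.
- by move=> x Kx; rewrite Hu// pw0 subr0.
- by exists 0, b => x _; rewrite pw0 cross0l add0r.
Qed.

Lemma Se_elt_pw K u : Se_elt K u -> exists g z a la b lb, [/\ dot g la = 0, cross g lb = 0,
  forall x, elt_cl K x -> u x = cross (pw g z a la x) (x - z) + pw g z b lb x &
  Sf_elt K (fun x => 2 *: pw g z a la x)].
Proof.
rewrite /Se_elt /Sf_elt; case: ifP => iK.
  move=> [c [d [Ac Bd Hu]]]; have [g [z [g0 Kz gz Hg]]] := interface_plane iK.
  have [b [lb [glb bl]]] := B_loc_pw g0 Kz gz Hg Bd.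
  have [a [la [gla al]]] := A_loc_pw g0 Kz gz Hg Ac.
  exists g, (x_K K), a, la, b, lb; split=> //; first by move=> x Kx; rewrite Hu// bl// al.
  exists 0, (fun x => 2 *: c x); split; first exact: A_locZ.
  by move=> x Kx; rewrite al// scale0r add0r.
move=> [a [b Hu]]; exists 0, 0, a, 0, b, 0; split.
- by rewrite dot0l.
- exact: cross0l.
- by move=> x Kx; rewrite Hu// !pw0 subr0.
- by exists 0, (2 *: a) => x _; rewrite pw0 scale0r add0r.
Qed.

Lemma Sf_elt_pw K u : Sf_elt K u -> exists g z a la (c : R), dot g la = 0 /\
  forall x, elt_cl K x -> u x = c *: (x - z) + pw g z a la x.
Proof.
rewrite /Sf_elt; case: ifP => iK.
  move=> [e [c [Ac Hu]]]; have [g [z [g0 Kz gz Hg]]] := interface_plane iK.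
  have [a [la [gla al]]] := A_loc_pw g0 Kz gz Hg Ac.
  by exists g, (x_K K), a, la, e; split=> // x Kx; rewrite Hu// al.
move=> [c [a Hu]]; exists 0, 0, a, 0, c; split; first by rewrite dot0l.
by move=> x Kx; rewrite Hu// pw0 subr0.
Qed.

Lemma Sn_elt_cst K (c : R) : Sn_elt K (cst c).
Proof.
rewrite /Sn_elt; case: ifP => iK.
  exists (fun=> 0), c; split; first exact: B_loc0.
  by move=> x _; rewrite dot0l add0r.
by exists 0, c => x _; rewrite dot0l add0r.
Qed.

End LocalSpaces.

(** * Derivatives and degrees of freedom of local functions *)

Lemma integrable_scale d (T : measurableType d) (R : realType) (mu : {measure set T -> \bar R})
    (D : set T) (f : T -> R) (c : R) : measurable D ->
  mu.-integrable D (EFin \o f) -> mu.-integrable D (EFin \o (fun x => c * f x)).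
Proof.
by move=> mD /(integrableZl mD c); apply: eq_integrable => // x _; rewrite /= EFinM.
Qed.

Section Traces.
Context {R : realType} (G : ife_setting R).
Local Notation V3 := 'rV[R]_3.
Local Notation mu1 := (@lebesgue_measure R).
Implicit Types (K : elt G) (x y z g a b l d p q r : V3).

Lemma elt_op_cube : exists N : R, forall K, elt_op K `<=` cube N.
Proof.
have [N HN] := Omega_bounded G; exists N => K x Kx; apply: HN; exact: elt_op_Omega Kx.
Qed.

Lemma locbdd_L2_elt K (f : V3 -> R) : locbdd f -> L2 (elt_op K) f.
Proof. have [N HN] := elt_op_cube; exact: L2_locbdd (measurable_elt_op K) (HN K). Qed.

Lemma L2_elt K (f : V3 -> R) : L2 (Omega G) f -> L2 (elt_op K) f.
Proof.
apply: L2_subset; [exact: measurable_elt_op|exact: measurable_Omega|exact: elt_op_Omega].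
Qed.

Lemma L2v_elt K (u : V3 -> V3) : L2v (Omega G) u -> L2v (elt_op K) u.
Proof. by move=> Lu i; exact: L2_elt. Qed.

Lemma eq_ae_on (U : set V3) (P : V3 -> Prop) : (forall x, U x -> P x) -> ae_on U P.
Proof. by move=> H; apply: aeW => p Up; exact: H. Qed.

Lemma locbdd_Z (c : R) (f : V3 -> R) : locbdd f -> locbdd (fun x => c * f x).
Proof. by move=> bf; apply: locbddM => //; exact: locbdd_cst. Qed.

Lemma locbdd_sub i z : locbdd (fun x : V3 => (x - z) 0 i).
Proof.
have -> : (fun x : V3 => (x - z) 0 i) = fun x => dot (delta_mx 0 i) (x - z); last exact: locbdd_affine.
apply/funext => x; rewrite /dot (bigD1 i)//= big1 ?addr0 ?mxE ?eqxx ?mul1r//.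
by move=> j /negPf ji; rewrite mxE eqxx ji mul0r.
Qed.

Lemma elt_segment K p q (s : R) : elt_cl K p -> elt_cl K q -> 0 <= s <= 1 ->
  elt_cl K (p + s *: (q - p)).
Proof.
move=> Kp Kq s01; have -> : p + s *: (q - p) = (1 - s) *: p + s *: q.
  by apply: row3P; rewrite !coordE; ring.
exact: tetra_convex.
Qed.

Lemma circ_eq K (u w : V3 -> V3) p q : elt_cl K p -> elt_cl K q ->
  (forall x, elt_cl K x -> u x = w x) -> circ u p q = circ w p q.
Proof.
move=> Kp Kq uw; apply: eq_Rintegral => s; rewrite inE/= in_itv/= => s01.
by rewrite uw//; exact: elt_segment.
Qed.

(** Integrability of the integrand of [circ]. *)
Definition circ_integrable (u : V3 -> V3) p q :=
  mu1.-integrable `[0, 1] (EFin \o (fun s : R => dot (u (p + s *: (q - p))) (q - p))).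

Lemma Se_elt_circ_integrable K u p q : Se_elt K u -> elt_cl K p -> elt_cl K q ->
  circ_integrable u p q.
Proof.
move=> /Se_elt_pw[g [z [a [la [b [lb [gla glb Hu _]]]]]]] Kp Kq.
have [H _] := circ_cutoff_cvg g z a la b lb p q.
apply: eq_integrable H => // s; rewrite inE/= in_itv/= => s01.
by congr (dot _ _)%:E; rewrite Hu//; exact: elt_segment.
Qed.

Lemma weak_curl_pw_cst U g z b l : cross g l = 0 -> weak_curl U (pw g z b l) (fun=> 0).
Proof.
move=> gl; have := @weak_curl_pw R U g z 0 0 b l (dot0r _) gl.
under [X in weak_curl _ _ X]eq_fun do rewrite pw0 scaler0.
by under eq_fun do rewrite pw0 cross0l add0r.
Qed.

Lemma weak_div_pw_cst U g z a l (c : R) : dot g l = 0 ->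
  weak_div U (fun x => c *: pw g z a l x) (fun=> 0).
Proof.
move=> gl; have gl' : dot g (c *: l) = 0 by rewrite dotZr gl mulr0.
have := @weak_div_pw R U g z (c *: a) (c *: l) 0 gl'.
under [X in weak_div _ _ X]eq_fun do rewrite mulr0.
congr (weak_div _ _ _); apply/funext => x.
by rewrite scale0r add0r /pw scalerDr !scalerA mulrC.
Qed.

(** The gradient of a member of the local nodal space, with its line integrals. *)
Lemma Sn_elt_grad K u : Sn_elt K u -> exists W : V3 -> V3, [/\ L2 (elt_op K) u,
  forall i, locbdd (fun x => W x 0 i), Se_elt K W,
  weak_grad (elt_op K) u W /\ weak_curl (elt_op K) W (fun=> 0) &
  forall p q, elt_cl K p -> elt_cl K q -> circ W p q = u q - u p].
Proof.
move=> /Sn_elt_pw[g [z [b [l [c [gl Hu SW]]]]]]; exists (pw g z b l).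
have mK := measurable_elt_op K.
have L : L2 (elt_op K) (fun x => dot (pw g z b l x) (x - z) + c).
  apply: locbdd_L2_elt; apply: locbddD; last exact: locbdd_cst.
  by apply: locbdd_dot => i; [exact: locbdd_pw|exact: locbdd_sub].
have Lu : L2 (elt_op K) u by apply: L2_eq L => x /elt_op_cl /Hu.
split=> //; first exact: locbdd_pw.
  split; last exact: weak_curl_pw_cst.
  have H := @weak_grad_pw R (elt_op K) g z b l c gl; apply: (weak_grad_ae mK L Lu _ H).
  by apply: eq_ae_on => x /elt_op_cl /Hu.
by move=> p q Kp Kq; rewrite (edge_circ_pw z b c p q gl) !Hu.
Qed.

(** The curl of a member of the local edge space, with its fluxes. *)
Lemma Se_elt_curl K u : Se_elt K u -> exists W : V3 -> V3, [/\ L2v (elt_op K) u,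
  forall i, locbdd (fun x => W x 0 i), Sf_elt K W,
  weak_curl (elt_op K) u W /\ weak_div (elt_op K) W (fun=> 0) &
  forall p q r, elt_cl K p -> elt_cl K q -> elt_cl K r ->
    (mu1 \x mu1)%E.-integrable utri (EFin \o (fun s : R * R =>
      dot (W (tpt p (q - p) (r - p) s)) (cross (q - p) (r - p)))) /\
    \int[(mu1 \x mu1)%E]_(s in utri) dot (W (tpt p (q - p) (r - p) s)) (cross (q - p) (r - p)) =
    circ u p q + circ u q r - circ u p r].
Proof.
move=> /Se_elt_pw[g [z [a [la [b [lb [gla glb Hu SW]]]]]]]; exists (fun x => 2 *: pw g z a la x).
have mK := measurable_elt_op K.
have L : L2v (elt_op K) (fun x => cross (pw g z a la x) (x - z) + pw g z b lb x).
  move=> i; apply: locbdd_L2_elt; under eq_fun do rewrite addV mxE.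
  apply: locbddD; last exact: locbdd_pw.
  apply: locbddD; last apply: locbdd_opp.
    by apply: locbddM; [exact: locbdd_pw|exact: locbdd_sub].
  by apply: locbddM; [exact: locbdd_pw|exact: locbdd_sub].
have Lu : L2v (elt_op K) u by apply: L2v_eq L => x /elt_op_cl /Hu.
split=> //.
- by move=> i; under eq_fun do rewrite scaleV; apply: locbdd_Z; exact: locbdd_pw.
- split; last exact: weak_div_pw_cst.
  have H := @weak_curl_pw R (elt_op K) g z a la b lb gla glb; apply: (weak_curl_ae mK L Lu _ H).
  by apply: eq_ae_on => x /elt_op_cl /Hu.
- move=> p q r Kp Kq Kr; have [I E] := triangle_circ_pw z a b p q r gla glb; split=> //.
  by rewrite E; congr (_ + _ - _); apply/esym; exact: (circ_eq _ _ Hu).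
Qed.

Lemma Sf_elt_div K u : Sf_elt K u -> exists c : R,
  L2v (elt_op K) u /\ weak_div (elt_op K) u (fun=> c).
Proof.
move=> /Sf_elt_pw[g [z [a [la [c [gla Hu]]]]]]; exists (3 * c).
have mK := measurable_elt_op K.
have L : L2v (elt_op K) (fun x => c *: (x - z) + pw g z a la x).
  move=> i; apply: locbdd_L2_elt; under eq_fun do rewrite addV scaleV.
  by apply: locbddD; [apply: locbdd_Z; exact: locbdd_sub|exact: locbdd_pw].
have Lu : L2v (elt_op K) u by apply: L2v_eq L => x /elt_op_cl /Hu.
split=> //; have H := @weak_div_pw R (elt_op K) g z a la c gla; apply: (weak_div_ae mK L Lu _ H).
by apply: eq_ae_on => x /elt_op_cl /Hu.
Qed.

(** The edge jump condition compares circulations: the length of the edge and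
    the normalisation of the tangent cancel. *)
Lemma seg_int_circ (u w : V3 -> V3) p q : p <> q ->
  circ_integrable u p q -> circ_integrable w p q ->
  seg_int p q (fun x => dot (u x - w x) (unit_tangent p q)) = circ u p q - circ w p q.
Proof.
move=> pq iu iw; rewrite /seg_int /unit_tangent; set e := enorm (q - p).
have e0 : e != 0 by rewrite enorm_eq0 subr_eq0 eq_sym; exact/eqP.
rewrite -[RHS]mul1r -[X in _ = X * _](divff e0) -mulrA; congr (_ * _).
rewrite mulrBr /circ -!RintegralZl// -RintegralB//; last first.
- exact: integrable_scale.
- exact: integrable_scale.
by apply: eq_Rintegral => s _; rewrite dotZr dotDl dotNl mulrBr.
Qed.

(** Equal fluxes satisfy the face jump condition; for a degenerate triangle the
    surface element is zero. *)
Lemma tri_int_flux (u w : V3 -> V3) p q r (c : R) :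
  let flux v := (fun s : R * R => dot (v (tpt p (q - p) (r - p) s)) (cross (q - p) (r - p))) in
  (mu1 \x mu1)%E.-integrable utri (EFin \o flux u) ->
  (mu1 \x mu1)%E.-integrable utri (EFin \o flux w) ->
  Rintegral (mu1 \x mu1)%E utri (flux u) = c -> Rintegral (mu1 \x mu1)%E utri (flux w) = c ->
  tri_int p q r (fun x => dot (u x) (unit_normal p q r) - dot (w x) (unit_normal p q r)) = 0.
Proof.
move=> flux iu iw Eu Ew; rewrite /tri_int /unit_normal; set N := cross _ _; set e := enorm N.
have mT := @measurable_utri R.
suff -> : \int[(mu1 \x mu1)%E]_(s in [set s : R * R | [/\ 0 <= s.1, 0 <= s.2 & s.1 + s.2 <= 1]])
   (dot (u (p + s.1 *: (q - p) + s.2 *: (r - p))) (e^-1 *: N) -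
    dot (w (p + s.1 *: (q - p) + s.2 *: (r - p))) (e^-1 *: N)) =
   \int[(mu1 \x mu1)%E]_(s in utri) (e^-1 * flux u s) - \int[(mu1 \x mu1)%E]_(s in utri) (e^-1 * flux w s).
  by rewrite !RintegralZl// Eu Ew subrr mulr0.
rewrite -RintegralB//; last first.
- exact: integrable_scale.
- exact: integrable_scale.
by apply: eq_Rintegral => s _; rewrite !dotZr.
Qed.

End Traces.

(** * The global complex *)

Section Complex.
Context {R : realType} (G : ife_setting R).
Local Notation V3 := 'rV[R]_3.
Implicit Types (K : elt G) (x p q r : V3) (f h : V3 -> R) (u v w : V3 -> V3).

Lemma is_node_elt_cl K p : is_node K p -> elt_cl K p.
Proof. by move=> [i ->]; exact: tetra_vertex. Qed.

Lemma ae_on_sym (T : Type) (U : set V3) (f g : V3 -> T) :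
  ae_on U (fun x => f x = g x) -> ae_on U (fun x => g x = f x).
Proof. exact: ae_on_imp. Qed.

(** Vector fields assembled from their restrictions to the elements. *)
Definition eltwisev (F : elt G -> V3 -> V3) x : V3 := \row_i eltwise (fun K x => F K x 0 i) x.

Lemma eltwisevE (F : elt G -> V3 -> V3) K x : elt_op K x -> eltwisev F x = F K x.
Proof. by move=> Kx; apply/rowP => i; rewrite mxE (eltwiseE _ Kx). Qed.

Lemma eltwisev_L2 (F : elt G -> V3 -> V3) : (forall K i, locbdd (fun x => F K x 0 i)) -> L2v (Omega G) (eltwisev F).
Proof.
by move=> bF i; under eq_fun do rewrite mxE; apply: eltwise_L2 => K; exact: bF.
Qed.

Lemma ae0v_elements w : (forall K, ae_on (elt_op K) (fun x => w x = 0)) -> ae0 G w.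
Proof.
move=> H; have : ae_on (Omega G) (fun x => forall i : 'I_3, w x 0 i = 0).
  apply: ae_on_and => i; apply: (ae0_elements (f := fun x => w x 0 i)) => K.
  by apply: ae_on_imp (H K) => x _ ->; rewrite mxE.
by apply: ae_on_imp => x _ Hx; apply/rowP => i; rewrite Hx mxE.
Qed.

(** The elementwise gradient of a member of the nodal space. *)
Lemma Sn_grad f : Sn G f -> exists W : elt G -> V3 -> V3, [/\
  forall K, weak_grad (elt_op K) f (W K),
  forall K i, locbdd (fun x => W K x 0 i),
  forall K, Se_elt K (W K), forall K, weak_curl (elt_op K) (W K) (fun=> 0) &
  forall K1 K2 p q, is_node K1 p -> is_node K1 q -> is_node K2 p -> is_node K2 q ->
    circ (W K1) p q = circ (W K2) p q].
Proof.
move=> [Lf [tr [ftr ltr ctr]]].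
have /choice[W HW] K := Sn_elt_grad (ltr K : Sn_elt K (tr K)).
exists W; split.
- move=> K; have [L _ _ [H _] _] := HW K.
  exact: weak_grad_ae (measurable_elt_op K) L (L2_elt K Lf) (ae_on_sym (ftr K)) H.
- by move=> K; have [] := HW K.
- by move=> K; have [] := HW K.
- by move=> K; have [_ _ _ []] := HW K.
- move=> K1 K2 p q p1 q1 p2 q2.
  have [_ _ _ _ C1] := HW K1; have [_ _ _ _ C2] := HW K2.
  rewrite C1 ?C2; try exact: is_node_elt_cl.
  by rewrite (ctr K1 K2 p)// (ctr K1 K2 q).
Qed.

(** The elementwise curl of a member of the edge space. *)
Lemma Se_curl v : Se G v -> exists W : elt G -> V3 -> V3, [/\
  forall K, weak_curl (elt_op K) v (W K),
  forall K i, locbdd (fun x => W K x 0 i),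
  forall K, Sf_elt K (W K), forall K, weak_div (elt_op K) (W K) (fun=> 0) &
  forall K1 K2 p q r, p <> q -> q <> r -> p <> r ->
    is_node K1 p -> is_node K1 q -> is_node K1 r ->
    is_node K2 p -> is_node K2 q -> is_node K2 r ->
    tri_int p q r (fun x => dot (W K1 x) (unit_normal p q r) - dot (W K2 x) (unit_normal p q r)) = 0].
Proof.
move=> [Lv [tr [vtr ltr ctr]]].
have {}ltr K : Se_elt K (tr K) := ltr K.
have /choice[W HW] K := Se_elt_curl (ltr K).
exists W; split.
- move=> K; have [L _ _ [H _] _] := HW K.
  exact: weak_curl_ae (measurable_elt_op K) L (L2v_elt K Lv) (ae_on_sym (vtr K)) H.
- by move=> K; have [] := HW K.
- by move=> K; have [] := HW K.
- by move=> K; have [_ _ _ []] := HW K.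
- move=> K1 K2 p q r pq qr pr p1 q1 r1 p2 q2 r2.
  have cE a b : a <> b -> is_node K1 a -> is_node K1 b -> is_node K2 a -> is_node K2 b ->
      circ (tr K1) a b = circ (tr K2) a b.
    move=> ab a1 b1 a2 b2; have := ctr K1 K2 a b ab a1 b1 a2 b2.
    have i1 := Se_elt_circ_integrable (ltr K1) (is_node_elt_cl a1) (is_node_elt_cl b1).
    have i2 := Se_elt_circ_integrable (ltr K2) (is_node_elt_cl a2) (is_node_elt_cl b2).
    by rewrite (seg_int_circ ab i1 i2) => /subr0_eq.
  have [_ _ _ _ C1] := HW K1; have [_ _ _ _ C2] := HW K2.
  have [i1 E1] := C1 p q r (is_node_elt_cl p1) (is_node_elt_cl q1) (is_node_elt_cl r1).
  have [i2 E2] := C2 p q r (is_node_elt_cl p2) (is_node_elt_cl q2) (is_node_elt_cl r2).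
  apply: (tri_int_flux i1 i2 E1); rewrite E2; congr (_ + _ - _); apply/esym; exact: cE.
Qed.

Lemma Sf_div v : Sf G v -> exists c : elt G -> R, forall K, weak_div (elt_op K) v (fun=> c K).
Proof.
move=> [Lv [tr [vtr ltr _]]].
have /choice[c Hc] K := Sf_elt_div (ltr K : Sf_elt K (tr K)).
exists c => K; have [L H] := Hc K.
exact: weak_div_ae (measurable_elt_op K) L (L2v_elt K Lv) (ae_on_sym (vtr K)) H.
Qed.

Lemma Sn_cst (c : R) : Sn G (cst c).
Proof.
split; first by have [N HN] := Omega_bounded G; exact: L2_locbdd (measurable_Omega G) HN (locbdd_cst c).
exists (fun=> cst c); split=> // K; first exact: eq_ae_on.
exact: Sn_elt_cst.
Qed.

Lemma grad_h_ae f W w : grad_h G f w -> (forall K, weak_grad (elt_op K) f (W K)) ->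
  (forall K i, locbdd (fun x => W K x 0 i)) ->
  forall K, ae_on (elt_op K) (fun x => w x = W K x).
Proof.
move=> [Lw Hw] HW bW K.
apply: (weak_grad_unique (elt_op_open (K := K)) (L2v_elt K Lw) _ (Hw K) (HW K)).
by move=> i; exact: locbdd_L2_elt.
Qed.

Lemma curl_h_ae v W w : curl_h G v w -> (forall K, weak_curl (elt_op K) v (W K)) ->
  (forall K i, locbdd (fun x => W K x 0 i)) ->
  forall K, ae_on (elt_op K) (fun x => w x = W K x).
Proof.
move=> [Lw Hw] HW bW K.
apply: (weak_curl_unique (elt_op_open (K := K)) (L2v_elt K Lw) _ (Hw K) (HW K)).
by move=> i; exact: locbdd_L2_elt.
Qed.

Lemma div_h_ae v (c : elt G -> R) h : div_h G v h -> (forall K, weak_div (elt_op K) v (fun=> c K)) ->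
  forall K, ae_on (elt_op K) (fun x => h x = c K).
Proof.
move=> [Lq Hq] Hc K.
apply: (weak_div_unique (elt_op_open (K := K)) (L2_elt K Lq) _ (Hq K) (Hc K)).
by apply: locbdd_L2_elt; exact: locbdd_cst.
Qed.

Lemma grad_maps : maps_into (Sn G) (grad_h G) (Se G).
Proof.
move=> f /Sn_grad[W [HW bW SW _ CW]]; split.
  exists (eltwisev W); split; first exact: eltwisev_L2.
  by move=> K; apply: weak_grad_eq (HW K) => x Kx; rewrite (eltwisevE _ Kx).
move=> w gw; have wW := grad_h_ae gw HW bW; case: gw => Lw _; split=> //.
exists W; split=> // K1 K2 p q pq p1 q1 p2 q2.
have i1 := Se_elt_circ_integrable (SW K1) (is_node_elt_cl p1) (is_node_elt_cl q1).
have i2 := Se_elt_circ_integrable (SW K2) (is_node_elt_cl p2) (is_node_elt_cl q2).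
by rewrite (seg_int_circ pq i1 i2) (CW K1 K2)// subrr.
Qed.

Lemma curl_maps : maps_into (Se G) (curl_h G) (Sf G).
Proof.
move=> v /Se_curl[W [HW bW SW _ CW]]; split.
  exists (eltwisev W); split; first exact: eltwisev_L2.
  by move=> K; apply: weak_curl_eq (HW K) => x Kx; rewrite (eltwisevE _ Kx).
move=> w cw; have wW := curl_h_ae cw HW bW; case: cw => Lw _; split=> //.
by exists W; split=> // K1 K2 p q r _; exact: CW.
Qed.

Lemma div_maps : maps_into (Sf G) (div_h G) (Qh G).
Proof.
move=> v /Sf_div[c Hc]; split.
  exists (eltwise (fun K => cst (c K))); split.
    by apply: eltwise_L2 => K; exact: locbdd_cst.
  by move=> K; apply: weak_div_eq (Hc K) => x Kx; rewrite (eltwiseE _ Kx).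
move=> q dq; have qc := div_h_ae dq Hc; case: dq => Lq _; split=> // K.
by exists (c K).
Qed.

Lemma grad_cst (c : R) w : grad_h G (cst c) w -> ae0 G w.
Proof.
move=> gw; apply: ae0v_elements => K; apply: (grad_h_ae gw (W := fun _ _ => 0)).
  move=> {}K; have := @weak_grad_pw R (elt_op K) 0 0 0 0 c (cross0l 0).
  by congr (weak_grad _ _ _); apply/funext => x; rewrite pw0// dot0l add0r.
by move=> {}K i; under eq_fun do rewrite mxE; exact: locbdd_cst.
Qed.

Lemma curl_grad f w u : Sn G f -> grad_h G f w -> curl_h G w u -> ae0 G u.
Proof.
move=> /Sn_grad[W [HW bW _ W0 _]] gw cu; apply: ae0v_elements => K.
apply: (curl_h_ae cu (W := fun _ _ => 0)) => {}K; last first.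
  by move=> i; under eq_fun do rewrite mxE; exact: locbdd_cst.
apply: (weak_curl_ae (measurable_elt_op K) _ (L2v_elt K gw.1) (ae_on_sym (grad_h_ae gw HW bW K)) (W0 K)).
by move=> i; exact: locbdd_L2_elt.
Qed.

Lemma div_curl v w h : Se G v -> curl_h G v w -> div_h G w h -> ae0 G h.
Proof.
move=> /Se_curl[W [HW bW _ W0 _]] cw dq; apply: ae0_elements => K.
apply: (div_h_ae dq (c := fun=> 0)) => {}K.
apply: (weak_div_ae (measurable_elt_op K) _ (L2v_elt K cw.1) (ae_on_sym (curl_h_ae cw HW bW K)) (W0 K)).
by move=> i; exact: locbdd_L2_elt.
Qed.

End Complex.

Theorem theorem3p3 (R : realType) (G : ife_setting R) :
  [/\ forall c : R, Sn G (cst c),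
      maps_into (Sn G) (grad_h G) (Se G),
      maps_into (Se G) (curl_h G) (Sf G) &
      maps_into (Sf G) (div_h G) (Qh G)] /\
  [/\ forall (c : R) w, grad_h G (cst c) w -> ae0 G w,
      forall v w u, Sn G v -> grad_h G v w -> curl_h G w u -> ae0 G u &
      forall v w q, Se G v -> curl_h G v w -> div_h G w q -> ae0 G q].
Proof.
split; split.
- exact: Sn_cst.
- exact: grad_maps.
- exact: curl_maps.
- exact: div_maps.
- exact: grad_cst.
- exact: curl_grad.
- exact: div_curl.
Qed.
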